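(* (a) Every irreducible unitary representation of $\mathbb G=\mathrm{GL}(\infty,\mathbb Z/p^\mu\mathbb Z)$ is unitarily equivalent to an induced representation $\mathrm{Ind}_{\widehat{\mathbb G}[L;M]}^{\mathbb G}(\tau)$, where $L,M\subset \mathfrak l$ are finitely generated submodules and $\tau$ is a unitary representation of the group $\widehat{\mathbb G}[L;M]$ that is trivial on the subgroup $\mathbb G^\bullet[L;M]$. (b) Two irreducible representations of this kind can be equivalent only for the trivial reason. That is, if $\mathrm{Ind}_{\widehat{\mathbb G}[L_1;M_1]}^{\mathbb G}(\tau_1)$ and $\mathrm{Ind}_{\widehat{\mathbb G}[L_2;M_2]}^{\mathbb G}(\tau_2)$ are irreducible, with $\tau_i$ trivial on $\mathbb G^\bullet[L_i;M_i]$ for $i=1,2$, then they are unitarily equivalent if and only if there exists $h\in\mathbb G$ such that $L_1h=L_2$, $M_1(h^{t})^{-1}=M_2$, and $\tau_2$ is equivalent to the representation $q\mapsto \tau_1(hqh^{-1})$ of $\widehat{\mathbb G}[L_2;M_2]$.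
   Context: Let $p>2$ be a prime, $\mu\ge 1$, $R:=\mathbb Z/p^\mu\mathbb Z$. Let $\mathfrak l$ be the $R$-module of all sequences (row vectors) $v=(v_1,v_2,\dots)$, $v_j\in R$, with $v_j=0$ for all sufficiently large $j$; $R^m\subset\mathfrak l$ denotes the sequences supported in the first $m$ coordinates. $\mathbb G=\mathrm{GL}(\infty,R)$ is the group of all infinite invertible matrices $g$ over $R$ (indexed by $\mathbb N$) such that each row and each column of $g$ and of $g^{-1}$ contains only finitely many nonzero elements. Topology: $g^{(\alpha)}\to g$ iff for every $i$ the $i$-th row of $g^{(\alpha)}$ and the $i$-th column of $g^{(\alpha)}$ are eventually constant and equal to the $i$-th row and the $i$-th column of $g$; equivalently, it is the topology induced by the embedding of $\mathbb G$ in the group of permutations of the countable set $\mathfrak l\oplus\mathfrak l$ given by $(v,w)\mapsto (vg, w(g^t)^{-1})$, where stabilizers of finite sets form a base of neighborhoods of the unit. Unitary representations are strongly continuous. For finitely generated submodules $L,M\subset\mathfrak l$, $\widehat{\mathbb G}[L;M]$ is the subgroup of all $g\in\mathbb G$ with $Lg=L$ and $M(g^t)^{-1}=M$. Definition of $\mathbb G^\bullet[L;M]$: choose $m$ with $L,M\subset R^m$. For a matrix $B$ with $k$ rows put $\ker B=\{v\in R^k: vB=0\}$. Choose, for some $N$, an $m\times N$ matrix $b$ with $\ker b=L$ and an $N\times m$ matrix $c$ with $\ker c^t=M$. Then $\mathbb G^\bullet[L;M]$ is the group of all $g\in\mathbb G$ which, as block matrices of size $m+\infty$, can be written in the form $$g=\begin{pmatrix}1-buc&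 bv\\ wc& z\end{pmatrix}$$ for some matrices $u,v,w,z$ (of sizes $N\times N$, $N\times\infty$, $\infty\times N$, $\infty\times\infty$). This is a subgroup of $\widehat{\mathbb G}[L;M]$ not depending on the choice of $m,b,c$. Induced representation: for an open subgroup $Q\subset\mathbb G$ and a unitary representation $\nu$ of $Q$ in $V$, $\mathrm{Ind}_Q^{\mathbb G}(\nu)$ acts in the Hilbert space of $\ell^2$-functions $f:Q\backslash\mathbb G\to V$ by $(\rho(g)f)(x)=U(g,x)f(xg)$; here one chooses $s(x)\in\mathbb G$ with $x_0s(x)=x$ ($x_0$ the initial point of $Q\backslash\mathbb G$) and sets $U(g,x)=\nu(q)$, where $q\in Q$ is determined by $s(x)g=q\,s(xg)$. It is well defined up to unitary equivalence. *)

(* Defs.v *)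
From HB Require Import structures.
From mathcomp Require Import all_boot all_order all_algebra.
From mathcomp Require Import all_classical all_reals all_analysis.
From mathcomp Require Import complex ring lra.
Import Order.TTheory GRing.Theory Num.Theory.
Import numFieldNormedType.Exports.

Set Implicit Arguments.
Unset Strict Implicit.
Unset Printing Implicit Defensive.

Local Open Scope classical_set_scope.
Local Open Scope ring_scope.

Section InfiniteMatrices.
Variable A : comNzRingType.
Implicit Types (v : nat -> A) (f g h : nat -> nat -> A).

(* Sequences v_1, v_2, ... and matrices indexed by {1, 2, ...} are functions on
   nat, the index being shifted by one.  The module of finitely supported
   sequences is the set of v satisfying finsupp v. *)
Definition finsupp v : Prop := exists n, forall j, (n <= j)%N -> v j = 0.

Definition rcfinite g : Prop :=
  (forall i, finsupp (g i)) /\ (forall j, finsupp (g^~ j)).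

(* In the two products below every sum that occurs has finite support, since
   the columns of the right factor are finite. *)
Definition rowmul v g : nat -> A :=
  fun j => \sum_(i \in [set: nat]) v i * g i j.

Definition immul g h : nat -> nat -> A := fun i => rowmul (g i) h.

Definition im1 : nat -> nat -> A := fun i j => (i == j)%:R.

Definition imtr g : nat -> nat -> A := fun i j => g j i.

Lemma fsbig_ub (F : nat -> A) n : (forall i, (n <= i)%N -> F i = 0) ->
  \sum_(i \in [set: nat]) F i = \sum_(i < n) F i.
Proof.
move=> F0; rewrite fsbig_ord; apply/esym/fsbig_widen => // i [_ /= /negP].
by rewrite -leqNgt; exact: F0.
Qed.

Lemma finsupp_unif (F : nat -> nat -> A) n : (forall k, finsupp (F k)) ->
  exists m, forall k i, (k < n)%N -> (m <= i)%N -> F k i = 0.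
Proof.
move=> Ff; elim: n => [|n [m Hm]]; first by exists 0%N.
have [b Hb] := Ff n; exists (maxn m b) => k i; rewrite ltnS leq_eqVlt geq_max.
by move=> /orP[/eqP ->|kn] /andP[mi bi]; [exact: Hb|exact: Hm].
Qed.

Lemma rowmulA v g h : (forall j, finsupp (g^~ j)) ->
  (forall j, finsupp (h^~ j)) -> rowmul (rowmul v g) h = rowmul v (immul g h).
Proof.
move=> gc hc; apply/funext => j; have [n hn] := hc j.
have [m gm] := finsupp_unif n gc.
have gh i : immul g h i j = \sum_(k < n) g i k * h k j.
  by apply: fsbig_ub => k nk; rewrite hn ?mulr0.
rewrite /rowmul (@fsbig_ub _ n) => [|k nk]; last by rewrite hn ?mulr0.
rewrite (@fsbig_ub _ m) => [|i mi]; last first.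
  by rewrite gh big1 ?mulr0 // => k _; rewrite gm ?mul0r.
under [RHS]eq_bigr do rewrite gh mulr_sumr.
rewrite [RHS]exchange_big; apply: eq_bigr => k _.
rewrite (@fsbig_ub _ m) => [|i mi]; last by rewrite gm ?mulr0.
by rewrite mulr_suml; apply: eq_bigr => i _; rewrite mulrA.
Qed.

Lemma rowmul1 v : rowmul v im1 = v.
Proof.
apply/funext => j; rewrite /rowmul (@fsbig_ub _ j.+1) => [|i ji]; last first.
  by rewrite /im1 gtn_eqF ?mulr0.
rewrite big_ord_recr /= /im1 eqxx mulr1 big1 ?add0r // => i _.
by rewrite ltn_eqF ?mulr0.
Qed.

Lemma immulA f g h : rcfinite g -> rcfinite h ->
  immul f (immul g h) = immul (immul f g) h.
Proof.
by move=> [_ gc] [_ hc]; apply/funext => i; rewrite /immul rowmulA.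
Qed.

Lemma immul1 g : immul g im1 = g.
Proof. by apply/funext => i; exact: rowmul1. Qed.

Lemma im1mul g : immul im1 g = g.
Proof.
apply/funext => i; apply/funext => j.
rewrite /immul /rowmul (@fsbig_ub _ i.+1) => [|k ik]; last first.
  by rewrite /im1 ltn_eqF ?mul0r.
rewrite big_ord_recr /= /im1 eqxx mul1r big1 ?add0r // => k _.
by rewrite gtn_eqF ?mul0r.
Qed.

Lemma rcfinite1 : rcfinite im1.
Proof.
split=> i; exists i.+1 => j ij; rewrite /im1; first by rewrite ltn_eqF.
by rewrite gtn_eqF.
Qed.

Lemma imtr_mul g h : imtr (immul g h) = immul (imtr h) (imtr g).
Proof.
apply/funext => i; apply/funext => j; apply: eq_fsbigr => k _; exact: mulrC.
Qed.

Lemma imtr1 : imtr im1 = im1.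
Proof. by apply/funext => i; apply/funext => j; rewrite /imtr /im1 eq_sym. Qed.

Lemma rcfinite_tr g : rcfinite g -> rcfinite (imtr g).
Proof. by case. Qed.

Lemma rcfinite_mul g h : rcfinite g -> rcfinite h -> rcfinite (immul g h).
Proof.
suff H g' h' : rcfinite g' -> rcfinite h' -> forall i, finsupp (immul g' h' i).
  move=> gf hf; split=> [|j]; first exact: H.
  have := H (imtr h) (imtr g) (rcfinite_tr hf) (rcfinite_tr gf) j.
  by rewrite -imtr_mul.
move=> [gr _] [hr _] i; have [n gn] := gr i; have [m hm] := finsupp_unif n hr.
exists m => j mj; rewrite /immul /rowmul (@fsbig_ub _ n) => [|k nk].
  by rewrite big1 // => k _; rewrite hm ?mulr0.
by rewrite gn ?mul0r.
Qed.

(* The inverse is kept as data; it is determined by the matrix, see gl_inj. *)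
Record GL := MkGL {
  gl_mx :> nat -> nat -> A;
  gl_inv : nat -> nat -> A;
  gl_fin : rcfinite gl_mx;
  gl_inv_fin : rcfinite gl_inv;
  gl_mulV : immul gl_mx gl_inv = im1;
  gl_Vmul : immul gl_inv gl_mx = im1 }.

Lemma gl_inj : injective gl_mx.
Proof.
move=> [g g' gf gf' gg' g'g] [h h' hf hf' hh' h'h] /= gh; subst h.
have gh : g' = h'.
  by rewrite -[LHS]immul1 -hh' immulA // g'g im1mul.
subst h'; congr MkGL; exact: Prop_irrelevance.
Qed.

HB.instance Definition _ := gen_eqMixin GL.
HB.instance Definition _ := gen_choiceMixin GL.

Definition gl_one : GL :=
  MkGL rcfinite1 rcfinite1 (immul1 im1) (immul1 im1).

Definition gl_invg (g : GL) : GL :=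
  MkGL (gl_inv_fin g) (gl_fin g) (gl_Vmul g) (gl_mulV g).

Lemma immul_cancel g h g' h' : rcfinite g -> rcfinite h -> rcfinite g' ->
  rcfinite h' -> immul g g' = im1 -> immul h h' = im1 ->
  immul (immul g h) (immul h' g') = im1.
Proof.
move=> gf hf gf' hf' gg hh.
rewrite immulA // -[immul (immul g h) h']immulA // hh immul1.
exact: gg.
Qed.

Definition gl_mulg (g h : GL) : GL :=
  MkGL (rcfinite_mul (gl_fin g) (gl_fin h))
       (rcfinite_mul (gl_inv_fin h) (gl_inv_fin g))
       (immul_cancel (gl_fin g) (gl_fin h) (gl_inv_fin g) (gl_inv_fin h)
         (gl_mulV g) (gl_mulV h))
       (immul_cancel (gl_inv_fin h) (gl_inv_fin g) (gl_fin h) (gl_fin g)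
         (gl_Vmul h) (gl_Vmul g)).

Lemma gl_mulA : associative gl_mulg.
Proof.
move=> f g h; apply: gl_inj => /=; apply: immulA; exact: gl_fin.
Qed.

Lemma gl_mul1 : right_id gl_one gl_mulg.
Proof. move=> g; apply: gl_inj; exact: immul1. Qed.

Lemma gl_1mul : left_id gl_one gl_mulg.
Proof. move=> g; apply: gl_inj; exact: im1mul. Qed.

Lemma gl_mulgV : right_inverse gl_one gl_invg gl_mulg.
Proof. move=> g; apply: gl_inj; exact: gl_mulV. Qed.

Lemma gl_mulVg : left_inverse gl_one gl_invg gl_mulg.
Proof. move=> g; apply: gl_inj; exact: gl_Vmul. Qed.

HB.instance Definition _ := isGroup.Build GL gl_mulA gl_1mul gl_mul1
  gl_mulVg gl_mulgV.

Lemma imtr_inv g h : immul g h = im1 -> immul (imtr h) (imtr g) = im1.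
Proof. by rewrite -imtr_mul => ->; exact: imtr1. Qed.

Definition gl_tr (g : GL) : GL :=
  MkGL (rcfinite_tr (gl_fin g)) (rcfinite_tr (gl_inv_fin g))
       (imtr_inv (gl_Vmul g)) (imtr_inv (gl_mulV g)).

(* A basic neighbourhood of g consists of the h that agree with g on the rows
   and columns with index < n, so that convergence to g is eventual equality of
   every row and every column. *)
Definition gl_agree (n : nat) (g : GL) : set GL :=
  [set h : GL | forall i j, (i < n)%N || (j < n)%N -> h i j = g i j].

Definition gl_nbhs (g : GL) : set_system GL :=
  [set U | exists n, gl_agree n g `<=` U].

HB.instance Definition _ := hasNbhs.Build GL gl_nbhs.

Lemma gl_nbhs_filter (g : GL) : ProperFilter (nbhs g).
Proof.
split; first by move=> [n] /(_ g); apply.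
split; first by exists 0%N.
- move=> U V [n gU] [m gV]; exists (maxn n m) => h gh; split.
    by apply: gU => i j ij; apply: gh; rewrite !leq_max; case/orP: ij => ->; rewrite ?orbT.
  by apply: gV => i j ij; apply: gh; rewrite !leq_max; case/orP: ij => ->; rewrite ?orbT.
- by move=> U V UV [n gU]; exists n; exact: subset_trans UV.
Qed.

Lemma gl_nbhs_singleton (g : GL) (U : set GL) : nbhs g U -> U g.
Proof. by move=> [n]; apply. Qed.

Lemma gl_nbhs_nbhs (g : GL) (U : set GL) : nbhs g U -> nbhs g (nbhs^~ U).
Proof.
move=> [n gU]; exists n => h gh; exists n => k hk; apply: gU => i j ij.
by rewrite hk ?gh.
Qed.

HB.instance Definition _ :=
  Nbhs_isNbhsTopological.Build GL gl_nbhs_filter gl_nbhs_singleton gl_nbhs_nbhs.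

Implicit Types (L M : set (nat -> A)).

(* L g *)
Definition rowact L (g : GL) : set (nat -> A) := [set rowmul v g | v in L].

(* M (g^t)^-1 *)
Definition corowact M (g : GL) : set (nat -> A) := rowact M (gl_tr g)^-1%g.

Definition fg_submodule L : Prop :=
  exists k (e : 'I_k -> nat -> A), (forall i, finsupp (e i)) /\
    L = [set v | exists a : 'I_k -> A, v = fun j => \sum_(i < k) a i * e i j].

Definition Ghat L M : {pred GL} :=
  [pred g | `[< rowact L g = L /\ corowact M g = M >]].

Lemma GhatP L M (g : GL) :
  reflect (rowact L g = L /\ corowact M g = M) (g \in Ghat L M).
Proof. exact: asboolP. Qed.

Lemma rowactM L (g h : GL) : rowact (rowact L g) h = rowact L (g * h)%g.
Proof.
have E v : rowmul (rowmul v g) h = rowmul v (g * h)%g.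
  by rewrite rowmulA; [|exact: (gl_fin g).2|exact: (gl_fin h).2].
rewrite /rowact image_comp; apply: eq_imagel => v _ /=; exact: E.
Qed.

Lemma rowact1 L : rowact L 1%g = L.
Proof.
rewrite /rowact -[RHS]image_id; apply: eq_imagel => v _; exact: rowmul1.
Qed.

Lemma corowactM M (g h : GL) : corowact (corowact M g) h = corowact M (g * h)%g.
Proof.
rewrite /corowact rowactM -invgM; congr (rowact _ _^-1)%g.
by apply: gl_inj; rewrite /= imtr_mul.
Qed.

Lemma corowact1 M : corowact M 1%g = M.
Proof.
rewrite /corowact (_ : gl_tr 1%g = 1%g) ?invg1 ?rowact1 //.
by apply: gl_inj; exact: imtr1.
Qed.

Lemma Ghat1 L M : 1%g \in Ghat L M.
Proof. by apply/GhatP; rewrite rowact1 corowact1. Qed.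

Lemma GhatM L M : mulg_closed (Ghat L M).
Proof.
move=> g h /GhatP[gL gM] /GhatP[hL hM]; apply/GhatP.
by rewrite -rowactM -corowactM gL gM.
Qed.

Lemma GhatV L M : invg_closed (Ghat L M).
Proof.
move=> g /GhatP[gL gM]; apply/GhatP; split.
  by rewrite -{1}gL rowactM mulgV rowact1.
by rewrite -{1}gM corowactM mulgV corowact1.
Qed.

HB.instance Definition _ L M :=
  monoid.isMulClosed.Build GL (Ghat L M) (@GhatM L M).
HB.instance Definition _ L M :=
  monoid.isMul1Closed.Build GL (Ghat L M) (@Ghat1 L M).
HB.instance Definition _ L M :=
  monoid.isInvClosed.Build GL (Ghat L M) (@GhatV L M).

(* The kernel, inside R^m, of a matrix with m rows. *)
Definition rowker m n (B : 'M[A]_(m, n)) : set (nat -> A) :=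
  [set v | (forall j, (m <= j)%N -> v j = 0) /\ (\row_(i < m) v i) *m B = 0].

(* g is the block matrix (1 - b u c, b v; w c, z) of size m + oo; v, w and z are
   given by their columns, rows and entries. *)
Definition bullet_form m N (b : 'M[A]_(m, N)) (c : 'M[A]_(N, m))
    (u : 'M[A]_N) (v : nat -> 'cV[A]_N) (w : nat -> 'rV[A]_N)
    (z : nat -> nat -> A) (g : GL) : Prop :=
  [/\ forall i j : 'I_m, g i j = (1%:M - b *m u *m c) i j,
      forall (i : 'I_m) j, g i (m + j)%N = (b *m v j) i 0,
      forall i (j : 'I_m), g (m + i)%N j = (w i *m c) 0 j &
      forall i j, g (m + i)%N (m + j)%N = z i j].

(* The group does not depend on the choice of m, b and c, so that membership
   with respect to some choice is the same as with respect to any choice. *)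
Definition Gbullet L M : {pred GL} :=
  [pred g | `[< exists m N (b : 'M[A]_(m, N)) (c : 'M[A]_(N, m)),
    [/\ rowker b = L, rowker c^T = M &
        exists (u : 'M[A]_N) (v : nat -> 'cV[A]_N) (w : nat -> 'rV[A]_N)
          (z : nat -> nat -> A), bullet_form b c u v w z g] >]].

End InfiniteMatrices.

(* hdot is linear in its first argument and antilinear in the second one. *)
Record hilbert (K : realType) := Hilbert {
  hsort :> completeNormedModType K[i];
  hdot : {dot hsort for (Num.conj : K[i] -> K[i])};
  hdotE : forall v : hsort, hdot v v = `|v| ^+ 2 }.

Section Summation.
Variables (K : realType) (X : choiceType).
Implicit Types (a b c : X -> K) (z : X -> K[i]).

Definition rsummable a : Prop := summable [set: X] (EFin \o a).

(* Unordered sums; they are meaningful for (c)summable families only. *)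
Definition rsum a : K :=
  fine (\esum_(x in [set: X]) (Num.max (a x) 0)%:E) -
  fine (\esum_(x in [set: X]) (Num.max (- a x) 0)%:E).

Definition csummable z : Prop :=
  rsummable (fun x => complex.Re (z x)) /\ rsummable (fun x => complex.Im (z x)).

Definition csum z : K[i] :=
  (rsum (fun x => complex.Re (z x)) +i* rsum (fun x => complex.Im (z x)))%C.

Lemma rsummable_le a b : (forall x, `|a x| <= `|b x|) -> rsummable b -> rsummable a.
Proof.
move=> ab; apply: le_lt_trans; apply: le_esum => x _ /=; by rewrite lee_fin.
Qed.

Lemma rsummableD a b : rsummable a -> rsummable b -> rsummable (fun x => a x + b x).
Proof. exact: summableD. Qed.

Lemma rsummableZ k a : rsummable a -> rsummable (fun x => k * a x).
Proof.
move=> sa; suff H n : rsummable (fun x => n%:R * a x).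
  have [n kn] : exists n, `|k| <= n%:R :> K.
    by exists (Num.trunc `|k|).+1; exact/ltW/truncnS_gt.
  apply: rsummable_le (H n) => x; rewrite !normrM ler_wpM2r //.
  by rewrite (le_trans kn) // ler_norm.
elim: n => [|n IHn].
  apply: rsummable_le sa => x; by rewrite mul0r normr0.
rewrite (_ : (fun x => _) = fun x => a x + n%:R * a x); first exact: rsummableD.
by apply/funext => x; rewrite -natr1 mulrDl mul1r addrC.
Qed.

Lemma rsummable_esum a : (forall x, 0 <= a x) ->
  rsummable a -> (\esum_(x in [set: X]) (a x)%:E)%E \is a fin_num.
Proof.
move=> a0 sa; rewrite ge0_fin_numE; last by apply: esum_ge0 => x _; rewrite lee_fin.
apply: le_lt_trans sa; apply: le_esum => x _ /=; by rewrite lee_fin ler_norm.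
Qed.

Lemma maxr_posneg (r : K) : Num.max r 0 - Num.max (- r) 0 = r.
Proof. by case: (leP r 0) => h; case: (leP (- r) 0) => h'; lra. Qed.

Lemma rsumE a b c : (forall x, 0 <= b x) -> (forall x, 0 <= c x) ->
    rsummable b -> rsummable c -> (forall x, a x = b x - c x) ->
  rsum a = fine (\esum_(x in [set: X]) (b x)%:E) -
           fine (\esum_(x in [set: X]) (c x)%:E).
Proof.
move=> b0 c0 sb sc abc.
have p0 (r : K) : 0 <= Num.max r 0 by rewrite le_max lexx orbT.
have sa : rsummable a.
  have -> : a = fun x => b x + (-1) * c x.
    by apply/funext => x; rewrite abc mulN1r.
  by apply: rsummableD => //; exact: rsummableZ.
have sp : rsummable (fun x => Num.max (a x) 0).
  apply: rsummable_le sa => x; rewrite ger0_norm // ge_max ler_norm normr_ge0 //.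
have sn : rsummable (fun x => Num.max (- a x) 0).
  apply: rsummable_le sa => x; rewrite ger0_norm // ge_max normr_ge0 andbT.
  by rewrite -normrN ler_norm.
apply/eqP; rewrite /rsum subr_eq addrAC eq_sym subr_eq; apply/eqP.
rewrite -!fineD ?rsummable_esum //; congr fine.
rewrite -!esumD; try by move=> x _; rewrite lee_fin.
apply: eq_esum => x _; rewrite -!EFinD abc; congr EFin.
have := maxr_posneg (b x - c x); lra.
Qed.

Lemma rsum_ge0E a : (forall x, 0 <= a x) -> rsummable a ->
  rsum a = fine (\esum_(x in [set: X]) (a x)%:E).
Proof.
move=> a0 sa; have s0 : rsummable (fun _ : X => 0 : K).
  by apply: rsummable_le sa => x; rewrite normr0.
rewrite (@rsumE a a (fun=> 0)) // => [|x]; last by rewrite subr0.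
by rewrite [X in _ - fine X]esum1 //= subr0.
Qed.

Let pos a : X -> K := fun x => Num.max (a x) 0.
Let neg a : X -> K := fun x => Num.max (- a x) 0.

Let pos0 a x : 0 <= pos a x. Proof. by rewrite le_max lexx orbT. Qed.
Let neg0 a x : 0 <= neg a x. Proof. by rewrite le_max lexx orbT. Qed.
Let posneg a x : a x = pos a x - neg a x.
Proof.
by rewrite maxr_posneg.
Qed.
Let spos a : rsummable a -> rsummable (pos a).
Proof.
by apply: rsummable_le => x; rewrite ger0_norm // ge_max ler_norm normr_ge0.
Qed.
Let sneg a : rsummable a -> rsummable (neg a).
Proof.
apply: rsummable_le => x; rewrite ger0_norm // ge_max normr_ge0 andbT.
by rewrite -normrN ler_norm.
Qed.
Let esum0 a : (forall x, 0 <= a x) -> rsummable a ->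
  (\esum_(x in [set: X]) (a x)%:E)%E = (rsum a)%:E.
Proof. by move=> a0 sa; rewrite rsum_ge0E // fineK // rsummable_esum. Qed.

Lemma rsumD a b : rsummable a -> rsummable b ->
  rsum (fun x => a x + b x) = rsum a + rsum b.
Proof.
move=> sa sb; rewrite (@rsumE _ (fun x => pos a x + pos b x)
  (fun x => neg a x + neg b x)) => [|x|x|||x]; last first.
- by rewrite {1}[a x]posneg {1}[b x]posneg; ring.
- by apply: rsummableD; exact: sneg.
- by apply: rsummableD; exact: spos.
- by rewrite addr_ge0.
- by rewrite addr_ge0.
under eq_esum do rewrite EFinD.
under [X in _ - fine X]eq_esum do rewrite EFinD.
rewrite !esumD; try by move=> x _; rewrite lee_fin.
rewrite !fineD ?rsummable_esum //; try exact: spos; try exact: sneg.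
by rewrite /rsum; ring.
Qed.

Lemma rsumN a : rsum (fun x => - a x) = - rsum a.
Proof.
rewrite /rsum opprB; congr (_ - fine _); apply: eq_esum => x _.
by rewrite opprK.
Qed.

Lemma rsumZ k a : rsummable a -> rsum (fun x => k * a x) = k * rsum a.
Proof.
have ge0 k' c : 0 <= k' -> (forall x, 0 <= c x) -> rsummable c ->
    rsum (fun x => k' * c x) = k' * rsum c.
  move=> k0 c0 sc; rewrite !rsum_ge0E //; last 2 first.
  - by move=> x; rewrite mulr_ge0.
  - exact: rsummableZ.
  rewrite -[k' * _]/(fine (k'%:E) * _) -fineM ?rsummable_esum //; congr fine.
  rewrite /esum -ereal_supZl //; last first.
    by apply/set0P; exists 0%E, set0; [split|rewrite fsbig_set0].
  congr ereal_sup; apply/seteqP; split=> y /=.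
    move=> [F FX <-]; exists (\sum_(x \in F) (c x)%:E)%E; first by exists F.
    by rewrite ge0_mule_fsumr // => x; rewrite lee_fin.
  move=> [_ [F FX <-] <-]; exists F => //.
  by rewrite ge0_mule_fsumr // => x; rewrite lee_fin.
wlog k0 : k / 0 <= k => [H|] sa.
  have [k0|/ltW k0] := leP 0 k; first exact: H.
  rewrite -[k in RHS]opprK mulNr -H ?oppr_ge0 // -rsumN.
  by congr rsum; apply/funext => x; rewrite mulNr opprK.
have e : rsum a = rsum (pos a) - rsum (neg a).
  rewrite -rsumN -rsumD; last 2 first.
  - exact: spos.
  - have := rsummableZ (-1) (sneg sa); congr rsummable.
    by apply/funext => x; rewrite mulN1r.
  by congr rsum; apply/funext => x; exact: posneg.
rewrite e mulrBr -!ge0 //; [|exact: sneg|exact: spos].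
rewrite -rsumN -rsumD; last 2 first.
- by apply: rsummableZ; exact: spos.
- have := rsummableZ (- k) (sneg sa); congr rsummable.
  by apply/funext => x; rewrite mulNr.
by congr rsum; apply/funext => x; rewrite {1}[a x]posneg mulrBr.
Qed.

End Summation.

Section DotTriangle.
Variables (C : numClosedFieldType) (U : lmodType C).
Variable form : {dot U for (Num.conj : C -> C)}.
Local Notation "z ^*" := (Num.conj z).

Lemma dot_triangle (u v : U) :
  sqrtC (form (u + v) (u + v)) <= sqrtC (form u u) + sqrtC (form v v).
Proof.
have [->|u0] := eqVneq u 0; first by rewrite add0r linear0l sqrtC0 add0r.
have [->|v0] := eqVneq v 0; first by rewrite addr0 linear0l sqrtC0 addr0.
set s := sqrtC (form u u); set t := sqrtC (form v v).
have s0 : 0 < s by rewrite sqrt_dnorm_gt0.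
have t0 : 0 < t by rewrite sqrt_dnorm_gt0.
rewrite -(@ler_pXn2r _ 2) ?nnegrE ?sqrt_dnorm_ge0 ?addr_ge0 ?sqrt_dnorm_ge0 // sqrtCK.
have su : form u u = s ^+ 2 by rewrite sqrtCK.
have tv : form v v = t ^+ 2 by rewrite sqrtCK.
rewrite dnormD /= sqrrD su tv [leRHS]addrAC lerD2l.
set d := form u v; rewrite -(ler_pM2l (mulr_gt0 t0 s0)).
have := dnorm_ge0 form (t *: u - s *: v).
rewrite dnormB !dnormZ !gtr0_norm // su tv.
have sJ : s^* = s by apply: CrealP; rewrite gtr0_real.
have tJ : t^* = t by apply: CrealP; rewrite gtr0_real.
have -> : form (t *: u) (s *: v) = t * (s * d).
  by rewrite linearZl_LR linearZr_LR /= sJ.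
rewrite !rmorphM /= sJ tJ subr_ge0.
suff -> : t ^+ 2 * s ^+ 2 + s ^+ 2 * t ^+ 2 = t * s * (s * t *+ 2).
  by apply: le_trans; rewrite mulrDr !mulrA.
by rewrite mulr2n; ring.
Qed.

End DotTriangle.

Section ComplexSummation.
Variables (K : realType) (X : choiceType).
Implicit Types (z w : X -> K[i]).

Lemma csumD z w : csummable z -> csummable w ->
  csum (fun x => z x + w x) = csum z + csum w.
Proof.
move=> [zr zi] [wr wi]; apply/eqP; rewrite eq_complex /= -!rsumD //.
by apply/andP; split; apply/eqP; congr rsum; apply/funext => x; case: (z x) (w x) => [? ?] [? ?].
Qed.

Lemma csumZ (k : K[i]) z : csummable z -> csum (fun x => k * z x) = k * csum z.
Proof.
case: k => [a b] [zr zi]; rewrite /csum.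
have -> : (fun x => complex.Re ((a +i* b)%C * z x)) =
    fun x => a * complex.Re (z x) + (- b) * complex.Im (z x).
  by apply/funext => x; case: (z x) => [? ?] /=; rewrite mulNr.
have -> : (fun x => complex.Im ((a +i* b)%C * z x)) =
    fun x => a * complex.Im (z x) + b * complex.Re (z x).
  by apply/funext => x; case: (z x) => [? ?] /=.
rewrite !rsumD ?rsumZ //; try exact: rsummableZ.
by apply/eqP; rewrite eq_complex /= mulNr !eqxx.
Qed.

Lemma csum_conj z : csum (fun x => Num.conj (z x)) = Num.conj (csum z).
Proof.
rewrite /csum -[RHS]/(_ -i* _)%C -rsumN; congr Complex; congr rsum.
  by apply/funext => x; case: (z x).
by apply/funext => x; case: (z x).
Qed.

Lemma csum_real (a : X -> K) : csum (fun x => (a x)%:C%C) = (rsum a)%:C%C.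
Proof.
rewrite /csum -[RHS]/(_ +i* 0)%C; congr Complex => /=.
have := rsumN (fun _ : X => 0 : K); rewrite oppr0 => /esym/eqP.
by rewrite eqNr => /eqP.
Qed.

End ComplexSummation.

Section HilbertTheory.
Variables (K : realType) (H : hilbert K).
Implicit Types u v : H.

Definition nsq v : K := complex.Re (`|v| ^+ 2).

Definition rnorm v : K := complex.Re `|v|.

Lemma rnormE v : `|v| = (rnorm v)%:C%C.
Proof. by rewrite /rnorm RRe_real // ger0_real. Qed.

Lemma rnorm_ge0 v : 0 <= rnorm v.
Proof. by rewrite -ler0c -rnormE. Qed.

Lemma nsqE v : nsq v = rnorm v ^+ 2.
Proof. by rewrite /nsq rnormE -rmorphXn. Qed.

Lemma nsq_ge0 v : 0 <= nsq v.
Proof. by rewrite nsqE sqr_ge0. Qed.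

Lemma hdot_nsq v : hdot H v v = (nsq v)%:C%C.
Proof. by rewrite hdotE nsqE rnormE rmorphXn. Qed.

Lemma nsqD u v : nsq (u + v) = nsq u + nsq v + complex.Re (hdot H u v) *+ 2.
Proof.
apply: complexI; rewrite -hdot_nsq dnormD !hdot_nsq.
by case: (hdot H u v) => a b; apply/eqP; rewrite eq_complex /=; apply/andP; split; apply/eqP; ring.
Qed.

Lemma nsqN v : nsq (- v) = nsq v.
Proof. by rewrite /nsq normrN. Qed.

Lemma nsqZ (k : K[i]) v : nsq (k *: v) = complex.Re (`|k| ^+ 2) * nsq v.
Proof.
have kE : `|k| = (complex.Re `|k|)%:C%C by rewrite RRe_real // ger0_real.
by rewrite !nsqE /rnorm normrZ rnormE kE -rmorphM -rmorphXn /= exprMn.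
Qed.

Lemma Re_hdot_le u v : `|complex.Re (hdot H u v)| <= nsq u + nsq v.
Proof.
have := nsq_ge0 (u + v); have := nsq_ge0 (u - v).
rewrite !nsqD nsqN linearNr raddfN /=.
have := nsq_ge0 u; have := nsq_ge0 v; rewrite ler_norml.
by move=> *; apply/andP; split; lra.
Qed.

Lemma Im_hdot_le u v : `|complex.Im (hdot H u v)| <= nsq u + nsq v.
Proof.
have -> : nsq v = nsq ('i%C *: v).
  have i1 : `|'i%C : K[i]| = 1 by rewrite normc_def /= expr0n expr1n add0r sqrtr1.
  by rewrite nsqZ i1 expr1n mul1r.
apply: le_trans (Re_hdot_le _ _); rewrite linearZr_LR /=.
by case: (hdot H u v) => a b /=; rewrite mul0r mulN1r sub0r opprK.
Qed.

Lemma nsqD_le u v : nsq (u + v) <= nsq u *+ 2 + nsq v *+ 2.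
Proof.
have := nsq_ge0 (u - v); rewrite !nsqD nsqN linearNr raddfN /=; lra.
Qed.

End HilbertTheory.

Section L2.
Variables (K : realType) (X : choiceType) (H : hilbert K).

(* The square-summable functions X -> H. *)
Definition l2_pred : {pred X -> H} :=
  [pred f | `[< rsummable (fun x => nsq (f x)) >]].

Lemma l2P f : reflect (rsummable (fun x => nsq (f x))) (f \in l2_pred).
Proof. exact: asboolP. Qed.

Lemma l2_submod_closed : submod_closed l2_pred.
Proof.
split=> [|k f g /l2P sf /l2P sg]; apply/l2P.
  rewrite (_ : (fun x => _) = fun=> 0); last first.
    by apply/funext => x; rewrite /nsq normr0 expr0n.
  by rewrite /rsummable /summable esum1 // => x _ /=; rewrite normr0.
have := rsummableD (rsummableZ (complex.Re (`|k| ^+ 2) *+ 2) sf) (rsummableZ 2 sg).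
apply: rsummable_le => x; rewrite ger0_norm ?nsq_ge0 //.
apply: le_trans (ler_norm _); apply: le_trans (nsqD_le _ _) _.
by rewrite nsqZ; lra.
Qed.

HB.instance Definition _ := GRing.isSubmodClosed.Build _ _ l2_pred l2_submod_closed.

Record l2 := MkL2 { l2_fun :> X -> H; l2_funP : l2_fun \in l2_pred }.

HB.instance Definition _ := [isSub for l2_fun].
HB.instance Definition _ := [Choice of l2 by <:].
HB.instance Definition _ := [SubChoice_isSubLmodule of l2 by <:].

Definition l2_dot (f g : l2) : K[i] := csum (fun x => hdot H (f x) (g x)).

Lemma l2_rsummable (f : l2) : rsummable (fun x => nsq (f x)).
Proof. exact/l2P/l2_funP. Qed.

Lemma l2_csummable (f g : l2) : csummable (fun x => hdot H (f x) (g x)).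
Proof.
have := rsummableD (l2_rsummable f) (l2_rsummable g).
move=> s; split; apply: rsummable_le s => x;
  apply: le_trans (ler_norm _); [exact: Re_hdot_le|exact: Im_hdot_le].
Qed.

Lemma l2_dot_herm (f g : l2) : l2_dot f g = (-1) ^+ false * Num.conj (l2_dot g f).
Proof.
rewrite expr0 mul1r -csum_conj; congr csum; apply/funext => x.
by rewrite hermC expr0 mul1r.
Qed.

Lemma l2_dot_linearl (g : l2) : linear_for *%R (l2_dot^~ g).
Proof.
move=> k f f'; rewrite /l2_dot.
transitivity (csum (fun x => hdot H ((k *: f) x) (g x) + hdot H (f' x) (g x))).
  by congr csum; apply/funext => x; rewrite linearDl.
rewrite csumD; [|exact: l2_csummable (k *: f) g|exact: l2_csummable f' g].
congr (_ + _); rewrite -csumZ; last exact: l2_csummable f g.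
by congr csum; apply/funext => x; rewrite linearZl_LR.
Qed.

Lemma l2_dot_bilinear :
  bilinear_for *%R (Num.conj \; *%R) (l2_dot : l2 -> l2 -> K[i]).
Proof.
split=> [g|f]; first exact: l2_dot_linearl.
move=> k g g'; rewrite ![l2_dot f _]l2_dot_herm !expr0 !mul1r l2_dot_linearl.
by rewrite rmorphD rmorphM.
Qed.

HB.instance Definition _ := bilinear_isBilinear.Build _ l2 l2 _ _ _ l2_dot
  l2_dot_bilinear.

HB.instance Definition _ :=
  isHermitianSesquilinear.Build _ l2 false Num.conj l2_dot l2_dot_herm.

Lemma l2_dotE (f : l2) : l2_dot f f = (rsum (fun x => nsq (f x)))%:C%C.
Proof.
by rewrite -csum_real; congr csum; apply/funext => x; rewrite hdot_nsq.
Qed.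

Lemma rsum_nsq_ge (f : l2) x : nsq (f x) <= rsum (fun x => nsq (f x)).
Proof.
rewrite rsum_ge0E; [|by move=> y; exact: nsq_ge0|exact: l2_rsummable].
rewrite -lee_fin fineK; last first.
  by apply: rsummable_esum; [move=> y; exact: nsq_ge0|exact: l2_rsummable].
apply: esum_ge; exists [set x]; first by split.
by rewrite fsbig_set1.
Qed.

Lemma l2_dot_gt0 (f : l2) : f != 0 -> 0 < l2_dot f f.
Proof.
move=> f0; rewrite l2_dotE ltcR lt_neqAle; apply/andP; split; last first.
  rewrite rsum_ge0E; [|by move=> y; exact: nsq_ge0|exact: l2_rsummable].
  apply/fine_ge0/esum_ge0 => x _; rewrite lee_fin; exact: nsq_ge0.
apply: contra f0 => /eqP f0; apply/eqP/val_inj/funext => x /=.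
have := rsum_nsq_ge f x; rewrite -f0 => fx; apply/eqP.
have : nsq (f x) == 0 by rewrite eq_le fx nsq_ge0.
by rewrite nsqE sqrf_eq0 -(inj_eq (@complexI K)) -rnormE normr_eq0.
Qed.

HB.instance Definition _ := isDotProduct.Build _ l2 l2_dot l2_dot_gt0.

Definition l2_norm (f : l2) : K[i] := sqrtC (l2_dot f f).

Lemma l2_normD (f g : l2) : l2_norm (f + g) <= l2_norm f + l2_norm g.
Proof. exact: dot_triangle. Qed.

Lemma l2_normZ (k : K[i]) (f : l2) : l2_norm (k *: f) = `|k| * l2_norm f.
Proof.
rewrite /l2_norm dnormZ sqrtCM ?nnegrE ?exprn_ge0 ?dnorm_ge0 //.
by rewrite sqrCK.
Qed.

Lemma l2_norm0 (f : l2) : l2_norm f = 0 -> f = 0.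
Proof. by move/eqP; rewrite sqrtC_eq0 dnorm_eq0 => /eqP. Qed.

HB.instance Definition _ :=
  Lmodule_isNormed.Build K[i] l2 l2_normD l2_normZ l2_norm0.

Lemma l2_normE (f : l2) : `|f| ^+ 2 = (rsum (fun x => nsq (f x)))%:C%C.
Proof. by rewrite -l2_dotE [LHS]sqrtCK. Qed.

Lemma l2_norm_lt (f : l2) (e : K) : 0 < e ->
  rsum (fun x => nsq (f x)) < e ^+ 2 -> `|f| < e%:C%C.
Proof.
move=> e0 fe; rewrite -(@ltr_pXn2r _ 2) ?nnegrE ?ler0c ?(ltW e0) //.
by rewrite l2_normE -rmorphXn ltcR.
Qed.

Lemma l2_norm_ltP (f : l2) (e : K) : 0 < e ->
  `|f| < e%:C%C -> rsum (fun x => nsq (f x)) < e ^+ 2.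
Proof.
move=> e0; rewrite -(@ltr_pXn2r _ 2) ?nnegrE ?ler0c ?(ltW e0) //.
by rewrite l2_normE -rmorphXn ltcR.
Qed.

Lemma l2_eval_le (f : l2) x : `|f x| <= `|f|.
Proof.
rewrite -(@ler_pXn2r _ 2) ?nnegrE // l2_normE rnormE -rmorphXn -nsqE lecR.
exact: rsum_nsq_ge.
Qed.

Lemma rnorm_cts : continuous (@rnorm K H).
Proof.
move=> v; apply/cvgrPdist_lt => e e0.
have e0' : 0 < e%:C%C by have := e0; rewrite -ltcR.
have /cvgrPdist_lt /(_ _ e0') : w @[w --> v] --> v by exact: cvg_id.
apply: filterS => w vw.
rewrite -ltcR; apply: le_lt_trans vw.
have := ler_dist_dist v w; rewrite !rnormE -rmorphB /= normc_def /= expr0n addr0.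
by rewrite sqrtr_sqr.
Qed.

Lemma nsq_cts : continuous (@nsq K H).
Proof.
have -> : @nsq K H = fun v => rnorm v * rnorm v.
  by apply/funext => v; rewrite nsqE expr2.
by move=> v; apply: cvgM; exact: rnorm_cts.
Qed.

Lemma l2_complete (F : set_system l2) : ProperFilter F -> cauchy F -> cvg F.
Proof.
move=> FF /cauchy_ballP cF.
have evcvg x : cvg ((fun f : l2 => f x) @ F).
  apply/cauchy_cvgP/cauchy_ballP => e e0; near_simpl.
  have := cF e e0; apply: filterS => -[f g]; rewrite -!ball_normE /=.
  by apply: le_lt_trans; exact: (l2_eval_le (f - g)).
pose l x := lim ((fun f : l2 => f x) @ F).
have lim_le (f : l2) (e : K) : 0 < e ->
    (\forall g \near F, `|f - g| < e%:C%C) ->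
    (\esum_(x in [set: X]) (nsq (l x - f x))%:E <= (e ^+ 2)%:E)%E.
  move=> e0 Fg; apply: ge_ereal_sup => _ [S [finS _] <-].
  rewrite fsbig_finite //= sumEFin lee_fin.
  set r := finmap.enum_fset (fset_set S).
  have cS : (\sum_(x <- r) nsq (g x - f x)) @[g --> F] -->
      \sum_(x <- r) nsq (l x - f x).
    apply: cvg_big => [|x _]; first exact: add_continuous.
    apply: continuous_cvg; first exact: nsq_cts.
    by apply: cvgB; [exact: evcvg|exact: cvg_cst].
  rewrite -(cvg_lim _ cS) //; apply: limr_le; first by apply/cvg_ex; eexists; exact: cS.
  move: Fg; apply: filterS => g fg.
  have {}fg : `|g - f| < e%:C%C by rewrite distrC.
  apply/ltW; apply: le_lt_trans (l2_norm_ltP e0 fg).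
  rewrite rsum_ge0E; [|by move=> y; exact: nsq_ge0|exact: l2_rsummable].
  rewrite -lee_fin fineK; last first.
    by apply: rsummable_esum; [move=> y; exact: nsq_ge0|exact: l2_rsummable].
  apply: esum_ge; exists S; first by split.
  by rewrite fsbig_finite //= sumEFin.
have sum_lf (f : l2) (e : K) : 0 < e ->
    (\forall g \near F, `|f - g| < e%:C%C) -> (fun x => l x - f x) \in l2_pred.
  move=> e0 Fg; apply/l2P; apply: le_lt_trans (ltry (e ^+ 2)).
  apply: le_trans (lim_le f e e0 Fg); apply: le_esum => x _ /=.
  by rewrite ger0_norm ?nsq_ge0.
have nearF (e : K) : 0 < e -> \forall f \near F, \forall g \near F, `|f - g| < e%:C%C.
  move=> e0; have e0' : 0 < e%:C%C by have := e0; rewrite -ltcR.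
  have := cF _ e0'; move/nearP_dep; apply: filterS => f; apply: filterS => g.
  by rewrite -ball_normE.
have ll2 : l \in l2_pred.
  have [f Ff] : exists f, \forall g \near F, `|f - g| < 1%:C%C.
    exact: filter_ex (nearF 1 ltr01).
  have -> : l = (fun x => l x - f x) + (f : X -> H).
    by apply/funext => x; rewrite /= [RHS]subrK.
  by apply: rpredD; [exact: sum_lf Ff|exact: l2_funP].
apply/cvg_ex; exists (MkL2 ll2); apply/cvgrPdist_lt => e e0.
have [r r0 er] : exists2 r : K, 0 < r & e = r%:C%C.
  exists (complex.Re e); last by rewrite RRe_real // gtr0_real.
  by move: e0; rewrite ltcE => /andP[].
have r20 : 0 < r / 2 by rewrite divr_gt0.
have := nearF _ r20; apply: filterS => f Ff; rewrite er; apply: l2_norm_lt => //.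
rewrite rsum_ge0E; [|by move=> y; exact: nsq_ge0|exact: l2_rsummable].
apply: (@le_lt_trans _ _ ((r / 2) ^+ 2)).
  rewrite -lee_fin fineK; last first.
    by apply: rsummable_esum; [move=> y; exact: nsq_ge0|exact: l2_rsummable].
  exact: lim_le.
by rewrite ltr_pXn2r ?nnegrE ?ltW // ltr_pdivrMr // ltr_pMr // ltr1n.
Qed.

HB.instance Definition _ := Uniform_isComplete.Build l2 l2_complete.

Lemma l2_hdotE (f : l2) : l2_dot f f = `|f| ^+ 2.
Proof. by rewrite [RHS]sqrtCK. Qed.

Definition l2_hilbert : hilbert K := @Hilbert K l2 l2_dot l2_hdotE.

End L2.

Section Representations.
Variables (K : realType) (A : comNzRingType).
Local Notation G := (GL A).

(* A unitary representation of the subgroup Q.  The values of ur_act outside Q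
   are irrelevant. *)
Record urep (Q : {pred G}) := URep {
  ur_space :> hilbert K;
  ur_act : G -> ur_space -> ur_space;
  ur_linear : {in Q, forall g, linear (ur_act g)};
  ur_act1 : forall v, ur_act 1%g v = v;
  ur_actM : {in Q &, forall g h v, ur_act (g * h)%g v = ur_act g (ur_act h v)};
  ur_hdot : {in Q, forall g u v,
    hdot ur_space (ur_act g u) (ur_act g v) = hdot ur_space u v};
  ur_cont : forall v, {within [set` Q], continuous (ur_act^~ v)} }.

Arguments ur_act [Q] _ _ _.

Definition unitarily_equivalent (Q : {pred G}) (H1 H2 : hilbert K)
    (a1 : G -> H1 -> H1) (a2 : G -> H2 -> H2) : Prop :=
  exists T : H1 -> H2, [/\ linear T, bijective T,
    forall u v, hdot H2 (T u) (T v) = hdot H1 u v &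
    {in Q, forall g v, T (a1 g v) = a2 g (T v)}].

(* The zero space is not irreducible. *)
Definition irreducible (Q : {pred G}) (H : hilbert K) (a : G -> H -> H) : Prop :=
  (exists v : H, v != 0) /\
  forall W : {pred H}, submod_closed W -> closed [set` W] ->
    {in Q, forall g, {in W, forall v, a g v \in W}} ->
    W =i pred1 0 \/ W =i predT.

Definition rcoset (Q : {pred G}) (g : G) : set G := [set (q * g)%g | q in [set` Q]].

(* Q \ G *)
Definition rcosets (Q : {pred G}) : Type :=
  {x : set G | `[< exists g, x = rcoset Q g >]}.

HB.instance Definition _ Q := Choice.on (rcosets Q).

Lemma rcoset_trans (Q : {pred G}) (x : rcosets Q) (g : G) :
  `[< exists h, [set (y * g)%g | y in val x] = rcoset Q h >].
Proof.
case: x => x /= /asboolP[h ->]; apply/asboolP; exists (h * g)%g.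
rewrite /rcoset image_comp; apply: eq_imagel => q _ /=.
by rewrite mulgA.
Qed.

Definition rcoset_act (Q : {pred G}) (x : rcosets Q) (g : G) : rcosets Q :=
  exist (fun y => `[< exists h, y = rcoset Q h >])
    [set (y * g)%g | y in val x] (rcoset_trans x g).

(* A representative s(x) of the coset x; x0 s(x) = x is rcoset_repP. *)
Definition rcoset_rep (Q : {pred G}) (x : rcosets Q) : G := xget 1%g (val x).

Section Induced.
Variables (Q : groupClosed G) (nu : urep Q).
Implicit Types (x : rcosets Q) (g : G).

Lemma rcoset_repP x : val x = rcoset Q (rcoset_rep x).
Proof.
rewrite /rcoset_rep; case: x => x /= /asboolP[h ->].
have : rcoset Q h (xget 1%g (rcoset Q h)).
  by apply: xgetPex; exists h, 1%g; [exact: gpred1|rewrite mul1g].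
move=> [q /= qQ <-]; apply/seteqP; split=> y [r /= rQ <-].
  by exists (r / q)%g; [exact: gpredF|rewrite mulgA mulgVK].
by exists (r * q)%g; [exact: gpredM|rewrite mulgA].
Qed.

Lemma rcoset_actM x g h : rcoset_act (rcoset_act x g) h = rcoset_act x (g * h)%g.
Proof.
apply: val_inj; rewrite /= image_comp; apply: eq_imagel => y _ /=.
by rewrite mulgA.
Qed.

Lemma rcoset_act1 x : rcoset_act x 1%g = x.
Proof.
apply: val_inj; rewrite /= -[RHS]image_id; apply: eq_imagel => y _ /=.
exact: mulg1.
Qed.

(* The element q of Q such that s(x) g = q s(x g). *)
Definition ind_cocycle g x : G :=
  (rcoset_rep x * g * (rcoset_rep (rcoset_act x g))^-1)%g.

Lemma ind_cocycleP g x : ind_cocycle g x \in (Q : {pred G}).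
Proof.
have : val (rcoset_act x g) (rcoset_rep x * g)%g.
  exists (rcoset_rep x) => //; rewrite rcoset_repP.
  by exists 1%g; [exact: gpred1|rewrite mul1g].
rewrite rcoset_repP => -[q qQ qE]; rewrite /ind_cocycle -qE mulgK.
exact: qQ.
Qed.

Definition ind_fun g (f : rcosets Q -> nu) : rcosets Q -> nu :=
  fun x => ur_act nu (ind_cocycle g x) (f (rcoset_act x g)).

Lemma ind_fun_l2 g (f : l2 (rcosets Q) nu) :
  ind_fun g f \in @l2_pred K (rcosets Q) nu.
Proof.
apply/l2P; have := l2_rsummable f; rewrite /rsummable /summable.
have bij : set_bij [set: rcosets Q] [set: rcosets Q] (fun x => rcoset_act x g).
  split=> //.
    move=> x y _ _ /(congr1 (fun y => rcoset_act y g^-1%g)).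
    by rewrite !rcoset_actM mulgV !rcoset_act1.
  move=> x _; exists (rcoset_act x g^-1%g) => //.
  by rewrite rcoset_actM mulVg rcoset_act1.
rewrite (reindex_esum _ _ _ _ bij); congr (_ < _)%E; apply: eq_esum => x _ /=.
congr (`|_|%:E); apply: complexI; rewrite -!hdot_nsq.
by rewrite ur_hdot // ind_cocycleP.
Qed.

Definition Ind g (f : l2_hilbert (rcosets Q) nu) : l2_hilbert (rcosets Q) nu :=
  MkL2 (ind_fun_l2 g f).

End Induced.
End Representations.

Arguments ur_act [K A Q] _ _ _.
Arguments Ind [K A Q] _ _ _.

(* Main.v *)
(* To submodules L and M attach the transvections 1 + phi a with phi in the
   annihilator of L, a in the annihilator of M and a phi = 0, and the space W(L, M)
   of the vectors that they fix.  Every element of Gbullet L M is, up to elements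
   close to 1, a product of such transvections, so W(L, M) is fixed by Gbullet L M;
   conversely these transvections belong to Gbullet L M, since Z/p^mu is
   self-injective.

   Let phi be supported in the first m coordinates, xi be fixed by the pointwise
   stabilizer of these coordinates, and e_j be the coordinate vectors.  The vectors
   (1 + phi e_j) xi, j >= m, have equal norms and equal pairwise scalar products, so
   their averages converge, and the limit is the projection of xi to the vectors
   fixed by the 1 + phi e_j.  The projections obtained in this way, and those for
   the transvections 1 + e_j a, preserve each other's images: the projection to
   W(L, M) maps W(L', M') to W(L /\ L', M /\ M').

   An irreducible representation has W(L, M) <> 0 for some finitely generated L and
   M; for a minimal such pair, the translates of W(L, M) by elements outside
   Ghat L M are orthogonal to W(L, M), hence the representation is induced from
   W(L, M).  As for uniqueness, a square-summable function on Ghat L1 M1 \ G fixed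
   by the transvections of (L2, M2) vanishes at the points with an infinite orbit,
   so that it is supported at the g with L1 g in L2 and M1 g in M2; by symmetry and
   finiteness these are equalities. *)
From HB Require Import structures.
From mathcomp Require Import finmap.
Require Import Defs.
From mathcomp Require Import all_boot all_order all_algebra.
From mathcomp Require Import all_classical all_reals all_analysis.
From mathcomp Require Import complex ring lra zify.
Import Order.TTheory GRing.Theory Num.Theory.
Import numFieldNormedType.Exports.

Set Implicit Arguments.
Unset Strict Implicit.
Unset Printing Implicit Defensive.

Local Open Scope classical_set_scope.
Local Open Scope ring_scope.

(** * Hilbert spaces *)

(** The open subgroups [Kg n] are not compact, so fixed vectors cannot be produced by integration. A
    vector fixed by some [Kg n] comes instead from the vector of least norm in the closed convex
    hull of an orbit. For transvections, the pairwise products are equal because [Kg m] fixes phi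
    and carries a coordinate row e_j, j >= m, to any finitely supported row beyond m with j-th
    coordinate 1; this covers the differences e_i - e_j.

    Duality over the ring is used in the form that a submodule of R^m is its own double annihilator.
    Hence the annihilator of an intersection is the sum of the annihilators, which is why projecting
    W(L', M') leads into the space of the intersections; and a vector outside L is detected by a
    column annihilating L, which yields the infinite orbits. Finiteness of the ring makes |L| + |M|
    a measure of minimality, and turns an inclusion of L1 g in L2 into an equality once there is one
    in the opposite direction.

    Equivalences with induced representations are obtained by comparing matrix coefficients on
    cyclic families. *)

Section RealDot.
Variables (K : realType) (H : hilbert K).
Implicit Types u v w : H.

(** Estimates are made in the underlying real Hilbert space, whose scalars are ordered; [hdot_rdot]
    recovers the complex product from it. *)
Definition rdot u v : K := complex.Re (hdot H u v).

Lemma hdotC u v : hdot H u v = Num.conj (hdot H v u).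
Proof. by rewrite hermC expr0 mul1r. Qed.

Lemma hdot_rdot u v : hdot H u v = (rdot u v +i* rdot u ('i%C *: v))%C.
Proof.
rewrite /rdot linearZr_LR /=; case: (hdot H u v) => a b /=.
by rewrite mul0r mulN1r sub0r opprK.
Qed.

Lemma rdotC u v : rdot u v = rdot v u.
Proof. by rewrite /rdot hdotC; case: (hdot H v u). Qed.

Lemma rdotDl u v w : rdot (u + v) w = rdot u w + rdot v w.
Proof. by rewrite /rdot linearDl raddfD. Qed.

Lemma rdotNl u w : rdot (- u) w = - rdot u w.
Proof. by rewrite /rdot linearNl raddfN. Qed.

Lemma rdotBl u v w : rdot (u - v) w = rdot u w - rdot v w.
Proof. by rewrite rdotDl rdotNl. Qed.

Lemma rdotZl (k : K) u w : rdot (k%:C%C *: u) w = k * rdot u w.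
Proof. by rewrite /rdot linearZl_LR /=; case: (hdot H u w) => a b /=; rewrite mul0r subr0. Qed.

Lemma rdot0l w : rdot 0 w = 0.
Proof. by rewrite /rdot linear0l. Qed.

Lemma rdotNr u w : rdot w (- u) = - rdot w u.
Proof. by rewrite !(rdotC w) rdotNl. Qed.

Lemma rdotZr (k : K) u w : rdot w (k%:C%C *: u) = k * rdot w u.
Proof. by rewrite !(rdotC w) rdotZl. Qed.

Lemma rdot_suml n (F : 'I_n -> H) w : rdot (\sum_i F i) w = \sum_i rdot (F i) w.
Proof.
elim/big_ind2: _ => // [|x u y v <- <-]; [exact: rdot0l|exact: rdotDl].
Qed.

Lemma rdot_nsq v : rdot v v = nsq v.
Proof. by rewrite /rdot hdot_nsq. Qed.

Lemma nsqB u v : nsq (u - v) = nsq u + nsq v - rdot u v *+ 2.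
Proof. by rewrite nsqD nsqN -/(rdot u (- v)) rdotNr mulNrn. Qed.

Lemma nsqZr (k : K) v : nsq (k%:C%C *: v) = k ^+ 2 * nsq v.
Proof. by rewrite -!rdot_nsq rdotZl rdotZr mulrA. Qed.

Lemma nsq0 : nsq (0 : H) = 0.
Proof. by rewrite -rdot_nsq rdot0l. Qed.

Lemma nsq_eq0 v : nsq v = 0 -> v = 0.
Proof.
by move/eqP; rewrite nsqE sqrf_eq0 -(inj_eq (@complexI K)) -rnormE normr_eq0 => /eqP.
Qed.

Lemma rdot_CS u v : rdot u v ^+ 2 <= nsq u * nsq v.
Proof.
have [/eqP/nsq_eq0 ->|v0] := boolP (nsq v == 0).
  by rewrite rdotC rdot0l nsq0 expr0n mulr0.
have {v0} v0 : 0 < nsq v by rewrite lt_neqAle eq_sym v0 nsq_ge0.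
have := nsq_ge0 (u - (rdot u v / nsq v)%:C%C *: v).
rewrite nsqB nsqZr rdotZr => h.
have e : nsq u + (rdot u v / nsq v) ^+ 2 * nsq v - rdot u v / nsq v * rdot u v *+ 2
  = (nsq u * nsq v - rdot u v ^+ 2) / nsq v.
  by field; rewrite gt_eqF.
by move: h; rewrite e pmulr_lge0 ?invr_gt0 // subr_ge0.
Qed.

Lemma rnorm_lt v (e : K) : (rnorm v < e) = (`|v| < e%:C%C).
Proof. by rewrite rnormE ltcR. Qed.

Lemma rnormD u v : rnorm (u + v) <= rnorm u + rnorm v.
Proof. by rewrite -lecR rmorphD /= -!rnormE ler_normD. Qed.

Lemma rnormN v : rnorm (- v) = rnorm v.
Proof. by rewrite /rnorm normrN. Qed.

Lemma rdot_le u v : `|rdot u v| <= rnorm u * rnorm v.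
Proof.
rewrite -(@ler_pXn2r _ 2) ?nnegrE ?mulr_ge0 ?rnorm_ge0 //.
by rewrite exprMn -!nsqE real_normK ?num_real // rdot_CS.
Qed.

Lemma hdot0_rdot u v : (forall k : K[i], rdot u (k *: v) = 0) -> hdot H u v = 0.
Proof. by move=> uv; rewrite hdot_rdot -[v in rdot u v]scale1r !uv. Qed.

Lemma hdot_inj u v : (forall w, hdot H u w = hdot H v w) -> u = v.
Proof.
move=> uv; apply/eqP; rewrite -subr_eq0; apply/eqP/nsq_eq0.
by rewrite -rdot_nsq /rdot linearBl /= uv subrr.
Qed.

Lemma rnorm_eps v : (forall e, 0 < e -> rnorm v < e) -> v = 0.
Proof.
move=> ve; apply: nsq_eq0; rewrite nsqE; apply/eqP; rewrite sqrf_eq0.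
rewrite eq_le rnorm_ge0 andbT leNgt; apply/negP => /ve; by rewrite ltxx.
Qed.

(** The Cauchy criterion in the shape in which minimizing sequences and averages satisfy it: the
    smaller index controls the squared distance. *)
Lemma nsq_complete (u : nat -> H) (C : K) :
  (forall n k, (n <= k)%N -> nsq (u n - u k) <= C / n.+1%:R) ->
  exists l, forall e, 0 < e -> exists N, forall n, (N <= n)%N -> rnorm (l - u n) < e.
Proof.
move=> uC.
have small (e : K) : 0 < e -> exists N, forall n, (N <= n)%N -> C / n.+1%:R < e.
  move=> e0; exists (Num.trunc (`|C| / e)).+1 => n Nn.
  rewrite ltr_pdivrMr ?ltr0Sn //; apply: le_lt_trans (ler_norm C) _.
  rewrite mulrC -ltr_pdivrMr //; apply: lt_le_trans (truncnS_gt _) _.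
  by rewrite ler_nat ltnW // ltnS.
have cu : cvg (u @ \oo).
  apply/cauchy_cvgP/cauchy_ballP => e e0.
  have [r r0 er] : exists2 r : K, 0 < r & e = r%:C%C.
    exists (complex.Re e); last by rewrite RRe_real // gtr0_real.
    by move: e0; rewrite ltcE => /andP[].
  have [N HN] := small (r ^+ 2) (exprn_gt0 2 r0).
  have key n k : (N <= n)%N -> (n <= k)%N -> `|u n - u k| < e.
    move=> Nn nk; rewrite er -rnorm_lt -(@ltr_pXn2r _ 2) ?nnegrE ?rnorm_ge0 ?(ltW r0) //.
    by rewrite -nsqE; apply: le_lt_trans (uC _ _ nk) (HN _ Nn).
  pose T : set H := [set v | exists2 n, (N <= n)%N & v = u n].
  exists (T, T) => /=; first by split; exists N => // n Nn; exists n.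
  move=> [_ _] [/= [n Nn ->] [k Nk ->]]; rewrite -ball_normE /=.
  have [nk|/ltnW kn] := leqP n k; first exact: key.
  by rewrite distrC key.
exists (lim (u @ \oo)) => e e0.
have e0' : 0 < e%:C%C by have := e0; rewrite -ltcR.
have /cvgrPdist_lt /(_ _ e0') [N _ HN] := cu.
by exists N => n Nn; rewrite rnorm_lt; exact: HN.
Qed.

End RealDot.

Lemma rnorm_nsq (K : realType) (H1 H2 : hilbert K) (u : H1) (v : H2) :
  nsq u = nsq v -> rnorm u = rnorm v.
Proof.
rewrite !nsqE => /eqP; rewrite eqrXn2 ?rnorm_ge0 //; exact/eqP.
Qed.

(** * Vectors of minimal norm and orthogonality *)

Section MinimalNorm.
Variables (K : realType) (H : hilbert K).
Implicit Types u v w : H.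

Definition adherent (C : H -> Prop) u : Prop :=
  forall e : K, 0 < e -> exists2 v, C v & rnorm (u - v) < e.

Lemma nsq_midpoint u v :
  nsq (u - v) = nsq u *+ 2 + nsq v *+ 2 - nsq ((2^-1 : K)%:C%C *: (u + v)) *+ 4.
Proof. by rewrite nsqZr nsqB nsqD -/(rdot u v); field. Qed.

(** By the parallelogram identity, the midpoint of two distinct vectors of minimal norm would be
    shorter. *)
Lemma min_norm_unique (C : H -> Prop) u v :
  (forall u v, C u -> C v -> C ((2^-1 : K)%:C%C *: (u + v))) ->
  C u -> C v -> (forall w, C w -> nsq u <= nsq w) -> nsq v = nsq u -> u = v.
Proof.
move=> midC Cu Cv umin vu; apply/eqP; rewrite -subr_eq0; apply/eqP/nsq_eq0.
apply/eqP; rewrite eq_le nsq_ge0 andbT nsq_midpoint vu.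
by have := umin _ (midC _ _ Cu Cv); lra.
Qed.

(** A minimizing sequence is Cauchy by the parallelogram identity, since the midpoints stay in
    [C]. *)
Lemma min_norm_exists (C : H -> Prop) w :
  (forall u v, C u -> C v -> C ((2^-1 : K)%:C%C *: (u + v))) ->
  (forall u, adherent C u -> C u) -> C w ->
  exists2 u, C u & forall v, C v -> nsq u <= nsq v.
Proof.
move=> midC clC Cw.
pose E : set K := [set nsq v | v in [set v | C v]].
have hE : has_inf E.
  split; first by exists (nsq w), w.
  by exists 0 => _ [v _ <-]; exact: nsq_ge0.
have infE v : C v -> inf E <= nsq v.
  by move=> Cv; apply: (ge_inf hE.2); exists v.
have /choice[u uP] : forall n : nat, exists u, C u /\ nsq u < inf E + n.+1%:R^-1.
  move=> n; have [|_ [u Cu <-] un] := @inf_adherent _ E (n.+1%:R^-1) _ hE.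
    by rewrite invr_gt0 ltr0Sn.
  by exists u.
(* The identity bounds the squared distance by 2/(n+1) + 2/(k+1), at most 4/(n+1) for n <= k. *)
have [|l lP] := @nsq_complete K H u 4.
  move=> n k nk; rewrite nsq_midpoint.
  have := infE _ (midC _ _ (uP n).1 (uP k).1); have := (uP n).2; have := (uP k).2.
  have : k.+1%:R^-1 <= n.+1%:R^-1 :> K by rewrite lef_pV2 ?posrE ?ltr0Sn // ler_nat ltnS.
  by move: (n.+1%:R^-1) (k.+1%:R^-1) => s t; lra.
exists l; first apply: clC => e e0.
  by have [N HN] := lP _ e0; exists (u N); [exact: (uP N).1|exact: HN].
move=> v Cv; rewrite !nsqE ler_pXn2r ?nnegrE ?rnorm_ge0 // leNgt; apply/negP => vl.
(* Half the gap: for large n both |l - u_n| < d and |u_n| < |v| + d, whence |l| < |v| + 2d = |l|. *)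
pose d := (rnorm l - rnorm v) / 2.
have d0 : 0 < d by rewrite divr_gt0 // subr_gt0.
have [N HN] := lP _ d0.
have := infE _ Cv; rewrite nsqE => infv.
pose n := maxn N (Num.trunc (d ^- 2)).+1.
have /HN lun : (N <= n)%N by rewrite leq_maxl.
have : nsq (u n) < (rnorm v + d) ^+ 2.
  apply: lt_le_trans (uP n).2 _; rewrite sqrrD -addrA lerD //.
  have: n.+1%:R^-1 <= d ^+ 2.
    rewrite -[leRHS]invrK lef_pV2 ?posrE ?ltr0Sn ?invr_gt0 ?exprn_gt0 //.
    apply: le_trans (ltW (truncnS_gt _)) _; rewrite ler_nat.
    by rewrite ltnS ltnW // leq_maxr.
  move/le_trans; apply; rewrite lerDr mulrn_wge0 // mulr_ge0 ?rnorm_ge0 //.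
  exact: ltW.
rewrite nsqE ltr_pXn2r ?nnegrE ?addr_ge0 ?rnorm_ge0 ?(ltW d0) // => un.
have := rnormD (l - u n) (u n); rewrite subrK.
by move: un lun; rewrite /d; lra.
Qed.

(** The shortest vector of the coset v + D is orthogonal to [D], hence zero, so that v lies in
    [D]. *)
Lemma perp0_full (D : H -> Prop) :
  D 0 -> (forall (k : K[i]) u v, D u -> D v -> D (k *: u + v)) ->
  (forall u, adherent D u -> D u) ->
  (forall z, (forall d, D d -> hdot H z d = 0) -> z = 0) -> forall v, D v.
Proof.
move=> D0 linD clD perpD v.
have [|||u Du umin] := @min_norm_exists (fun w => D (v - w)) v.
- move=> x y Dx Dy.
  have -> : v - (2^-1 : K)%:C%C *: (x + y) =
      (2^-1 : K)%:C%C *: (v - x) + ((2^-1 : K)%:C%C *: (v - y) + 0).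
    have hh : (2^-1 : K)%:C%C *: (v + v) = v.
      rewrite scalerDr -scalerDl -rmorphD /= (_ : 2^-1 + 2^-1 = 1) ?scale1r //.
      by field.
    by rewrite addr0 -scalerDr addrACA -opprD scalerBr hh.
  apply: (linD) => //; exact: (linD).
- move=> x xD; apply: clD => e e0; have [y Dy xy] := xD e e0.
  exists (v - y) => //; rewrite (_ : v - x - (v - y) = - (x - y)) ?rnormN //.
  by rewrite !opprB [LHS]addrC addrA subrK.
- by rewrite subrr.
have ortho d : D d -> rdot u d = 0.
  move=> Dd; have key (t : K) : nsq u <= nsq (u + t%:C%C *: d).
    apply: umin; rewrite opprD addrA addrC -scaleNr; exact: linD.
  have p0 : 0 < nsq d + 1 by rewrite ltr_wpDl ?nsq_ge0.
  (* The minimizing coefficient has denominator [nsq d]; adding 1 avoids the case d = 0 and still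
     forces [rdot u d] to vanish. *)
  have := key (- (rdot u d / (nsq d + 1))).
  rewrite nsqD -/(rdot _ _) rdotZr nsqZr.
  have -> : nsq u + (- (rdot u d / (nsq d + 1))) ^+ 2 * nsq d +
     - (rdot u d / (nsq d + 1)) * rdot u d *+ 2 =
     nsq u - rdot u d ^+ 2 * ((nsq d + 2) / (nsq d + 1) ^+ 2).
    by field; rewrite gt_eqF.
  rewrite lerBrDr gerDl pmulr_lle0; last first.
    by rewrite divr_gt0 ?exprn_gt0 // ltr_wpDl ?nsq_ge0.
  by move=> h; apply/eqP; rewrite -sqrf_eq0 eq_le h sqr_ge0.
suff u0 : u = 0 by rewrite u0 subr0 in Du.
apply: perpD => d Dd; apply: hdot0_rdot => k; apply: ortho.
by rewrite -[_ *: _]addr0; exact: linD.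
Qed.

End MinimalNorm.

(** * Isometries from equal Gram matrices *)

Section Gram.
Variables (K : realType) (I : Type).

Definition total_family (H : hilbert K) (a : I -> H) : Prop :=
  forall z, (forall i, hdot H z (a i) = 0) -> z = 0.

Definition comb (H : hilbert K) (a : I -> H) (s : seq (K[i] * I)) : H :=
  \sum_(p <- s) p.1 *: a p.2.

Lemma combZ (H : hilbert K) (a : I -> H) k s :
  comb a [seq (k * p.1, p.2) | p <- s] = k *: comb a s.
Proof. by rewrite /comb big_map scaler_sumr; apply: eq_bigr => p _; rewrite scalerA. Qed.

Lemma combD (H : hilbert K) (a : I -> H) s t :
  comb a (s ++ t) = comb a s + comb a t.
Proof. by rewrite /comb big_cat. Qed.

Lemma Re_norm_ge0 (k : K[i]) : 0 <= complex.Re `|k|.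
Proof. by have : 0 <= `|k| := normr_ge0 k; rewrite lecE => /andP[]. Qed.

Lemma rnormZ (H : hilbert K) (k : K[i]) (v : H) : rnorm (k *: v) = complex.Re `|k| * rnorm v.
Proof.
have kE : `|k| = (complex.Re `|k|)%:C%C by rewrite RRe_real // ger0_real.
by rewrite {1}/rnorm normrZ {1}kE rnormE -rmorphM.
Qed.

Lemma comb_approx (H : hilbert K) (k : K[i]) (u v u' v' : H) (e : K) : 0 < e ->
  rnorm (u - u') < e / (2 * (complex.Re `|k| + 1)) -> rnorm (v - v') < e / 2 ->
  rnorm (k *: u + v - (k *: u' + v')) < e.
Proof.
move=> e0 uu vv; rewrite opprD addrACA -scalerBr.
apply: le_lt_trans (rnormD _ _) _; rewrite rnormZ.
have k0 := Re_norm_ge0 k.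
have : complex.Re `|k| * rnorm (u - u') <= e / 2.
  apply: le_trans (ler_wpM2l k0 (ltW uu)) _.
  rewrite [leLHS](_ : _ = e / 2 * (complex.Re `|k| / (complex.Re `|k| + 1))); last first.
    by field; rewrite gt_eqF // ltr_wpDl.
  rewrite ler_piMr ?divr_ge0 ?(ltW e0) // ler_pdivrMr ?ltr_wpDl //; lra.
by move: vv; lra.
Qed.

(** This is [perp0_full] for the closure of the linear span of the family. *)
Lemma comb_dense (H : hilbert K) (a : I -> H) f (e : K) : total_family a -> 0 < e ->
  exists s, rnorm (f - comb a s) < e.
Proof.
move=> ta e0; move: f e e0.
have comb0 : comb a [::] = 0 by rewrite /comb big_nil.
suff H0 f : forall e : K, 0 < e -> exists2 u, (exists s, u = comb a s) & rnorm (f - u) < e.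
  by move=> f e /(H0 f)[_ [s ->] fs]; exists s.
apply: (@perp0_full K H (adherent (fun u => exists s, u = comb a s))).
- move=> e e0; exists 0; first by exists [::].
  by rewrite subr0 rnorm_lt normr0 ltcR.
- move=> k u v uS vS e e0.
  have k0 := Re_norm_ge0 k.
  have [|_ [s ->] us] := uS (e / (2 * (complex.Re `|k| + 1))).
    by rewrite divr_gt0 // mulr_gt0 // ltr_wpDl.
  have [|_ [t ->] vt] := vS (e / 2); first by rewrite divr_gt0.
  exists (k *: comb a s + comb a t); last exact: comb_approx.
  by exists ([seq (k * p.1, p.2) | p <- s] ++ t); rewrite combD combZ.
- move=> u uS e e0; have e20 : 0 < e / 2 by rewrite divr_gt0.
  have [v /(_ _ e20)[w [s ->] vw] uv] := uS _ e20; exists (comb a s); first by exists s.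
  have := rnormD (u - v) (v - comb a s); rewrite addrA subrK; lra.
- move=> z zS; apply: ta => i; apply: zS => e e0; exists (a i).
    by exists [:: (1, i)]; rewrite /comb big_seq1 scale1r.
  by rewrite subrr rnorm_lt normr0 ltcR.
Qed.

Variables (H1 H2 : hilbert K) (a : I -> H1) (b : I -> H2).
Hypothesis gram : forall i j, hdot H1 (a i) (a j) = hdot H2 (b i) (b j).

Lemma comb_nsq s : nsq (comb a s) = nsq (comb b s).
Proof.
apply: complexI; rewrite -!hdot_nsq /comb !linear_sumlz; apply: eq_bigr => p _.
rewrite !linear_sumr; apply: eq_bigr => q _ /=.
by rewrite !linearZl_LR /= !linearZr_LR /= gram.
Qed.

Lemma combB_nsq s t : nsq (comb a s - comb a t) = nsq (comb b s - comb b t).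
Proof.
have E (H : hilbert K) (c : I -> H) : comb c s - comb c t =
    comb c (s ++ [seq (-1 * p.1, p.2) | p <- t]).
  by rewrite combD combZ scaleN1r.
by rewrite !E comb_nsq.
Qed.

(** The closure of the graph of [comb a s] |-> [comb b s]. Working with the relation avoids choosing
    representations of vectors as combinations. *)
Definition gram_rel (f : H1) (u : H2) : Prop :=
  forall e : K, 0 < e -> exists s, rnorm (f - comb a s) < e /\ rnorm (u - comb b s) < e.

Lemma gram_rel_lin k f u g v :
  gram_rel f u -> gram_rel g v -> gram_rel (k *: f + g) (k *: u + v).
Proof.
move=> fu gv e e0.
have k0 := Re_norm_ge0 k.
have [|s [fs us]] := fu (e / (2 * (complex.Re `|k| + 1))).
  by rewrite divr_gt0 // mulr_gt0 // ltr_wpDl.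
have [|t [gt vt]] := gv (e / 2); first by rewrite divr_gt0.
exists ([seq (k * p.1, p.2) | p <- s] ++ t).
by rewrite !combD !combZ; split; exact: comb_approx.
Qed.

Lemma gram_rel_nsq f u : gram_rel f u -> nsq f = nsq u.
Proof.
move=> fu; rewrite !nsqE; congr (_ ^+ 2); apply/eqP; rewrite -subr_eq0 -normr_le0.
apply/ler_addgt0Pl => e e0; rewrite addr0.
have e20 : 0 < e / 2 by rewrite divr_gt0.
have [s [fs us]] := fu _ e20.
have E := rnorm_nsq (comb_nsq s).
have := rnormD (f - comb a s) (comb a s); have := rnormD (u - comb b s) (comb b s).
have := rnormD (comb a s - f) f; have := rnormD (comb b s - u) u.
rewrite !subrK -(rnormN (comb a s - f)) -(rnormN (comb b s - u)) !opprB E ler_norml.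
by move: fs us => *; apply/andP; split; lra.
Qed.

Lemma gram_rel_ex f : total_family a -> exists u, gram_rel f u.
Proof.
move=> ta.
have /choice[s sP] : forall n : nat, exists s, rnorm (f - comb a s) < n.+1%:R^-1.
  by move=> n; apply: comb_dense; rewrite // invr_gt0 ltr0Sn.
(* The combinations are at distance at most 2/(n+1), and 4/(n+1)^2 <= 4/(n+1). *)
have [|u uP] := @nsq_complete K H2 (fun n => comb b (s n)) 4.
  move=> n k nk; rewrite -combB_nsq nsqE.
  have kn : k.+1%:R^-1 <= n.+1%:R^-1 :> K by rewrite lef_pV2 ?posrE ?ltr0Sn // ler_nat ltnS.
  have n0 : 0 < n.+1%:R^-1 :> K by rewrite invr_gt0 ltr0Sn.
  have n1 : n.+1%:R^-1 <= 1 :> K by rewrite invf_le1 ?ltr0Sn // ler1n.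
  have : rnorm (comb a (s n) - comb a (s k)) <= n.+1%:R^-1 *+ 2.
    have := rnormD (comb a (s n) - f) (f - comb a (s k)); rewrite addrA subrK.
    have := sP n; have := sP k; rewrite -(rnormN (comb a (s n) - f)) opprB.
    by move: kn; move: (n.+1%:R^-1) (k.+1%:R^-1) => x y *; lra.
  have r0 := rnorm_ge0 (comb a (s n) - comb a (s k)).
  move=> h; have {}h : rnorm (comb a (s n) - comb a (s k)) ^+ 2 <= (n.+1%:R^-1 *+ 2) ^+ 2.
    by rewrite ler_pXn2r // nnegrE // addr_ge0 // ltW.
  apply: le_trans h _; move: n0 n1; move: (n.+1%:R^-1) => x *; nra.
exists u => e e0; have [N HN] := uP e e0.
pose n := maxn N (Num.trunc (e^-1)).+1.
exists (s n); split; last by apply: HN; rewrite leq_maxl.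
apply: lt_trans (sP n) _; rewrite invf_plt ?posrE ?ltr0Sn //.
apply: lt_le_trans (truncnS_gt _) _; rewrite ler_nat.
by rewrite leqW // leq_maxr.
Qed.

Lemma gram_rel_uniq f u v : gram_rel f u -> gram_rel f v -> u = v.
Proof.
move=> fu fv; have := gram_rel_nsq (gram_rel_lin (-1) fu fv).
rewrite !scaleN1r addNr nsq0 addrC => /esym/nsq_eq0/eqP.
by rewrite subr_eq0 => /eqP.
Qed.

Lemma gram_rel_gen i : gram_rel (a i) (b i).
Proof.
move=> e e0; exists [:: (1, i)]; rewrite /comb !big_seq1 !scale1r !subrr.
by rewrite !rnorm_lt !normr0 ltcR.
Qed.

End Gram.

Lemma nsq_isometry_hdot (K : realType) (H1 H2 : hilbert K) (T : H1 -> H2) :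
  linear T -> (forall u, nsq (T u) = nsq u) ->
  forall u v, hdot H2 (T u) (T v) = hdot H1 u v.
Proof.
move=> Tl Tn; have R u v : rdot (T u) (T v) = rdot u v.
  have := nsqD (T u) (T v); have := nsqD u v; have := Tl 1 u v.
  by rewrite !scale1r => <-; rewrite !Tn -/(rdot _ _) -/(rdot _ _); lra.
have TZ k u : T (k *: u) = k *: T u.
  have := Tl k u 0; have := Tl (-1) 0 0; rewrite scaler0 addr0 scaleN1r addNr => ->.
  by rewrite !addr0.
by move=> u v; rewrite !hdot_rdot -!R TZ.
Qed.

Lemma gram_unitary (K : realType) (I : Type) (H1 H2 : hilbert K) (a : I -> H1)
    (b : I -> H2) :
  (forall i j, hdot H1 (a i) (a j) = hdot H2 (b i) (b j)) -> total_family a -> total_family b ->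
  exists T : H1 -> H2, [/\ linear T, bijective T,
    forall u v, hdot H2 (T u) (T v) = hdot H1 u v & forall i, T (a i) = b i].
Proof.
move=> ab ta tb; have ba i j := esym (ab i j).
have /choice[T TP] := fun f => gram_rel_ex ab f ta.
have /choice[S SP] := fun f => gram_rel_ex ba f tb.
have sw f u : gram_rel b a u f -> gram_rel a b f u.
  by move=> uf e e0; have [s [us fs]] := uf e e0; exists s.
have Tl : linear T.
  by move=> k u v; apply: (gram_rel_uniq ab) (TP _) _; exact: gram_rel_lin.
exists T; split => //.
- exists S => x.
    by apply: (gram_rel_uniq ba) (SP _) _; move=> e /(TP x)[s []]; exists s.
  by apply: (gram_rel_uniq ab) (TP _) _; exact/sw/SP.
- by apply: nsq_isometry_hdot => // u; exact/esym/(gram_rel_nsq ab).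
- by move=> i; apply: (gram_rel_uniq ab) (TP _) _; exact: gram_rel_gen.
Qed.

(** * Transvections *)

Section Transvections.
Variable A : comNzRingType.
Implicit Types (a b phi psi : nat -> A) (g h k : GL A).

Definition dotp a phi : A := \sum_(i \in [set: nat]) a i * phi i.

Definition colmul (g : nat -> nat -> A) phi : nat -> A := fun i => dotp (g i) phi.

Definition delta i : nat -> A := im1 A i.

Lemma fun1D a b i : (a + b) i = a i + b i. Proof. by []. Qed.
Lemma fun1N a i : (- a) i = - a i. Proof. by []. Qed.
Lemma fun2D (f g : nat -> nat -> A) i j : (f + g) i j = f i j + g i j. Proof. by []. Qed.

Lemma dotpC a phi : dotp a phi = dotp phi a.
Proof. by apply: eq_fsbigr => i _; rewrite mulrC. Qed.

Lemma dotp_ord n a phi : (forall i, (n <= i)%N -> phi i = 0) ->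
  dotp a phi = \sum_(i < n) a i * phi i.
Proof. by move=> phin; apply: fsbig_ub => i ni; rewrite phin ?mulr0. Qed.

Lemma dotpDl a b phi : finsupp phi -> dotp (a + b) phi = dotp a phi + dotp b phi.
Proof.
move=> [n phin]; rewrite !(dotp_ord _ phin) -big_split; apply: eq_bigr => i _ /=.
by rewrite -mulrDl.
Qed.

Lemma dotpZl c a phi : finsupp phi -> dotp (fun i => c * a i) phi = c * dotp a phi.
Proof.
move=> [n phin]; rewrite !(dotp_ord _ phin) mulr_sumr; apply: eq_bigr => i _.
by rewrite mulrA.
Qed.

Lemma dotpDr a phi psi : finsupp phi -> finsupp psi ->
  dotp a (phi + psi) = dotp a phi + dotp a psi.
Proof.
move=> [n pn] [m sm].
rewrite (dotp_ord (n := maxn n m)) => [|i]; last first.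
  by rewrite geq_max fun1D => /andP[/pn -> /sm ->]; rewrite addr0.
rewrite (dotp_ord (n := maxn n m) a (phi := phi)) => [|i]; last first.
  by rewrite geq_max => /andP[/pn].
rewrite (dotp_ord (n := maxn n m) a (phi := psi)) => [|i]; last first.
  by rewrite geq_max => /andP[_ /sm].
by rewrite -big_split; apply: eq_bigr => i _ /=; rewrite -mulrDr.
Qed.

Lemma dotpZr c a phi : finsupp phi -> dotp a (fun i => c * phi i) = c * dotp a phi.
Proof.
move=> [n pn]; rewrite (dotp_ord (n := n)) => [|i /pn ->]; last by rewrite mulr0.
by rewrite (dotp_ord _ pn) mulr_sumr; apply: eq_bigr => i _; rewrite mulrCA.
Qed.

Lemma dotpNl a phi : finsupp phi -> dotp (- a) phi = - dotp a phi.
Proof.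
move=> phif; rewrite -[RHS]mulN1r -dotpZl //; congr dotp; apply/funext => i.
by rewrite mulN1r.
Qed.

Lemma delta_finsupp i : finsupp (delta i).
Proof. exact: (rcfinite1 A).1. Qed.

Lemma deltaE i j : delta i j = (i == j)%:R. Proof. by []. Qed.

Lemma dotp_delta a i : dotp a (delta i) = a i.
Proof.
rewrite -[RHS](congr1 (fun f => f i) (rowmul1 a)) /rowmul; apply: eq_fsbigr => j _.
by rewrite /delta /im1 eq_sym.
Qed.

Lemma finsuppD a b : finsupp a -> finsupp b -> finsupp (a + b).
Proof.
move=> [n an] [m bm]; exists (maxn n m) => i; rewrite geq_max => /andP[ni mi].
by rewrite fun1D an // bm // addr0.
Qed.

Lemma finsuppN a : finsupp a -> finsupp (- a).
Proof. by move=> [n an]; exists n => i ni; rewrite fun1N an // oppr0. Qed.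

Lemma finsuppB a b : finsupp a -> finsupp b -> finsupp (a - b).
Proof. by move=> af bf; apply: finsuppD => //; exact: finsuppN. Qed.

Lemma finsuppZ c a : finsupp a -> finsupp (fun i => c * a i).
Proof. by move=> [n an]; exists n => i ni; rewrite an // mulr0. Qed.

Lemma finsupp0 : finsupp (0 : nat -> A).
Proof. by exists 0%N. Qed.

Lemma dotp_rowmul a phi (g : nat -> nat -> A) : finsupp phi ->
  (forall j, finsupp (g^~ j)) -> dotp (rowmul a g) phi = dotp a (colmul g phi).
Proof.
move=> phif gc; pose h (i j : nat) := phi i.
(* The column phi is viewed as a matrix all of whose columns are phi, so that associativity of the
   matrix product applies. *)
by have /(congr1 (fun f => f 0%N)) := @rowmulA _ a g h gc (fun=> phif).
Qed.

Lemma rowmul_finsupp a (g : nat -> nat -> A) : finsupp a -> rcfinite g -> finsupp (rowmul a g).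
Proof.
move=> [n an] [gr _]; have [m hm] := finsupp_unif n gr; exists m => j mj.
rewrite /rowmul (@fsbig_ub _ _ n) => [|i ni]; last by rewrite an // mul0r.
by rewrite big1 // => i _; rewrite hm // mulr0.
Qed.

Lemma colmul_rowmul (g : nat -> nat -> A) phi : colmul g phi = rowmul phi (imtr g).
Proof. by apply/funext => i; rewrite /colmul dotpC. Qed.

Lemma colmul_finsupp phi (g : nat -> nat -> A) : finsupp phi -> rcfinite g -> finsupp (colmul g phi).
Proof. by move=> ? ?; rewrite colmul_rowmul; apply: rowmul_finsupp => //; exact: rcfinite_tr. Qed.

Lemma rowmulM a g h : rowmul (rowmul a g) h = rowmul a (g * h)%g.
Proof. by rewrite rowmulA; [|exact: (gl_fin g).2|exact: (gl_fin h).2]. Qed.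

Lemma colmulM phi g h : finsupp phi -> colmul g (colmul h phi) = colmul (g * h)%g phi.
Proof.
move=> phif; apply/funext => i; rewrite /colmul -[LHS]/(dotp _ (colmul h phi)).
by rewrite -dotp_rowmul //; exact: (gl_fin h).2.
Qed.

Lemma rowmul1g a : rowmul a (1%g : GL A) = a.
Proof. exact: rowmul1. Qed.

Lemma colmul1g phi : colmul (1%g : GL A) phi = phi.
Proof. by apply/funext => i; rewrite /colmul dotpC -[RHS]dotp_delta. Qed.

Lemma rowmulK a g : rowmul (rowmul a g) g^-1%g = a.
Proof. by rewrite rowmulM mulgV rowmul1g. Qed.

Lemma rowmulVK a g : rowmul (rowmul a g^-1%g) g = a.
Proof. by rewrite rowmulM mulVg rowmul1g. Qed.

Lemma dotp_GL a phi g : finsupp phi -> dotp (rowmul a g^-1%g) (colmul g phi) = dotp a phi.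
Proof.
move=> phif; rewrite dotp_rowmul; last exact: (gl_fin _).2.
  by rewrite colmulM // mulVg colmul1g.
exact: colmul_finsupp (gl_fin g).
Qed.

Lemma delta_rowmul i (g : nat -> nat -> A) : rowmul (delta i) g = g i.
Proof. by apply/funext => j; rewrite /rowmul -/(dotp _ _) dotpC dotp_delta. Qed.

Lemma delta_colmul j (g : nat -> nat -> A) : colmul g (delta j) = g^~ j.
Proof. by apply/funext => i; exact: dotp_delta. Qed.

Definition outer phi a : nat -> nat -> A := fun i j => phi i * a j.

Lemma outer_mull phi a h i j :
  immul (im1 A + outer phi a) h i j = h i j + phi i * rowmul a h j.
Proof.
rewrite /immul /rowmul -!/(dotp _ _).
have hj : finsupp (h^~ j) by exact: (gl_fin h).2.
by rewrite dotpDl // dotpZl // dotpC dotp_delta.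
Qed.

Lemma outer_mulr phi a h i j : finsupp phi ->
  immul h (im1 A + outer phi a) i j = h i j + colmul h phi i * a j.
Proof.
move=> phif; rewrite /immul /rowmul -!/(dotp _ _) dotpC.
have hj : finsupp (h i) by exact: (gl_fin h).1.
transitivity (dotp (delta j + (fun i => a j * phi i)) (h i)).
  congr dotp; apply/funext => l; rewrite ?fun2D ?fun1D /outer [phi l * _]mulrC.
  by congr (_ + _); rewrite /delta /im1 eq_sym.
by rewrite dotpDl // dotpZl // dotpC dotp_delta mulrC /colmul (dotpC phi).
Qed.

(** The relation a phi = 0 makes the matrix phi a square to zero, so that 1 - phi a is the inverse
    of 1 + phi a. *)
Definition trv_ok phi a := [/\ finsupp phi, finsupp a & dotp a phi = 0].

Lemma trv_rcfinite phi a : finsupp phi -> finsupp a -> rcfinite (im1 A + outer phi a).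
Proof.
move=> phif af; split=> i.
  apply: finsuppD; [exact: delta_finsupp|exact: finsuppZ].
have -> : (fun j => im1 A j i + outer phi a j i) = delta i + (fun j => a i * phi j).
  apply/funext => j; rewrite ?fun2D ?fun1D /outer mulrC.
  by congr (_ + _); rewrite /delta /im1 eq_sym.
apply: finsuppD; [exact: delta_finsupp|exact: finsuppZ].
Qed.

Lemma trv_inverse phi a : trv_ok phi a ->
  immul (im1 A + outer phi a) (im1 A + outer phi (- a)) = im1 A.
Proof.
move=> [phif af aphi]; apply/funext => i; apply/funext => j.
have phifN := finsuppN af; rewrite /immul /rowmul -/(dotp _ _).
have fj : finsupp ((im1 A + outer phi (- a))^~ j) by exact: (trv_rcfinite _ _).2.
rewrite dotpDl // dotpZl // dotpC dotp_delta.
have -> : dotp a ((im1 A + outer phi (- a))^~ j) = a j.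
  have -> : (im1 A + outer phi (- a))^~ j = delta j + (fun i => (- a j) * phi i).
    apply/funext => l; rewrite ?fun2D ?fun1D /outer [_ * phi l]mulrC.
    by congr (_ + _); rewrite /delta /im1 eq_sym.
  by rewrite dotpC dotpDl // dotpZl // (dotpC phi) aphi mulr0 addr0 dotpC dotp_delta.
rewrite -[LHS]/(im1 A i j + phi i * (- a j) + phi i * a j) mulrN addrAC.
by rewrite -addrA subrr addr0.
Qed.

Lemma trv_okN phi a : trv_ok phi a -> trv_ok phi (- a).
Proof.
by move=> [phif af aphi]; split; [|exact: finsuppN|rewrite dotpNl // aphi oppr0].
Qed.

Lemma trv_inverseV phi a : trv_ok phi a ->
  immul (im1 A + outer phi (- a)) (im1 A + outer phi a) = im1 A.
Proof. by move=> /trv_okN/trv_inverse; rewrite opprK. Qed.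

(* The junk value 1 is taken when trv_ok fails. *)
Definition trv phi a : GL A :=
  if pselect (trv_ok phi a) is left H then
    let: And3 fp fa _ := H in
    MkGL (trv_rcfinite fp fa) (trv_rcfinite fp (finsuppN fa))
      (trv_inverse H) (trv_inverseV H)
  else 1%g.

Lemma trvE phi a : trv_ok phi a -> trv phi a = im1 A + outer phi a :> (nat -> nat -> A).
Proof. by rewrite /trv; case: pselect => // -[]. Qed.

Lemma trv_mull phi a h i j : trv_ok phi a ->
  (trv phi a * h)%g i j = h i j + phi i * rowmul a h j.
Proof. by move=> ok; rewrite -outer_mull -trvE. Qed.

Lemma trv_mulr phi a h i j : trv_ok phi a ->
  (h * trv phi a)%g i j = h i j + colmul h phi i * a j.
Proof. by move=> ok; rewrite -outer_mulr -?trvE //; case: ok. Qed.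

Lemma trv_val phi a i j : trv_ok phi a -> trv phi a i j = (i == j)%:R + phi i * a j.
Proof. by move=> ok; rewrite trvE. Qed.

Lemma gl_eqP g h : (forall i j, g i j = h i j) -> g = h.
Proof. by move=> gh; apply: gl_inj; apply/funext => i; apply/funext => j. Qed.

Lemma rowmul_trv phi a b : trv_ok phi a ->
  rowmul b (trv phi a) = fun j => b j + dotp b phi * a j.
Proof.
move=> ok; apply/funext => j; have [phif _ _] := ok; rewrite /rowmul -/(dotp _ _) dotpC.
transitivity (dotp (delta j + (fun i => a j * phi i)) b).
  congr dotp; apply/funext => l; rewrite trv_val // fun1D [phi l * _]mulrC.
  by rewrite deltaE eq_sym.
have fs : finsupp (fun i => a j * phi i) by exact: finsuppZ.
rewrite dotpC.
have [n dn] := finsuppD (delta_finsupp j) fs; have [m pm] := phif.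
rewrite (dotp_ord _ (n := maxn n (maxn m j.+1))); last first.
  by move=> i; rewrite geq_max => /andP[/dn].
rewrite (dotp_ord _ (n := maxn n (maxn m j.+1)) (phi := phi)); last first.
  by move=> i; rewrite !geq_max => /andP[_ /andP[/pm]].
rewrite -(dotp_delta b) (dotp_ord _ (n := maxn n (maxn m j.+1)) (phi := delta j)); last first.
  by move=> i; rewrite !geq_max deltaE => /andP[_ /andP[_ ji]]; rewrite ltn_eqF.
rewrite mulr_suml -big_split; apply: eq_bigr => i _ /=.
by rewrite mulrDr; congr (_ + _); rewrite mulrCA mulrC.
Qed.

Lemma colmul_trv phi a psi : trv_ok phi a -> finsupp psi ->
  colmul (trv phi a) psi = fun i => psi i + phi i * dotp a psi.
Proof.
move=> ok psif; apply/funext => i; rewrite /colmul trvE //.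
by rewrite -[(im1 A + outer phi a) i]/(delta i + fun j => phi i * a j) dotpDl // dotpZl // dotpC dotp_delta.
Qed.

Lemma trvDr phi a b : trv_ok phi a -> trv_ok phi b ->
  trv phi (a + b) = (trv phi a * trv phi b)%g.
Proof.
move=> oka okb; have [phif af ap] := oka; have [_ bf bp] := okb.
have okab : trv_ok phi (a + b).
  by split => //; [exact: finsuppD|rewrite dotpDl // ap bp addr0].
apply: gl_eqP => i j; rewrite trv_mull // rowmul_trv // ap mul0r addr0 !trv_val //.
by rewrite -addrA -mulrDr [b j + a j]addrC.
Qed.

Lemma trvDl phi psi a : trv_ok phi a -> trv_ok psi a ->
  trv (phi + psi) a = (trv phi a * trv psi a)%g.
Proof.
move=> ok1 ok2; have [phif af ap] := ok1; have [psif _ bp] := ok2.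
have ok : trv_ok (phi + psi) a.
  by split => //; [exact: finsuppD|rewrite dotpC dotpDl // !(dotpC _ a) ap bp addr0].
apply: gl_eqP => i j; rewrite trv_mull // rowmul_trv // bp mul0r addr0 !trv_val //.
by rewrite -addrA -mulrDl [psi i + phi i]addrC.
Qed.

Lemma trv0r phi : finsupp phi -> trv phi 0 = 1%g.
Proof.
move=> phif; apply: gl_eqP => i j; rewrite trv_val ?mulr0 ?addr0 //.
split => //; first exact: finsupp0.
by rewrite dotpC; have [n pn] := phif; rewrite (dotp_ord _ (n := 0)) ?big_ord0.
Qed.

Lemma trvN phi a : trv_ok phi a -> trv phi (- a) = (trv phi a)^-1%g.
Proof.
move=> ok; apply/esym/mulg1_eq; rewrite -trvDr ?subrr ?trv0r //; first by case: ok.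
exact: trv_okN.
Qed.

Lemma trv_ok_conj g phi a : trv_ok phi a -> trv_ok (colmul g phi) (rowmul a g^-1%g).
Proof.
move=> [phif af ap]; split; [exact: colmul_finsupp (gl_fin g)|exact: rowmul_finsupp (gl_fin _)|].
by rewrite dotp_GL.
Qed.

Lemma trvJ g phi a : trv_ok phi a ->
  (g * trv phi a * g^-1)%g = trv (colmul g phi) (rowmul a g^-1%g).
Proof.
move=> ok; have ok' := trv_ok_conj g ok.
suff -> : (g * trv phi a)%g = (trv (colmul g phi) (rowmul a g^-1%g) * g)%g by rewrite mulgK.
by apply: gl_eqP => i j; rewrite trv_mull // trv_mulr // rowmulVK.
Qed.

(** The block matrices diag(1_n, z); these subgroups form a base of neighbourhoods of the unit. *)
Definition Kg n : set (GL A) := gl_agree n 1%g.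

Lemma KgP n g : Kg n g <->
  (forall i, (i < n)%N -> g i = delta i) /\ (forall j, (j < n)%N -> g^~ j = delta j).
Proof.
split=> [gn|[gr gc] i j /orP[/gr ->//|/gc gj]]; last first.
  by rewrite -[LHS]/((g^~ j) i) gj deltaE eq_sym.
split=> i ni; apply/funext => j; first by rewrite gn ?ni.
by rewrite gn ?ni ?orbT // deltaE eq_sym.
Qed.

Lemma Kg1 n : Kg n 1%g. Proof. by []. Qed.

Lemma KgM n g h : Kg n g -> Kg n h -> Kg n (g * h)%g.
Proof.
move=> /KgP[gr gc] /KgP[hr hc]; apply/KgP; split=> i ni.
  by rewrite -[LHS]/(rowmul (g i) h) gr // delta_rowmul hr.
rewrite -[LHS]/(colmul g (h^~ i)) hc // delta_colmul; exact: gc.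
Qed.

Lemma KgV n g : Kg n g -> Kg n g^-1%g.
Proof.
move=> /KgP[gr gc]; apply/KgP; split=> i ni.
  by rewrite -[LHS]delta_rowmul -{1}gr // -[g i]delta_rowmul rowmulK.
rewrite -[LHS]delta_colmul -{1}gc // -[g^~ i]delta_colmul colmulM ?mulVg ?colmul1g //.
exact: delta_finsupp.
Qed.

Lemma Kg_le n m g : (n <= m)%N -> Kg m g -> Kg n g.
Proof. by move=> nm gm i j ij; apply: gm; case/orP: ij => h; rewrite (leq_trans h nm) ?orbT. Qed.

Definition low n a := forall i, (n <= i)%N -> a i = 0.
Definition high n a := forall i, (i < n)%N -> a i = 0.

Lemma low_finsupp n a : low n a -> finsupp a. Proof. by exists n. Qed.

Lemma dotp_lowhigh n a phi : low n a -> high n phi -> dotp a phi = 0.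
Proof.
move=> an pn; rewrite dotpC (dotp_ord _ an) big1 // => i _.
by rewrite pn // mul0r.
Qed.

Lemma dotp_highlow n a phi : high n a -> low n phi -> dotp a phi = 0.
Proof. by move=> an pn; rewrite dotpC; exact: dotp_lowhigh pn an. Qed.

Lemma high_delta n i : (n <= i)%N -> high n (delta i).
Proof. by move=> ni j jn; rewrite deltaE gtn_eqF // (leq_trans jn). Qed.

Lemma low_delta n i : (i < n)%N -> low n (delta i).
Proof. by move=> ni j jn; rewrite deltaE ltn_eqF // (leq_trans ni). Qed.

Lemma trv_Kg n phi a : trv_ok phi a -> high n phi -> high n a -> Kg n (trv phi a).
Proof.
move=> ok pn an i j; rewrite trv_val //.
by case/orP => h; rewrite ?(pn _ h) ?(an _ h) ?mul0r ?mulr0 addr0.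
Qed.

Lemma colmul_Kg n k phi : Kg n k -> low n phi -> colmul k phi = phi.
Proof.
move=> /KgP[kr kc] pn; apply/funext => i; rewrite /colmul (dotp_ord _ pn).
rewrite -[RHS](dotp_delta phi) dotpC (dotp_ord _ pn); apply: eq_bigr => j _.
by rewrite -[k i j]/((k^~ j) i) kc // !deltaE eq_sym.
Qed.

Lemma rowmul_Kg n k a : Kg n k -> low n a -> rowmul a k = a.
Proof.
move=> /KgP[kr kc] an; apply/funext => j.
rewrite -[RHS]dotp_delta /rowmul -/(dotp _ _) !(dotpC a) !(dotp_ord _ an).
apply: eq_bigr => i _; by rewrite kr // !deltaE eq_sym.
Qed.

Lemma high_rowmul n k a : Kg n k -> high n a -> high n (rowmul a k).
Proof.
move=> /KgP[kr kc] an j jn; rewrite /rowmul -/(dotp _ _) kc // dotp_delta.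
exact: an.
Qed.

End Transvections.

(** * Unitary actions *)

Section Exchangeable.
Variables (K : realType) (H : hilbert K) (xi : nat -> H) (r c : K).
Hypothesis xi_nsq : forall j, nsq (xi j) = r.
Hypothesis xi_dot : forall i j, i != j -> rdot (xi i) (xi j) = c.

(* The limit is that of the averages of the xi j. *)
Lemma exchangeable_limit : exists eta : H, forall z d,
  (exists N, forall j, (N <= j)%N -> rdot (xi j) z = d) -> rdot eta z = d.
Proof.
pose s n := \sum_(i < n.+1) xi i.
pose u n := (n.+1%:R^-1 : K)%:C%C *: s n.
have dot_s i n : (i <= n)%N -> rdot (xi i) (s n) = n.+1%:R * c + (r - c).
  move=> iN; rewrite rdotC rdot_suml (bigD1 (Ordinal (n := n.+1) iN)) //=.
  rewrite rdot_nsq xi_nsq (eq_bigr (fun=> c)) => [|j ji]; last by rewrite xi_dot.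
  by rewrite sumr_const cardC1 card_ord -mulr_natl -[n.+1%:R]natr1; ring.
have dot_u n k : (n <= k)%N -> rdot (u n) (u k) = c + (r - c) / k.+1%:R.
  move=> nk; rewrite rdotZl rdotZr rdot_suml (eq_bigr (fun=> k.+1%:R * c + (r - c))); last first.
    by move=> i _; rewrite dot_s // (leq_trans _ nk) // -ltnS.
  rewrite sumr_const card_ord -[(_ + _) *+ _]mulr_natl.
  have n0 : n.+1%:R != 0 :> K by rewrite pnatr_eq0.
  have k0 : k.+1%:R != 0 :> K by rewrite pnatr_eq0.
  by move: n0 k0; move: (n.+1%:R) (k.+1%:R) => x y *; field; apply/andP.
have rc : 0 <= r - c.
  have := nsq_ge0 (xi 0%N - xi 1%N); rewrite nsqB !xi_nsq xi_dot //; lra.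
(* By [dot_u] the squared distance of u_n and u_k, n <= k, equals (r-c)/(n+1) - (r-c)/(k+1). *)
have [|l lP] := @nsq_complete K H u (r - c).
  move=> n k nk; rewrite nsqB -!rdot_nsq !dot_u //.
  have : 0 <= (r - c) / k.+1%:R by rewrite divr_ge0.
  by move: (_ / n.+1%:R) (_ / k.+1%:R) => x y; lra.
exists l => z d [N HN].
(* The total deviation of the finitely many exceptional terms; it enters the n-th average only as
   C/(n+1). *)
pose C : K := \sum_(i < N) (rdot (xi i) z - d).
have dot_uz n : (N <= n)%N -> rdot (u n) z - d = C / n.+1%:R.
  move=> Nn; have -> : rdot (u n) z - d = (\sum_(i < n.+1) (rdot (xi i) z - d)) / n.+1%:R.
    rewrite rdotZl rdot_suml sumrB sumr_const card_ord -[d *+ _]mulr_natl.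
    have : n.+1%:R != 0 :> K by rewrite pnatr_eq0.
    by move: (n.+1%:R) => x x0; field.
  congr (_ / _); rewrite -!(big_mkord xpredT (fun i => rdot (xi i) z - d)).
  rewrite (big_cat_nat (n := N)) //= ?leqW // [X in _ + X]big1_seq ?addr0 ?big_mkord // => i /andP[_].
  by rewrite mem_index_iota => /andP[Ni _]; rewrite HN // subrr.
apply/eqP; rewrite -subr_eq0 -normr_le0; apply/ler_addgt0Pl => e e0; rewrite addr0.
have p0 : 0 < rnorm z + 1 by rewrite ltr_wpDl ?rnorm_ge0.
have [M HM] := lP (e / 2 / (rnorm z + 1)) (divr_gt0 (divr_gt0 e0 (ltr0Sn _ _)) p0).
pose n := maxn (maxn N M) (Num.trunc (`|C| / (e / 2))).+1.
have Nn : (N <= n)%N by rewrite !leq_max leqnn.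
have Mn : (M <= n)%N by rewrite !leq_max leqnn orbT.
have -> : rdot l z - d = rdot (l - u n) z + C / n.+1%:R by rewrite -dot_uz // rdotBl; ring.
apply: le_trans (ler_normD _ _) _.
have h1 : `|rdot (l - u n) z| <= e / 2.
  apply: le_trans (rdot_le _ _) _; have := HM n Mn; rewrite ltr_pdivlMr // => h.
  by have := rnorm_ge0 (l - u n); move: h; lra.
have h2 : `|C / n.+1%:R| <= e / 2.
  rewrite normrM normfV (ger0_norm (ler0n _ _)) ler_pdivrMr ?ltr0Sn // mulrC.
  rewrite -ler_pdivrMr ?divr_gt0 //; apply: le_trans (ltW (truncnS_gt _)) _.
  by rewrite ler_nat leqW // leq_maxr.
by move: h1 h2; lra.
Qed.

(** The limit satisfies <eta, xi_l> = c, hence |eta|^2 = c. The last hypothesis gives <eta, V eta> =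
    c as well, and then |eta - V eta|^2 = c + c - 2c = 0. *)
Lemma exchangeable_fixed (eta : H) (U V : H -> H) :
  (forall z d, (exists N, forall j, (N <= j)%N -> rdot (xi j) z = d) -> rdot eta z = d) ->
  (forall u v, rdot (V u) v = rdot u (U v)) -> (forall u, nsq (V u) = nsq u) ->
  (exists N0, forall l, (N0 <= l)%N ->
    exists N, forall j, (N <= j)%N -> rdot (xi j) (U (xi l)) = c) ->
  V eta = eta.
Proof.
move=> etaP UV Vn [N0 UP].
have eta_xi l : rdot eta (xi l) = c.
  by apply: etaP; exists l.+1 => j lj; rewrite xi_dot // gtn_eqF.
have etaeta : nsq eta = c.
  by rewrite -rdot_nsq; apply: etaP; exists 0%N => j _; rewrite rdotC.
have etaV : rdot eta (V eta) = c.
  apply: (etaP); exists N0 => l lN; rewrite rdotC UV; apply: etaP; exact: UP.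
apply/eqP; rewrite -subr_eq0; apply/eqP/nsq_eq0.
by rewrite nsqB Vn rdotC etaV etaeta mulr2n subrr.
Qed.

End Exchangeable.

(** * Unitary actions and cyclic families *)

Section UnitaryActions.
Variables (K : realType) (G : groupType).

(** The algebraic part of a unitary representation; continuity is left out so that it covers
    [Ind nu] and twists by automorphisms directly. *)
Definition unitary_action (H : hilbert K) (act : G -> H -> H) : Prop :=
  [/\ forall g, linear (act g), forall v, act 1%g v = v,
      forall g h v, act (g * h)%g v = act g (act h v) &
      forall g u v, hdot H (act g u) (act g v) = hdot H u v].

Section Theory.
Variables (H : hilbert K) (act : G -> H -> H).
Hypothesis ua : unitary_action act.

Lemma ua_lin g k u v : act g (k *: u + v) = k *: act g u + act g v.
Proof. by case: ua => l _ _ _; rewrite l. Qed.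

Lemma ua1 v : act 1%g v = v. Proof. by case: ua. Qed.

Lemma uaM g h v : act (g * h)%g v = act g (act h v). Proof. by case: ua. Qed.

Lemma ua_hdot g u v : hdot H (act g u) (act g v) = hdot H u v. Proof. by case: ua. Qed.

Lemma uaK g v : act g^-1%g (act g v) = v. Proof. by rewrite -uaM mulVg ua1. Qed.

Lemma ua0 g : act g 0 = 0.
Proof. by have := ua_lin g (-1) 0 0; rewrite scaler0 addr0 scaleN1r addNr. Qed.

Lemma uaD g u v : act g (u + v) = act g u + act g v.
Proof. by have := ua_lin g 1 u v; rewrite !scale1r. Qed.

Lemma uaZ g k u : act g (k *: u) = k *: act g u.
Proof. by have := ua_lin g k u 0; rewrite ua0 !addr0. Qed.

Lemma uaB g u v : act g (u - v) = act g u - act g v.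
Proof. by rewrite uaD -scaleN1r uaZ scaleN1r. Qed.

Lemma ua_hdotV g u v : hdot H (act g u) v = hdot H u (act g^-1%g v).
Proof. by rewrite -(ua_hdot g^-1%g) uaK. Qed.

Lemma ua_rdot g u v : rdot (act g u) v = rdot u (act g^-1%g v).
Proof. by rewrite /rdot ua_hdotV. Qed.

Lemma ua_nsq g v : nsq (act g v) = nsq v.
Proof. by rewrite -!rdot_nsq ua_rdot uaK. Qed.

Lemma ua_rnorm g v : rnorm (act g v) = rnorm v.
Proof. exact/rnorm_nsq/ua_nsq. Qed.

Lemma ua_fixV g v : act g v = v -> act g^-1%g v = v.
Proof. by move=> {1}<-; rewrite uaK. Qed.

End Theory.

(** The translates of the vectors [i w] span a dense subspace, expressed by their orthogonal
    complement. *)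
Definition cyclic (H : hilbert K) (act : G -> H -> H) (V : Type) (i : V -> H) : Prop :=
  forall z, (forall g w, hdot H z (act g (i w)) = 0) -> z = 0.

(** Equal matrix coefficients mean equal Gram matrices of the two families of translates.
    [gram_unitary] then provides [T], and it intertwines because this can be tested on a total
    family. *)
Lemma cyclic_equivalent (H1 H2 : hilbert K) (act1 : G -> H1 -> H1)
    (act2 : G -> H2 -> H2) (V : Type) (i1 : V -> H1) (i2 : V -> H2) :
  unitary_action act1 -> unitary_action act2 ->
  (forall g w w', hdot H1 (act1 g (i1 w)) (i1 w') = hdot H2 (act2 g (i2 w)) (i2 w')) ->
  cyclic act1 i1 -> cyclic act2 i2 ->
  exists T : H1 -> H2, [/\ linear T, bijective T,
    forall u v, hdot H2 (T u) (T v) = hdot H1 u v &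
    forall g v, T (act1 g v) = act2 g (T v)].
Proof.
move=> u1 u2 i12 c1 c2.
pose a1 (p : G * V) := act1 p.1 (i1 p.2); pose a2 (p : G * V) := act2 p.1 (i2 p.2).
have tot1 : total_family a1 by move=> z z0; apply: c1 => g w; exact: (z0 (g, w)).
have tot2 : total_family a2 by move=> z z0; apply: c2 => g w; exact: (z0 (g, w)).
have [|T [Tl Tb Td Ta]] := @gram_unitary K _ H1 H2 a1 a2 _ tot1 tot2.
  move=> [g w] [h w']; rewrite /a1 /a2 /= [LHS](hdotC) [RHS]hdotC.
  rewrite (ua_hdotV u1) (ua_hdotV u2) [in LHS]hdotC [in RHS]hdotC.
  by rewrite -(uaM u1) -(uaM u2) i12.
exists T; split => // g v; apply/eqP; rewrite -subr_eq0; apply/eqP/tot2 => -[h w].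
have E : act2 g^-1%g (a2 (h, w)) = T (a1 (g^-1 * h, w)%g) by rewrite Ta /a2 /= (uaM u2).
rewrite linearBl /= (ua_hdotV u2) E Td -Ta Td (ua_hdotV u1) /a1 /= (uaM u1).
by rewrite subrr.
Qed.

End UnitaryActions.

(** * Vectors fixed by an open subgroup *)

Section Smooth.
Variables (K : realType) (A : comNzRingType) (pi : urep K (predT : {pred GL A})).

Lemma urep_unitary : unitary_action (ur_act pi).
Proof.
split=> [g|v|g h v|g u v]; [exact: ur_linear|exact: ur_act1|exact: ur_actM|exact: ur_hdot].
Qed.

Lemma urep_smooth v (e : K) : 0 < e ->
  exists n, forall g, Kg n g -> rnorm (ur_act pi g v - v) < e.
Proof.
move=> e0; have e0' : 0 < e%:C%C by have := e0; rewrite -ltcR.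
have /subspace_continuousP /(_ 1%g isT) c := @ur_cont _ _ _ pi v.
have /cvgrPdist_lt /(_ _ e0') [n Hn] := c; exists n => g gn.
rewrite -rnormN opprB rnorm_lt -[X in X - _](ur_act1 v); exact: (Hn g gn).
Qed.

(* C below is the closed convex hull of the orbit of v under Kg n, written as an
   intersection of half-spaces; its element of minimal norm is fixed by Kg n. *)
Lemma urep_fixed_vector (v : pi) : v != 0 ->
  exists n (u : pi), u != 0 /\ forall g, Kg n g -> ur_act pi g u = u.
Proof.
move=> v0; have ua := urep_unitary.
have n0 : 0 < rnorm v.
  rewrite lt_neqAle rnorm_ge0 andbT eq_sym; apply: contra v0 => /eqP nv.
  by apply/eqP/nsq_eq0; rewrite nsqE nv expr0n.
have [n Hn] := urep_smooth v (divr_gt0 n0 (ltr0Sn _ 1)).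
pose C u := forall z d, (forall g, Kg n g -> rdot (ur_act pi g v) z <= d) -> rdot u z <= d.
have midC x y : C x -> C y -> C ((2^-1 : K)%:C%C *: (x + y)).
  move=> Cx Cy z d H; rewrite rdotZl rdotDl.
  by have := Cx _ _ H; have := Cy _ _ H; lra.
have [||u Cu umin] := @min_norm_exists K pi C v midC.
- move=> x xC z d H; apply/ler_addgt0Pr => e e0.
  have p0 : 0 < rnorm z + 1 by rewrite ltr_wpDl ?rnorm_ge0.
  have [y Cy xy] := xC (e / (rnorm z + 1)) (divr_gt0 e0 p0).
  have := Cy _ _ H; have -> : rdot x z = rdot (x - y) z + rdot y z by rewrite rdotBl subrK.
  have := le_trans (ler_norm _) (rdot_le (x - y) z).
  move: xy; rewrite ltr_pdivlMr // => xy.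
  by have := rnorm_ge0 (x - y); move: xy; lra.
- by move=> z d H; have := H 1%g (@Kg1 A n); rewrite ur_act1.
exists n, u; split.
  (* [n] was chosen with |g v - v| < |v|/2 on [Kg n], so the orbit lies in the half-space <x, v> >=
     |v|^2/2, which does not contain 0. *)
  apply/eqP => u0; have := Cu (- v) (- (nsq v / 2)); rewrite u0 rdot0l.
  suff H : forall g, Kg n g -> rdot (ur_act pi g v) (- v) <= - (nsq v / 2).
    by move/(_ H); rewrite nsqE; have := exprn_gt0 2 n0; lra.
  move=> g /Hn gv; rewrite -[ur_act pi g v](subrK v) rdotDl !rdotNr rdot_nsq.
  have := le_trans (ler_norm _) (rdot_le (ur_act pi g v - v) (- v)).
  rewrite rnormN rdotNr => h; suff : rnorm (ur_act pi g v - v) * rnorm v <= nsq v / 2 by lra.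
  by rewrite nsqE expr2 mulrAC ler_pM2r // ltW.
move=> g gn; apply/esym; apply: (min_norm_unique midC Cu _ umin); last exact: ua_nsq.
move=> z d H; rewrite (ua_rdot ua); apply: Cu => h hn.
rewrite (ua_rdot ua) -(uaM ua) -invgM -(ua_rdot ua); apply: H; exact: KgM.
Qed.

End Smooth.

(** * Annihilators over Z/n *)

Section DoubleAnnihilator.
Variables (n : nat) (n_gt1 : (1 < n)%N).
Local Notation R := 'Z_n.

(** With g = gcd(d, n), the multiples of d are those of g by Bezout; n/g kills them, and it kills s
    only if g divides s. *)
Lemma Zp_annihilator (d s : R) : (forall t, s <> t * d) ->
  exists c, c * d = 0 /\ c * s <> 0.
Proof.
move=> sd; have n0 : n%:R = 0 :> R by rewrite -(natr_Zp n%:R) val_Zp_nat // modnn.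
have [u [v uv]] := Bezoutz (d : nat)%:Z n%:Z.
pose g := gcdn d n; have g0 : (0 < g)%N by rewrite gcdn_gt0 (ltnW n_gt1) orbT.
have gE : (u%:~R : R) * d = g%:R.
  have := congr1 (fun z : int => z%:~R : R) uv.
  rewrite /gcdz rmorphD !rmorphM /= -[X in _ = X]pmulrn => <-.
  rewrite -[n%:~R]/(n%:R) n0 mulr0 addr0; congr (_ * _).
  by rewrite -[RHS]/((d : nat)%:R) natr_Zp.
have [d' dE] : exists q, (d : nat) = (q * g)%N by apply/dvdnP/dvdn_gcdl.
have [n' nE] : exists q, n = (q * g)%N by apply/dvdnP/dvdn_gcdr.
exists (n'%:R); split.
  rewrite -(natr_Zp d) -natrM dE mulnCA -nE.
  by rewrite natrM n0 mulr0.
move=> cs; apply: (sd ((s %/ g)%N%:R * u%:~R)); rewrite -mulrA gE -natrM.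
rewrite divnK ?natr_Zp //.
have : ((n' * s)%N%:R : R) = 0 by rewrite natrM natr_Zp.
move/(congr1 val); rewrite /= val_Zp_nat // => /eqP; rewrite -/(dvdn _ _) {1}nE.
have n'0 : (0 < n')%N by move: (ltnW n_gt1); rewrite nE muln_gt0 => /andP[].
by rewrite dvdn_pmul2l.
Qed.

(** The Smith normal form of an integer lift of [B], reduced modulo n, makes the matrix diagonal;
    the claim then splits into coordinates, where it is [Zp_annihilator]. *)
Lemma rowspace_annihilator k m (B : 'M[R]_(k, m)) (x : 'rV_m) :
  (forall u, x <> u *m B) -> exists y : 'cV_m, B *m y = 0 /\ x *m y <> 0.
Proof.
move=> xB.
have [L Lu [T Tu [d _ BE]]] := int_Smith_normal_form (map_mx (fun z : R => (z : nat)%:Z) B).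
pose D : 'M[R]_(k, m) := \matrix_(i, j) ((d`_i)%:~R *+ (i == j :> nat)).
have unit_map q (X : 'M[int]_q) : X \in unitmx -> map_mx intr X \in @unitmx R q.
  move=> Xu; have := congr1 (map_mx (intr : int -> R)) (mulmxV Xu).
  by rewrite map_mxM map_mx1 => /mulmx1_unit[].
have {}BE : B = map_mx intr L *m D *m map_mx intr T.
  have -> : B = map_mx intr (map_mx (fun z : R => (z : nat)%:Z) B).
    by apply/matrixP => i j; rewrite !mxE -[RHS]/((B i j : nat)%:R) natr_Zp.
  rewrite BE !map_mxM; congr (_ *m _ *m _).
  by apply/matrixP => i j; rewrite !mxE rmorphMn.
pose L' : 'M[R]_k := map_mx intr L; pose T' : 'M[R]_m := map_mx intr T.
have L'u : L' \in unitmx by exact: unit_map.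
have T'u : T' \in unitmx by exact: unit_map.
pose x' := x *m invmx T'.
(* The diagonal entry of [D] in column j; the columns without a diagonal position are zero. *)
pose e (j : nat) : R := if (j < k)%N then (d`_j)%:~R else 0.
have [j jP] : exists j, forall t, x' 0 j <> t * e j.
  apply: contrapT => /forallNP H.
  have /choice[t tP] : forall j, exists t, x' 0 j = t * e j.
    by move=> j; apply: contrapT => /forallNP h; exact: (H j).
  apply: (xB ((\row_i (if insub (i : nat) is Some j then t j else 0)) *m invmx L')).
  rewrite BE -/L' -/T' !mulmxA mulmxKV //.
  rewrite -[LHS](mulmxKV T'u) -/x'; congr (_ *m _); apply/rowP => j.
  rewrite tP /e mxE; case: ifP => jk.
    rewrite (bigD1 (Ordinal jk)) //= !mxE eqxx big1 ?addr0 => [|i ij].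
      case: insubP => [j' _ jj'|/=]; last by rewrite ltn_ord.
      by congr (t _ * _); apply: val_inj.
    rewrite !mxE; case: eqP => [ij'|_]; last by rewrite mulr0.
    by case/eqP: ij; apply: val_inj.
  rewrite mulr0 big1 // => i _; rewrite !mxE; case: eqP => [ij|]; rewrite ?mulr0 //.
  by rewrite -ij ltn_ord in jk.
have [c [ce cx]] := Zp_annihilator jP.
exists (invmx T' *m (c *: delta_mx j 0)); split.
  rewrite BE -/L' -/T' !mulmxA mulmxK // -!mulmxA.
  suff -> : D *m (c *: (delta_mx j 0 : 'cV_m)) = 0 by rewrite mulmx0.
  apply/colP => i; rewrite -scalemxAr -colE !mxE.
  case: eqP => [ij|]; last by rewrite mulr0.
  by move: ce; rewrite /e -ij ltn_ord.
rewrite mulmxA -/x' -scalemxAr -colE => /matrixP/(_ 0 0); rewrite !mxE.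
by move: cx; rewrite /x' !mxE.
Qed.

End DoubleAnnihilator.

(** * Submodules of finitely supported sequences and their annihilators *)

Section Submodules.
Variable A : comNzRingType.
Implicit Types (L M S : set (nat -> A)) (v w a phi : nat -> A).

Definition submod S := S 0 /\ forall k v w, S v -> S w -> S (fun i => k * v i + w i).

Definition lowset n S := forall v, S v -> low n v.

(** Serves both for the columns annihilated by [L] and for the rows annihilated by [M]. *)
Definition ann S : set (nat -> A) := [set phi | finsupp phi /\ forall v, S v -> dotp v phi = 0].

Lemma submodD S v w : submod S -> S v -> S w -> S (v + w).
Proof.
by move=> [_ S1] Sv Sw; have := S1 1 v w Sv Sw; congr S; apply/funext => i; rewrite mul1r.
Qed.

Lemma submodZ S k v : submod S -> S v -> S (fun i => k * v i).
Proof.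
by move=> [S0 S1] Sv; have := S1 k v 0 Sv S0; congr S; apply/funext => i; rewrite addr0.
Qed.

Lemma submod_sum S n (F : 'I_n -> nat -> A) (c : 'I_n -> A) : submod S ->
  (forall i, c i = 0 \/ S (F i)) -> S (fun j => \sum_(i < n) c i * F i j).
Proof.
move=> sS; elim: n F c => [|n IH] F c SF.
  by have := sS.1; congr S; apply/funext => j; rewrite big_ord0.
have := submodD sS (IH (fun i => F (lift ord0 i)) _ (fun i => SF (lift ord0 i)))
  (_ : S (fun j => c ord0 * F ord0 j)).
move=> H; have := H _; rewrite (_ : _ + _ = fun j => \sum_(i < n.+1) c i * F i j); last first.
  by apply/funext => j; rewrite big_ord_recl addrC.
apply; case: (SF ord0) => [->|]; last exact: submodZ.
by have := sS.1; congr S; apply/funext => j; rewrite mul0r.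
Qed.

Lemma annD S v w : ann S v -> ann S w -> ann S (v + w).
Proof.
move=> [vf vS] [wf wS]; split=> [|u Su]; first exact: finsuppD.
by rewrite dotpDr // vS // wS // addr0.
Qed.

Lemma ann0 S : ann S 0.
Proof.
split=> [|v _]; first exact: finsupp0.
by rewrite (dotp_ord _ (n := 0)) ?big_ord0.
Qed.

Lemma annZ S k v : ann S v -> ann S (fun i => k * v i).
Proof.
move=> [vf vS]; split=> [|u Su]; first exact: finsuppZ.
by rewrite dotpZr // vS // mulr0.
Qed.

Lemma annN S v : ann S v -> ann S (- v).
Proof. by move=> /(annZ (-1)); congr ann; apply/funext => i; rewrite mulN1r. Qed.

Lemma annB S v w : ann S v -> ann S w -> ann S (v - w).
Proof. by move=> vS wS; apply: annD => //; exact: annN. Qed.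

Definition trunc n v : nat -> A := fun i => if (i < n)%N then v i else 0.

Lemma low_trunc n v : low n (trunc n v).
Proof. by move=> i; rewrite /trunc ltnNge => ->. Qed.

Lemma high_trunc n v : high n (v - trunc n v).
Proof. by move=> i ni; rewrite fun1D fun1N /trunc ni subrr. Qed.

Lemma ann_high n S v : lowset n S -> finsupp v -> high n v -> ann S v.
Proof. by move=> Sn vf vn; split=> // u /Sn un; exact: dotp_lowhigh un vn. Qed.

Lemma ann_trunc n S v : lowset n S -> ann S v -> ann S (trunc n v).
Proof.
move=> Sn vS; rewrite -[trunc n v](subKr v); apply: annB => //.
apply: (ann_high Sn _ (high_trunc _)); case: vS => vf _.
by apply: finsuppB => //; exact: low_finsupp (low_trunc _).
Qed.

End Submodules.

Section FiniteRing.
Variables (n : nat) (n_gt1 : (1 < n)%N).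
Local Notation R := 'Z_n.
Implicit Types (S L M : set (nat -> R)) (v w x phi : nat -> R).

Definition ofrow m (x : 'rV[R]_m) : nat -> R :=
  fun j => if insub j is Some i then x 0 i else 0.

Lemma ofrow_val m (x : 'rV[R]_m) (i : 'I_m) : ofrow x i = x 0 i.
Proof.
rewrite /ofrow; case: insubP => [j _ ji|]; last by rewrite ltn_ord.
by congr (x _ _); apply: val_inj.
Qed.

Lemma ofrow_low m (x : 'rV[R]_m) : low m (ofrow x).
Proof. by move=> j mj; rewrite /ofrow; case: insubP => // i; rewrite ltnNge mj. Qed.

Lemma ofrowK m v : low m v -> ofrow (\row_(i < m) v i) = v.
Proof.
move=> vm; apply/funext => j; have [jm|mj] := ltnP j m.
  by rewrite -[j]/(val (Ordinal jm)) ofrow_val mxE.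
by rewrite vm // ofrow_low.
Qed.

(** By finiteness of R^m, [S] is the row space of the matrix having all elements of [S] as rows,
    with a zero row for each vector of R^m outside [S]; [rowspace_annihilator] applies to it. *)
Lemma double_annihilator m S x : submod S -> lowset m S -> low m x -> ~ S x ->
  exists y, [/\ low m y, ann S y & dotp x y <> 0].
Proof.
move=> sS Sm xm xS; pose T : finType := 'rV[R]_m.
pose B : 'M[R]_(#|T|, m) := \matrix_(i, j)
  (if pselect (S (ofrow (enum_val i : 'rV_m))) then (enum_val i : 'rV_m) 0 j else 0).
have [|y [By xy]] := @rowspace_annihilator n n_gt1 _ _ B (\row_i x i).
  move=> u xu; apply: xS; rewrite -(ofrowK xm) xu.
  have -> : ofrow (u *m B) = fun j => \sum_(i < #|T|)
      (if pselect (S (ofrow (enum_val i : 'rV_m))) then u 0 i else 0) *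
      ofrow (enum_val i : 'rV_m) j.
    apply/funext => j; have [jm|mj] := ltnP j m; last first.
      by rewrite ofrow_low // big1 // => i _; rewrite ofrow_low // mulr0.
    rewrite -[j]/(val (Ordinal jm)) ofrow_val mxE; apply: eq_bigr => i _.
    by rewrite mxE ofrow_val; case: pselect => h /=; rewrite ?mulr0 ?mul0r.
  by apply: submod_sum => // i; case: pselect => h /=; [right|left].
have dotE v : low m v -> dotp v (ofrow y^T) = ((\row_i v i) *m y) 0 0.
  move=> vm; rewrite dotpC (dotp_ord _ vm) mxE; apply: eq_bigr => i _.
  by rewrite ofrow_val !mxE mulrC.
exists (ofrow y^T); split; first exact: ofrow_low.
  split=> [|v Sv]; first exact: low_finsupp (ofrow_low _).
  rewrite dotE; last exact: Sm.
  have := congr1 (fun z : 'cV_#|T| => z (enum_rank (\row_(i < m) v i : T)) 0) By.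
  rewrite /= [X in X = _ -> _]mxE [X in _ = X -> _]mxE => <-; rewrite [LHS]mxE.
  apply: eq_bigr => i _; rewrite !mxE enum_rankK ofrowK; last exact: Sm.
  by case: pselect => //= _; rewrite mxE.
rewrite dotE // => E; apply: xy; apply/matrixP => i j; rewrite !ord1 E.
by rewrite mxE.
Qed.

(** A submodule of R^m is finite, so all its elements together can serve as generators. *)
Lemma fg_submoduleP L : fg_submodule L <-> submod L /\ exists m, lowset m L.
Proof.
split.
  move=> [k [e [ef ->]]]; split.
    split; first by exists (fun=> 0); apply/funext => j; rewrite big1 // => i _; rewrite mul0r.
    move=> c _ _ [a ->] [b ->]; exists (fun i => c * a i + b i); apply/funext => j.
    rewrite mulr_sumr -big_split; apply: eq_bigr => i _ /=.
    by rewrite mulrA mulrDl.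
  have /choice[N NP] := ef.
  exists (\max_(i < k) N i) => _ [a ->] j mj; rewrite big1 // => i _.
  by rewrite NP ?mulr0 // (leq_trans _ mj) // leq_bigmax.
move=> [sL [m Lm]]; pose T : finType := 'rV[R]_m.
exists #|T|, (fun i => if pselect (L (ofrow (enum_val i : 'rV_m)))
  then ofrow (enum_val i : 'rV_m) else 0); split.
  by move=> i; case: pselect => _ /=; [exact: low_finsupp (ofrow_low _)|exact: finsupp0].
apply/seteqP; split=> [v Lv|_ [a ->]]; last first.
  apply: submod_sum => // i; right; case: pselect => //= _; exact: sL.1.
pose r := enum_rank (\row_(i < m) v i : T).
exists (fun i => (i == r)%:R); apply/funext => j.
rewrite (bigD1 r) //= eqxx mul1r big1 ?addr0 => [|i /negPf ->]; last by rewrite mul0r.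
rewrite enum_rankK ofrowK; last exact: Lm.
by case: pselect.
Qed.

Lemma fg_setI L M : fg_submodule L -> fg_submodule M -> fg_submodule (L `&` M).
Proof.
move=> /fg_submoduleP[[L0 L1] [m Lm]] /fg_submoduleP[[M0 M1] _]; apply/fg_submoduleP; split.
  by split=> // k v w [Lv Mv] [Lw Mw]; split; [exact: L1|exact: M1].
by exists m => v [/Lm].
Qed.

Lemma fg_full m : fg_submodule [set v : nat -> R | low m v].
Proof.
apply/fg_submoduleP; split; last by exists m.
split=> // k v w vm wm i mi; by rewrite vm // wm // mulr0 addr0.
Qed.

Lemma fg_finite L : fg_submodule L -> finite_set L.
Proof.
move=> /fg_submoduleP[_ [m Lm]]; apply: (sub_finite_set (B := range (@ofrow m))).
  by move=> v /Lm vm; exists (\row_i v i); rewrite ?ofrowK.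
by apply: finite_image; exact: finite_finset.
Qed.

(** Were phi outside the sum of the two annihilators, some y annihilating this sum would satisfy y
    phi <> 0. By double annihilation y lies in both [L1] and [L2], so phi kills it. *)
Lemma ann_setI m L1 L2 phi : fg_submodule L1 -> fg_submodule L2 ->
  lowset m L1 -> lowset m L2 -> low m phi -> ann (L1 `&` L2) phi ->
  exists phi1 phi2, [/\ phi = phi1 + phi2, low m phi1, low m phi2, ann L1 phi1 & ann L2 phi2].
Proof.
move=> /fg_submoduleP[s1 _] /fg_submoduleP[s2 _] m1 m2 pm pL.
pose S : set (nat -> R) := [set x | exists x1 x2,
  [/\ x = x1 + x2, low m x1, low m x2, ann L1 x1 & ann L2 x2]].
apply: contrapT => pS.
have addZ k (v w : nat -> R) : low m v -> low m w -> low m (fun i => k * v i + w i).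
  by move=> vm wm i mi; rewrite vm // wm // mulr0 addr0.
have sS : submod S.
  split; first by exists 0, 0; split; rewrite ?addr0 //; exact: ann0.
  move=> k _ _ [x1 [x2 [-> ? ? ? ?]]] [y1 [y2 [-> ? ? ? ?]]].
  exists (fun i => k * x1 i + y1 i), (fun i => k * x2 i + y2 i).
  split; [|exact: addZ|exact: addZ| |].
  - by apply/funext => i; rewrite !fun1D mulrDr addrACA.
  - by apply: (annD (annZ k _)).
  - by apply: (annD (annZ k _)).
have Sm : lowset m S.
  by move=> _ [x1 [x2 [-> h1 h2 _ _]]] i mi; rewrite fun1D h1 // h2 // addr0.
have [y [ym yS py]] := double_annihilator sS Sm pm pS.
have mem L : submod L -> lowset m L -> (forall x, low m x -> ann L x -> S x) -> L y.
  move=> sL Lm LS; apply: contrapT => yL.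
  have [z [zm zL yz]] := double_annihilator sL Lm ym yL.
  by apply: yz; rewrite dotpC yS.2 //; exact: LS.
apply: py; rewrite dotpC pL.2 //; split.
  apply: (mem _ s1 m1) => x xm xL; exists x, 0; split=> //; rewrite ?addr0 //.
  exact: ann0.
apply: (mem _ s2 m2) => x xm xL; exists 0, x; split=> //; rewrite ?add0r //.
exact: ann0.
Qed.

End FiniteRing.

(** * Factorization of the elements of Gbullet *)

Section Factorization.
Variable A : comNzRingType.
Implicit Types (L M : set (nat -> A)) (v w a phi : nat -> A) (g h : GL A).

(** The relations B_k F_l = 0 cancel all cross terms, so the product of the 1 + F_k B_k is 1 plus
    the sum of the F_k B_k. *)
Lemma colmul_trv_prod r (F B : nat -> nat -> A) psi :
  (forall k, (k < r)%N -> finsupp (F k) /\ finsupp (B k)) ->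
  (forall k l, (k < r)%N -> (l < r)%N -> dotp (B k) (F l) = 0) -> finsupp psi ->
  colmul (\prod_(k < r) trv (F k) (B k))%g psi =
  fun i => psi i + \sum_(k < r) F k i * dotp (B k) psi.
Proof.
elim: r psi => [|r IH] psi fin orth psif.
  by rewrite big_ord0 colmul1g; apply/funext => i; rewrite big_ord0 addr0.
have ok : trv_ok (F r) (B r) by split; [exact: (fin r _).1|exact: (fin r _).2|exact: orth].
rewrite big_ord_recr /= -colmulM // colmul_trv //.
have psi'f : finsupp (fun i => psi i + F r i * dotp (B r) psi).
  apply: (finsuppD psif); have := finsuppZ (dotp (B r) psi) (fin r (leqnn _)).1.
  by congr finsupp; apply/funext => i; rewrite mulrC.
rewrite IH // => [|k kr|k l kr lr]; last 2 first.
- by apply: fin; exact: ltnW.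
- by apply: orth; exact: ltnW.
apply/funext => i; rewrite big_ord_recr /= -addrA [X in _ + X]addrC; congr (_ + (_ + _)).
apply: eq_bigr => k _; congr (_ * _).
have -> : (fun i => psi i + F r i * dotp (B r) psi) = psi + (fun i => dotp (B r) psi * F r i).
  by apply/funext => j; rewrite fun1D mulrC.
have kr : (k < r.+1)%N by rewrite ltnS ltnW.
have [Ff _] := fin r (leqnn _).
by rewrite dotpDr ?dotpZr ?orth ?mulr0 ?addr0 //; exact: finsuppZ.
Qed.

Lemma rowmul_trv_prod r (F B : nat -> nat -> A) b :
  (forall k, (k < r)%N -> finsupp (F k) /\ finsupp (B k)) ->
  (forall k l, (k < r)%N -> (l < r)%N -> dotp (B k) (F l) = 0) ->
  rowmul b (\prod_(k < r) trv (F k) (B k))%g =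
  fun j => b j + \sum_(k < r) dotp b (F k) * B k j.
Proof.
elim: r b => [|r IH] b fin orth.
  by rewrite big_ord0 rowmul1g; apply/funext => i; rewrite big_ord0 addr0.
have ok : trv_ok (F r) (B r) by split; [exact: (fin r _).1|exact: (fin r _).2|exact: orth].
rewrite big_ord_recr /= -rowmulM IH // => [|k kr|k l kr lr]; last 2 first.
- by apply: fin; exact: ltnW.
- by apply: orth; exact: ltnW.
rewrite rowmul_trv //; apply/funext => j; rewrite big_ord_recr /= -addrA.
congr (_ + (_ + _ * _)); have [Ff _] := fin r (leqnn _).
rewrite -[fun _ => _]/(b + fun j => \sum_(k < r) dotp b (F k) * B k j) dotpDl //.
suff -> : dotp (fun j => \sum_(k < r) dotp b (F k) * B k j) (F r) = 0 by rewrite addr0.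
have [m Fm] := Ff; rewrite (dotp_ord _ Fm).
under eq_bigr do rewrite mulr_suml.
rewrite exchange_big big1 //= => k _; under eq_bigr do rewrite -mulrA.
by rewrite -mulr_sumr -(dotp_ord _ Fm) orth ?mulr0 // ltnS ltnW.
Qed.

(** For a finitely supported w, the condition w (g^t)^-1 = w amounts to g w = w with w read as a
    column. *)
Definition fixes_pt L M g : Prop :=
  (forall v, L v -> rowmul v g = v) /\ (forall w, M w -> colmul g w = w).

Lemma fixes_ptM L M g h : (forall w, M w -> finsupp w) ->
  fixes_pt L M g -> fixes_pt L M h -> fixes_pt L M (g * h)%g.
Proof.
move=> Mf [gL gM] [hL hM]; split=> v Lv; first by rewrite -rowmulM gL ?hL.
by rewrite -colmulM ?hM ?gM //; exact: Mf.
Qed.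

Lemma fixes_ptV L M g : (forall w, M w -> finsupp w) ->
  fixes_pt L M g -> fixes_pt L M g^-1%g.
Proof.
move=> Mf [gL gM]; split=> v Lv; first by rewrite -{1}(gL _ Lv) rowmulK.
by rewrite -{1}(gM _ Lv) colmulM ?mulVg ?colmul1g //; exact: Mf.
Qed.

(* Together with fixes_pt, this is the part of the block form defining Gbullet
   that does not depend on the choice of b and c; see bullet_tensor. *)
Definition tensor_cols L M n g : Prop :=
  exists s : seq ((nat -> A) * (nat -> A)),
    (forall p, List.In p s -> ann L p.1 /\ ann M p.2 /\ low n p.2) /\
    forall i j, (j < n)%N -> g i j = (i == j)%:R + \sum_(p <- s) p.1 i * p.2 j.

(** When [L] and [M] are supported below n, e_j with j >= n annihilates both, so these are
    transvections attached to (L, M). *)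
Definition far_trv L M n g : Prop :=
  (exists phi j, [/\ (n <= j)%N, ann L phi, phi j = 0 & g = trv phi (delta A j)]) \/
  (exists a j, [/\ (n <= j)%N, ann M a, a j = 0 & g = trv (delta A j) a]).

Lemma trv_ok_delta phi j : finsupp phi -> phi j = 0 -> trv_ok phi (delta A j).
Proof. by move=> ? ?; split; [|exact: delta_finsupp|rewrite dotpC dotp_delta]. Qed.

Lemma trv_delta_ok a j : finsupp a -> a j = 0 -> trv_ok (delta A j) a.
Proof. by move=> ? ?; split; [exact: delta_finsupp| |rewrite dotp_delta]. Qed.

Lemma In_nth (T : Type) (x0 : T) (s : seq T) k : (k < size s)%N -> List.In (nth x0 s k) s.
Proof. by elim: s k => // x s IH [|k] /=; [left|move=> /IH; right]. Qed.

(* Let g - 1 agree with the sum of the Phi_k B_k on the first n columns, let D_k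
   be coordinate vectors beyond all the supports and put Z_k = B_k g^-1.  Then
   e = (1 - D Z)(1 + Phi D)(1 + D B) has the same first n columns as g, because
   Z g = B; and e^-1 g, whose first n columns are trivial, becomes an element
   of Kg n after its first n rows have been cleared by transvections. *)
Lemma tensor_factor L M n g (P : set (GL A)) :
  lowset n L -> lowset n M -> fixes_pt L M g -> tensor_cols L M n g ->
  P 1%g -> (forall x y, P x -> P y -> P (x * y)%g) ->
  (forall x, far_trv L M n x -> P x) ->
  exists e k e', [/\ P e, P e', Kg n k & g = (e * k * e')%g].
Proof.
move=> Ln Mn [gL gM] [s [sP gs]] P1 PM PF; pose r := size s.
pose Phi k := (nth (0, 0) s k).1; pose B k := (nth (0, 0) s k).2.
have PhiL k : (k < r)%N -> ann L (Phi k) by move=> kr; case: (sP _ (In_nth (0, 0) kr)).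
have BM k : (k < r)%N -> ann M (B k) by move=> kr; case: (sP _ (In_nth (0, 0) kr)) => _ [].
have Bn k : (k < r)%N -> low n (B k) by move=> kr; case: (sP _ (In_nth (0, 0) kr)) => _ [].
have {}gs i j : (j < n)%N -> g i j = (i == j)%:R + \sum_(k < r) Phi k i * B k j.
  by move=> jn; rewrite gs // (big_nth (0, 0)) big_mkord.
pose Z k := rowmul (B k) g^-1%g.
have Bf k : (k < r)%N -> finsupp (B k) by move=> /Bn; exact: low_finsupp.
have Zf k : (k < r)%N -> finsupp (Z k) by move=> /Bf h; exact: rowmul_finsupp h (gl_fin _).
have Pf k : (k < r)%N -> finsupp (Phi k) by move=> /PhiL [].
have Mf w : M w -> finsupp w by move=> /Mn/low_finsupp.
have [gVL gVM] : fixes_pt L M g^-1%g by exact: fixes_ptV.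
have ZM k : (k < r)%N -> ann M (Z k).
  move=> kr; split=> [|w Mw]; first exact: Zf.
  rewrite dotpC dotp_rowmul; [|exact: Mf|exact: (gl_fin _).2].
  by rewrite gVM // dotpC; case: (BM k kr) => _; exact.
have [J0 J0P] : exists m, forall k, (k < r)%N -> low m (Phi k) /\ low m (Z k).
  have [|m mP] := @finsupp_unif A (fun k => if (k < r)%N then Phi k else 0) r.
    by move=> k; case: ifP => [/Pf//|_]; exact: finsupp0.
  have [|l lP] := @finsupp_unif A (fun k => if (k < r)%N then Z k else 0) r.
    by move=> k; case: ifP => [/Zf//|_]; exact: finsupp0.
  exists (maxn m l) => k kr; split=> i; rewrite geq_max => /andP[mi li].
    by have := mP k i kr mi; rewrite kr.
  by have := lP k i kr li; rewrite kr.
(* Taking J >= n also keeps the D_k away from the B_k and from the first n coordinate vectors. *)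
pose J := maxn J0 n; have nJ k : (n <= J + k)%N by rewrite (leq_trans (leq_maxr J0 n)) // leq_addr.
have PhiJ k i : (k < r)%N -> (J <= i)%N -> Phi k i = 0.
  by move=> kr Ji; apply: (J0P k kr).1; rewrite (leq_trans _ Ji) // leq_maxl.
have ZJ k i : (k < r)%N -> (J <= i)%N -> Z k i = 0.
  by move=> kr Ji; apply: (J0P k kr).2; rewrite (leq_trans _ Ji) // leq_maxl.
have BJ k i : (k < r)%N -> (J <= i)%N -> B k i = 0.
  by move=> kr Ji; apply: Bn => //; rewrite (leq_trans _ Ji) // leq_maxr.
pose D k := delta A (J + k); pose ZN k := - Z k.
have ZNf k : (k < r)%N -> finsupp (ZN k) by move=> kr; apply/finsuppN/Zf.
have Df k : finsupp (D k) by exact: delta_finsupp.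
pose e1 := (\prod_(k < r) trv (Phi k) (D k))%g.
pose e2 := (\prod_(k < r) trv (D k) (B k))%g.
pose e3 := (\prod_(k < r) trv (D k) (ZN k))%g.
have prodP (F : 'I_r -> GL A) : (forall k, P (F k)) -> P (\prod_k F k)%g.
  by move=> PFk; apply: (big_ind P) => //; exact: PM.
have far1 k : (k < r)%N -> far_trv L M n (trv (Phi k) (D k)).
  by move=> kr; left; exists (Phi k), (J + k)%N; split; rewrite ?PhiJ ?leq_addr //; exact: PhiL.
have far2 k : (k < r)%N -> far_trv L M n (trv (D k) (B k)).
  by move=> kr; right; exists (B k), (J + k)%N; split; rewrite ?BJ ?leq_addr //; exact: BM.
have far3 k : (k < r)%N -> far_trv L M n (trv (D k) (ZN k)).
  move=> kr; right; exists (ZN k), (J + k)%N; split=> //; first exact/annN/ZM.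
  by rewrite /ZN fun1N ZJ ?leq_addr ?oppr0.
have far_fix x : far_trv L M n x -> fixes_pt L M x.
  case=> [[phi [j [nj phiL phij ->]]]|[a [j [nj aM aj ->]]]].
    have ok := trv_ok_delta phiL.1 phij; split=> [v Lv|w Mw].
      rewrite rowmul_trv // phiL.2 //; apply/funext => i; by rewrite mul0r addr0.
    rewrite colmul_trv //; last exact: Mf.
    by rewrite dotpC dotp_delta (Mn _ Mw) //; apply/funext => i; rewrite mulr0 addr0.
  have ok := trv_delta_ok aM.1 aj; split=> [v Lv|w Mw].
    rewrite rowmul_trv // dotp_delta (Ln _ Lv) //; apply/funext => i; by rewrite mul0r addr0.
  rewrite colmul_trv //; last exact: Mf.
  by rewrite dotpC aM.2 //; apply/funext => i; rewrite mulr0 addr0.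
have prod_fix (F : 'I_r -> GL A) : (forall k, far_trv L M n (F k)) -> fixes_pt L M (\prod_k F k)%g.
  move=> Ffar; apply: (big_ind (fixes_pt L M)) => [|x y|i0 _].
  - by split=> v _; rewrite ?rowmul1g ?colmul1g.
  - exact: fixes_ptM.
  - exact: far_fix.
pose e := (e3 * (e1 * e2))%g.
have eP : P e.
  apply: (PM); last apply: (PM); apply: prodP => i0; apply: (PF).
  - exact: far3 (ltn_ord _).
  - exact: far1 (ltn_ord _).
  - exact: far2 (ltn_ord _).
have eF : fixes_pt L M e.
  apply: fixes_ptM => //; [|apply: fixes_ptM => //]; apply: prod_fix => i0;
  [exact: far3 (ltn_ord _)|exact: far1 (ltn_ord _)|exact: far2 (ltn_ord _)].
have e_col j : (j < n)%N -> colmul e (delta A j) = colmul g (delta A j).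
  move=> jn; have jf := delta_finsupp A j.
  have Dj k : dotp (D k) (delta A j) = 0.
    by rewrite dotp_delta /D deltaE gtn_eqF // (leq_trans jn).
  have BDk k l : (k < r)%N -> dotp (B k) (D l) = 0.
    by move=> kr; rewrite dotp_delta BJ // leq_addr.
  have ZDk k l : (k < r)%N -> dotp (ZN k) (D l) = 0.
    by move=> kr; rewrite dotp_delta /ZN fun1N ZJ ?leq_addr // oppr0.
  have DPk k l : (l < r)%N -> dotp (D k) (Phi l) = 0.
    by move=> lr; rewrite dotpC dotp_delta PhiJ // leq_addr.
  have E2 : colmul e2 (delta A j) = delta A j + (fun i => \sum_(k < r) B k j * D k i).
    rewrite colmul_trv_prod //; last 2 first.
    - by move=> k kr; split; [exact: Df|exact: Bf].
    - by move=> k l kr lr; exact: BDk.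
    apply/funext => i; rewrite fun1D; congr (_ + _); apply: eq_bigr => k _.
    by rewrite dotp_delta mulrC.
  have sumDf : finsupp (fun i => \sum_(k < r) B k j * D k i).
    exists (J + r)%N => i Ji; rewrite big1 // => k _.
    by rewrite /D deltaE ltn_eqF ?mulr0 // (leq_trans _ Ji) // ltn_add2l.
  have dotD (b : nat -> A) : finsupp b -> dotp b (fun i => \sum_(k < r) B k j * D k i) =
      \sum_(k < r) B k j * b (J + k)%N.
    move=> [m bm]; rewrite dotpC (dotp_ord _ bm).
    under eq_bigr do rewrite mulr_suml.
    rewrite exchange_big /=; apply: eq_bigr => k _.
    under eq_bigr do rewrite -mulrA.
    by rewrite -mulr_sumr -(dotp_ord _ bm) dotpC dotp_delta.
  have E1 : colmul (e1 * e2)%g (delta A j) = colmul g (delta A j) + (fun i => \sum_(k < r) B k j * D k i).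
    rewrite -colmulM // E2 colmul_trv_prod //; last first.
    - by apply: finsuppD.
    - by move=> k l kr lr; exact: DPk.
    - by move=> k kr; split; [exact: Pf|exact: Df].
    apply/funext => i; rewrite !fun1D delta_colmul gs // deltaE [j == i]eq_sym addrAC.
    congr (_ + _ + _); apply: eq_bigr => k _.
    rewrite dotpDr // Dj add0r dotD // (bigD1 k) //= big1 ?addr0 => [|l lk].
      by rewrite /D deltaE eqxx mulr1.
    rewrite /D deltaE eqn_add2l; case: eqP => [kl|]; rewrite ?mulr0 //.
    by case/eqP: lk; apply: val_inj.
  have gf : finsupp (colmul g (delta A j)) by exact: colmul_finsupp (gl_fin g).
  rewrite -colmulM // E1 colmul_trv_prod //; last first.
  - by apply: finsuppD.
  - by move=> k l kr lr; exact: ZDk.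
  - by move=> k kr; split; [exact: Df|exact: ZNf].
  apply/funext => i; rewrite fun1D -addrA -[RHS]addr0; congr (_ + _).
  rewrite -big_split big1 //= => k _.
  rewrite dotpDr // dotD; last exact: ZNf.
  rewrite (_ : \sum_(l < r) B l j * ZN k (J + l)%N = 0) ?addr0; last first.
    by rewrite big1 // => l _; rewrite /ZN fun1N ZJ ?leq_addr ?oppr0 ?mulr0.
  rewrite /ZN dotpNl // dotp_GL // dotp_delta mulrN mulrC.
  by rewrite [D k i * _]mulrC subrr.
pose k0 := (e^-1 * g)%g.
have k0c j : (j < n)%N -> colmul k0 (delta A j) = delta A j.
  move=> jn; have jf := delta_finsupp A j.
  by rewrite -colmulM // -e_col // colmulM // mulVg colmul1g.
have k0F : fixes_pt L M k0 by apply: fixes_ptM => //; exact: fixes_ptV.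
have [N0 N0P] := @finsupp_unif A k0 n (gl_fin k0).1.
(* Since the first n columns of [k0] are trivial, its first n rows are those of 1 plus the sum of
   the b_l e_(n+l). The b_l annihilate [L] because [k0] fixes [L] pointwise and [L] vanishes at n +
   l. *)
pose b l i := if (i < n)%N then k0 i (n + l)%N else 0.
have bn l : low n (b l) by move=> i; rewrite /b ltnNge => ->.
have bL l : ann L (b l).
  split=> [|v Lv]; first exact: low_finsupp (bn l).
  rewrite (dotp_ord _ (bn l)); have vn := Ln _ Lv.
  have := congr1 (fun f => f (n + l)%N) (k0F.1 _ Lv); rewrite (vn (n + l)%N) ?leq_addr // => E; rewrite -[RHS]E.
  rewrite /rowmul -/(dotp _ _) dotpC (dotp_ord _ vn); apply: eq_bigr => i _.
  by rewrite /b ltn_ord mulrC.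
pose D' l := delta A (n + l).
pose e' := (\prod_(l < N0) trv (b l) (D' l))%g.
have bf l : finsupp (b l) by exact: low_finsupp (bn l).
have D'f l : finsupp (D' l) by exact: delta_finsupp.
have D'b k l : dotp (D' k) (b l) = 0 by rewrite dotpC dotp_delta bn // leq_addr.
have e'P : P e'.
  rewrite /e'; apply: (big_ind P) => // l _; apply: PF; left.
  by exists (b l), (n + l)%N; split; rewrite ?leq_addr // bn // leq_addr.
exists e, (k0 * e'^-1)%g, e'; split=> //; last by rewrite !mulgA mulgVK mulgV mul1g.
apply/KgP; split=> i ni.
  rewrite -[LHS](delta_rowmul _ (k0 * e'^-1)%g) -rowmulM delta_rowmul.
  rewrite -[RHS](rowmulK _ e'); congr (rowmul _ _).
  rewrite rowmul_trv_prod //; apply/funext => j.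
  rewrite (eq_bigr (fun l : 'I_N0 => k0 i (n + l)%N * D' l j)) => [|l _]; last first.
    by rewrite dotpC dotp_delta /b ni.
  have [jn|nj] := ltnP j n.
    rewrite big1 ?addr0 => [|l _]; last first.
      by rewrite /D' deltaE gtn_eqF ?mulr0 // (leq_trans jn) // leq_addr.
    by rewrite -[LHS]/((k0^~ j) i) -delta_colmul k0c // !deltaE eq_sym.
  rewrite deltaE ltn_eqF ?(leq_trans ni) // add0r.
  have [jN|Nj] := ltnP (j - n) N0; last first.
    rewrite N0P // ?(leq_trans Nj) ?leq_subr // big1 // => l _.
    rewrite /D' deltaE; case: eqP => [E|]; rewrite ?mulr0 //.
    by move: Nj; rewrite -E addKn leqNgt ltn_ord.
  rewrite (bigD1 (Ordinal jN)) //= /D' deltaE subnKC // eqxx mulr1 big1 ?addr0 // => l lj.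
  rewrite deltaE; case: eqP => [E|]; rewrite ?mulr0 //.
  by case/eqP: lj; apply: val_inj; rewrite /= -E addKn.
have ef := delta_finsupp A i.
rewrite -[LHS](delta_colmul _ (k0 * e'^-1)%g) -colmulM //.
suff -> : colmul e'^-1%g (delta A i) = delta A i by exact: k0c.
have E : colmul e' (delta A i) = delta A i.
  rewrite colmul_trv_prod //; apply/funext => j; rewrite big1 ?addr0 // => l _.
  by rewrite dotp_delta /D' deltaE gtn_eqF ?mulr0 // (leq_trans ni) // leq_addr.
by rewrite -{1}E colmulM // mulVg colmul1g.
Qed.

End Factorization.

(** * Averages over transvections *)

Section Averaging.
Variables (K : realType) (A : comNzRingType) (H : hilbert K).
Implicit Types (act : GL A -> H -> H) (a phi psi : nat -> A) (v z : H).

Definition Kfixed act m v := forall g, Kg m g -> act g v = v.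

(** For [low m phi] these are unipotent upper triangular block matrices of size m + oo; those of
    [ltype] are lower triangular. *)
Definition utype act m phi v := forall j, (m <= j)%N -> act (trv phi (delta A j)) v = v.

Definition ltype act m a v := forall j, (m <= j)%N -> act (trv (delta A j) a) v = v.

Lemma trv_ok_lowhigh m phi a : low m phi -> high m a -> finsupp a -> trv_ok phi a.
Proof. by move=> pm am af; split=> //; [exact: low_finsupp pm|exact: dotp_highlow am pm]. Qed.

Lemma trv_ok_highlow m phi a : high m phi -> low m a -> finsupp phi -> trv_ok phi a.
Proof. by move=> pm am pf; split=> //; [exact: low_finsupp am|exact: dotp_lowhigh am pm]. Qed.

Lemma highB m a b : high m a -> high m b -> high m (a - b).
Proof. by move=> am bm i im; rewrite fun1D fun1N am // bm // subr0. Qed.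

Lemma highD m a b : high m a -> high m b -> high m (a + b).
Proof. by move=> am bm i im; rewrite fun1D am // bm // addr0. Qed.

(* eta is the limit of the averages of the vectors act (trv phi (delta A j)) xi,
   hence the projection of xi to the vectors of type phi. *)
Lemma average_utype act m phi xi : unitary_action act -> low m phi -> Kfixed act m xi ->
  exists eta, [/\ Kfixed act m eta, utype act m phi eta,
    forall psi, low m psi -> utype act m psi xi -> utype act m psi eta,
    forall a, low m a -> ltype act m a xi -> ltype act m a eta &
    forall z, Kfixed act m z -> utype act m phi z -> hdot H eta z = hdot H xi z].
Proof.
move=> ua pm xiK.
have df j : finsupp (delta A j) by exact: delta_finsupp.
have ok a : high m a -> finsupp a -> trv_ok phi a by move=> *; exact: trv_ok_lowhigh pm _ _.
have okd j : (m <= j)%N -> trv_ok phi (delta A j) by move=> mj; apply: ok => //; exact: high_delta.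
have okm l : trv_ok phi (delta A (m + l)) by apply: okd; exact: leq_addr.
pose f a := rdot (act (trv phi a) xi) xi.
have fJ k l : (m <= l)%N -> Kg m k -> act (k * trv phi (delta A l))%g xi = act (trv phi (rowmul (delta A l) k^-1%g)) xi.
  move=> ml km; have -> : (k * trv phi (delta A l) = k * trv phi (delta A l) * k^-1 * k)%g.
    by rewrite mulgVK.
  by rewrite (trvJ _ (okd _ ml)) (colmul_Kg km) // (uaM ua) xiK.
(* Such a row is a = e_l k with k = 1 + e_l (a - e_l) in [Kg m]. Conjugation by k turns 1 + phi e_l
   into 1 + phi a, and k fixes xi. *)
have f1 a l : high m a -> finsupp a -> (m <= l)%N -> a l = 1 -> f a = f (delta A l).
  move=> am af ml al.
  have ok1 : trv_ok (delta A l) (a - delta A l).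
    split; rewrite ?dotp_delta //; first exact: finsuppB.
    by rewrite fun1D fun1N al deltaE eqxx subrr.
  pose k := trv (delta A l) (a - delta A l).
  have km : Kg m k by apply: trv_Kg => //; [exact: high_delta|apply: highB => //; exact: high_delta].
  have ka : rowmul (delta A l) k = a.
    rewrite rowmul_trv //; apply/funext => i.
    by rewrite dotp_delta [delta A l l]deltaE eqxx mul1r fun1D fun1N addrC subrK.
  have E : act (k^-1 * trv phi (delta A l))%g xi = act (trv phi a) xi.
    by rewrite fJ // ?invgK ?ka //; exact: KgV.
  by rewrite /f -E (uaM ua) (ua_rdot ua) invgK (xiK _ km).
pose c := f (delta A m).
(* The row e_l + e_m has coordinate 1 at both places, which links e_l to e_m. *)
have f2 l : (m <= l)%N -> f (delta A l) = c.
  rewrite leq_eqVlt => /orP[/eqP <- //|ml].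
  have hf : finsupp (delta A l + delta A m) by exact: finsuppD.
  have hh : high m (delta A l + delta A m).
    by apply: highD; apply: high_delta => //; exact: ltnW.
  rewrite -(f1 (delta A l + delta A m) l) //; last 2 first.
  - exact: ltnW.
  - by rewrite fun1D !deltaE eqxx ltn_eqF // addr0.
  by apply: f1 => //; rewrite fun1D !deltaE eqxx gtn_eqF // add0r.
have fc a l : high m a -> finsupp a -> (m <= l)%N -> a l = 1 -> f a = c.
  by move=> am af ml al; rewrite (f1 a l) // f2.
have dotE a b : high m a -> finsupp a -> high m b -> finsupp b ->
    rdot (act (trv phi a) xi) (act (trv phi b) xi) = f (a - b).
  move=> am af bm bf; have okb := ok _ bm bf.
  by rewrite rdotC (ua_rdot ua) rdotC -trvN // -(uaM ua) -trvDr ?[- b + a]addrC //;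
    [exact: trv_okN|exact: ok].
pose x j := act (trv phi (delta A (m + j))) xi.
have hd j : high m (delta A (m + j)) by apply: high_delta; exact: leq_addr.
have x_nsq j : nsq (x j) = nsq xi by exact: ua_nsq.
have x_dot i j : i != j -> rdot (x i) (x j) = c.
  move=> ij; rewrite dotE //; apply: (fc _ (m + i)%N); rewrite ?leq_addr //.
  - exact: highB.
  - exact: finsuppB.
  - by rewrite fun1D fun1N !deltaE eqxx eqn_add2l eq_sym (negPf ij) subr0.
have [eta etaP] := exchangeable_limit x_nsq x_dot.
have fixed g : (exists N0, forall l, (N0 <= l)%N ->
    exists N, forall j, (N <= j)%N -> rdot (x j) (act g (x l)) = c) -> act g eta = eta.
  move=> h; rewrite -[g]invgK; apply: (ua_fixV ua).
  apply: (exchangeable_fixed x_dot etaP (U := act g)) => // [u v|u]; last exact: ua_nsq.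
  by rewrite (ua_rdot ua) invgK.
(* For j beyond the support of b, the row e_j - b has j-th coordinate 1. *)
have near1 b : high m b -> finsupp b ->
    exists N, forall j, (N <= j)%N -> rdot (x j) (act (trv phi b) xi) = c.
  move=> bm bf; have [N bN] := bf; exists N => j Nj; rewrite dotE //.
  apply: (fc _ (m + j)%N); rewrite ?leq_addr //; [exact: highB|exact: finsuppB|].
  by rewrite fun1D fun1N deltaE eqxx bN ?subr0 // (leq_trans Nj) // leq_addl.
exists eta; split.
- move=> g gm; apply: fixed; exists 0%N => l _.
  rewrite /x -(uaM ua) fJ ?leq_addr //; apply: near1.
    by apply: high_rowmul; [exact: KgV|exact: hd].
  exact: rowmul_finsupp (gl_fin _).
- move=> i mi; apply: fixed; exists 0%N => l _; rewrite /x -(uaM ua) -(trvDr (okd _ mi) (okm l)).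
  by apply: near1; [apply: highD => //; exact: high_delta|exact: finsuppD].
- move=> psi psim xipsi i mi; apply: fixed; exists 0%N => l _; exists l.+1 => j lj.
  have okp : trv_ok psi (delta A i) by apply: trv_ok_lowhigh psim _ _ => //; exact: high_delta.
  suff -> : act (trv psi (delta A i)) (x l) = x l by rewrite x_dot // gtn_eqF.
  rewrite /x -(uaM ua).
  have -> : (trv psi (delta A i) * trv phi (delta A (m + l)) =
      trv phi (delta A (m + l)) * trv psi (delta A i))%g.
    apply: gl_eqP => i' j'; rewrite (trv_mull _ _ _ okp) (trv_mull _ _ _ (okm l)).
    rewrite (rowmul_trv _ okp) (rowmul_trv _ (okm l)) /=.
    rewrite [dotp (delta A i) _]dotpC [dotp (delta A (m + l)) _]dotpC !dotp_delta (pm i mi) (psim _ (leq_addr l m)).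
    by rewrite !mul0r !addr0 (trv_val _ _ okp) (trv_val _ _ (okm l)) addrAC.
  by rewrite (uaM ua) xipsi.
- move=> a am xia i mi; apply: fixed; exists i.+1 => l il; exists l.+1 => j lj.
  have oka : trv_ok (delta A i) a by apply: trv_ok_highlow am _ => //; exact: high_delta.
  suff -> : act (trv (delta A i) a) (x l) = x l by rewrite x_dot // gtn_eqF.
  have li : (m + l == i)%N = false by rewrite gtn_eqF // (leq_trans il) // leq_addl.
  rewrite /x -(uaM ua).
  (* The two transvections commute up to this factor: (1 + e_i a)(1 + phi e_(m+l)) = (1 + phi
     e_(m+l)) k (1 + e_i a). It lies in [Kg m], and l > i ensures that i and m + l differ. *)
  pose k := trv (fun i' => dotp a phi * delta A i i') (delta A (m + l)).
  have okk : trv_ok (fun i' => dotp a phi * delta A i i') (delta A (m + l)).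
    by apply: trv_ok_delta; [exact: finsuppZ|rewrite deltaE eq_sym li mulr0].
  have km : Kg m k.
    apply: (trv_Kg okk) => // j' jm; by rewrite (high_delta _ mi jm) mulr0.
  have -> : (trv (delta A i) a * trv phi (delta A (m + l)) =
      trv phi (delta A (m + l)) * (k * trv (delta A i) a))%g.
    rewrite mulgA -(trvDl (okm l) okk) -[LHS](mulgVK (trv (delta A i) a)) (trvJ _ (okm l)).
    congr (trv _ _ * _)%g.
      rewrite colmul_trv //; last exact: low_finsupp pm.
      by apply/funext => i'; rewrite fun1D mulrC.
    rewrite -trvN // rowmul_trv; last exact: trv_okN.
    by apply/funext => i'; rewrite dotp_delta [delta A (m + l) i]deltaE li mul0r addr0.
  by rewrite !(uaM ua) xia // xiK.
- have key z : Kfixed act m z -> utype act m phi z -> rdot eta z = rdot xi z.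
    move=> zK zphi; apply: etaP; exists 0%N => j _.
    by rewrite /x (ua_rdot ua) (ua_fixV ua) // zphi // leq_addr.
  move=> z zK zphi; rewrite !hdot_rdot !key // => [g gm|j mj].
    by rewrite (uaZ ua) zK.
  by rewrite (uaZ ua) zphi.
Qed.

(* This automorphism exchanges the roles of rows and columns. *)
Definition contragredient (g : GL A) : GL A := gl_tr g^-1%g.

Lemma contragredientM g h : contragredient (g * h)%g = (contragredient g * contragredient h)%g.
Proof. by rewrite /contragredient invgM; apply: gl_inj; rewrite /= imtr_mul. Qed.

Lemma contragredient1 : contragredient 1%g = 1%g.
Proof. by rewrite /contragredient invg1; apply: gl_inj; exact: imtr1. Qed.

Lemma contragredient_trv phi a : trv_ok phi a ->
  contragredient (trv phi a) = (trv a phi)^-1%g.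
Proof.
move=> ok; have ok' : trv_ok a phi by case: ok => ? ? ?; split=> //; rewrite dotpC.
rewrite /contragredient -!trvN //; apply: gl_eqP => i j /=.
rewrite /imtr !trv_val; [|exact: trv_okN|exact: trv_okN].
by rewrite !fun1N !mulrN eq_sym mulrC.
Qed.

Lemma Kg_contragredient m g : Kg m g -> Kg m (contragredient g).
Proof.
move=> /KgV gm i j ij; rewrite /= /imtr -[gl_inv g j i]/(g^-1%g j i) gm 1?orbC //.
by rewrite /= /im1 eq_sym.
Qed.

Lemma contragredientK : involutive contragredient.
Proof. by move=> g; apply: gl_inj. Qed.

Lemma unitary_contragredient act : unitary_action act ->
  unitary_action (fun g => act (contragredient g)).
Proof.
move=> [a1 a2 a3 a4]; split=> [g|v|g h v|g u v]; first exact: a1.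
- by rewrite contragredient1.
- by rewrite contragredientM.
- exact: a4.
Qed.

Lemma Kfixed_contragredient act m v :
  Kfixed (fun g => act (contragredient g)) m v <-> Kfixed act m v.
Proof.
split=> vK g gm; last exact/vK/Kg_contragredient.
by rewrite -[g]contragredientK; exact/vK/Kg_contragredient.
Qed.

Lemma utype_contragredient act m phi v : unitary_action act -> low m phi ->
  utype (fun g => act (contragredient g)) m phi v <-> ltype act m phi v.
Proof.
move=> ua pm; have ok j : (m <= j)%N -> trv_ok phi (delta A j).
  by move=> mj; apply: (trv_ok_lowhigh pm); [exact: high_delta|exact: delta_finsupp].
split=> h j mj; last by rewrite (contragredient_trv (ok _ mj)); apply: (ua_fixV ua); exact: h.
by rewrite -[trv _ _]invgK -(contragredient_trv (ok _ mj)); apply: (ua_fixV ua); exact: h.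
Qed.

Lemma ltype_contragredient act m phi v : unitary_action act -> low m phi ->
  ltype (fun g => act (contragredient g)) m phi v <-> utype act m phi v.
Proof.
move=> ua pm; have ok j : (m <= j)%N -> trv_ok (delta A j) phi.
  by move=> mj; apply: (trv_ok_highlow _ pm); [exact: high_delta|exact: delta_finsupp].
split=> h j mj; last by rewrite (contragredient_trv (ok _ mj)); apply: (ua_fixV ua); exact: h.
by rewrite -[trv _ _]invgK -(contragredient_trv (ok _ mj)); apply: (ua_fixV ua); exact: h.
Qed.

Lemma average_ltype act m phi xi : unitary_action act -> low m phi -> Kfixed act m xi ->
  exists eta, [/\ Kfixed act m eta, ltype act m phi eta,
    forall psi, low m psi -> utype act m psi xi -> utype act m psi eta,
    forall a, low m a -> ltype act m a xi -> ltype act m a eta &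
    forall z, Kfixed act m z -> ltype act m phi z -> hdot H eta z = hdot H xi z].
Proof.
move=> ua pm xiK; have ua' := unitary_contragredient ua.
have [|eta [e1 e2 e3 e4 e5]] := average_utype ua' pm (xi := xi).
  exact/Kfixed_contragredient.
exists eta; split.
- exact/Kfixed_contragredient.
- exact/utype_contragredient.
- by move=> psi psim /(ltype_contragredient _ ua psim)/e4 h; apply/(ltype_contragredient _ ua psim)/h.
- by move=> psi psim /(utype_contragredient _ ua psim)/e3 h; apply/(utype_contragredient _ ua psim)/h.
- by move=> z zK zt; apply: e5; [exact/Kfixed_contragredient|exact/utype_contragredient].
Qed.

(** The types are imposed one at a time; the preservation clauses of each averaging keep those
    already obtained. *)
Lemma average_types act m (s t : seq (nat -> A)) xi : unitary_action act ->
  (forall phi, phi \in s -> low m phi) -> (forall a, a \in t -> low m a) ->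
  Kfixed act m xi ->
  exists eta, [/\ Kfixed act m eta,
    (forall phi, phi \in s -> utype act m phi eta) /\ (forall a, a \in t -> ltype act m a eta),
    forall psi, low m psi -> utype act m psi xi -> utype act m psi eta,
    forall a, low m a -> ltype act m a xi -> ltype act m a eta &
    forall z, Kfixed act m z -> (forall phi, phi \in s -> utype act m phi z) ->
      (forall a, a \in t -> ltype act m a z) -> hdot H eta z = hdot H xi z].
Proof.
move=> ua; elim: s => [|phi s IH]; first elim: t => [|a t IH] _.
- by move=> _ xiK; exists xi; split.
- move=> tm xiK; have am : low m a by apply: tm; rewrite mem_head.
  have tm' b : b \in t -> low m b by move=> bt; apply: tm; rewrite in_cons bt orbT.
  have [//|eta [e1 [_ e2] e3 e4 e5]] := IH _ tm' xiK.
  have [eta' [f1 f2 f3 f4 f5]] := average_ltype ua am e1.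
  exists eta'; split=> //.
  + split=> // b; rewrite in_cons => /orP[/eqP -> //|bt].
    by apply: f4; [apply: tm; rewrite in_cons bt orbT|exact: e2].
  + by move=> psi psim /(e3 _ psim); exact: f3.
  + by move=> b bm /(e4 _ bm); exact: f4.
  + move=> z zK zs zt; rewrite f5 //; last by apply: zt; rewrite mem_head.
    by apply: e5 => // b bt; apply: zt; rewrite in_cons bt orbT.
- move=> sm tm xiK; have pm : low m phi by apply: sm; rewrite mem_head.
  have sm' b : b \in s -> low m b by move=> bs; apply: sm; rewrite in_cons bs orbT.
  have [eta [e1 [e2 e2'] e3 e4 e5]] := IH sm' tm xiK.
  have [eta' [f1 f2 f3 f4 f5]] := average_utype ua pm e1.
  exists eta'; split=> //.
  + split=> b; last by move=> bt; apply: f4; [exact: tm|exact: e2'].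
    rewrite in_cons => /orP[/eqP -> //|bt].
    by apply: f3; [apply: sm; rewrite in_cons bt orbT|exact: e2].
  + by move=> psi psim /(e3 _ psim); exact: f3.
  + by move=> b bm /(e4 _ bm); exact: f4.
  + move=> z zK zs zt; rewrite f5 //; last by apply: zs; rewrite mem_head.
    by apply: e5 => // b bt; apply: zs; rewrite in_cons bt orbT.
Qed.

End Averaging.

(** * The spaces W(L, M) *)

Section FixedVectors.
Variables (K : realType) (A : comNzRingType) (H : hilbert K).
Variables (act : GL A -> H -> H) (ua : unitary_action act).
Implicit Types (L M : set (nat -> A)) (a phi psi : nat -> A) (v w : H) (g : GL A).

Definition tfixed L M v :=
  forall phi a, ann L phi -> ann M a -> dotp a phi = 0 -> act (trv phi a) v = v.

Lemma lowset_finsupp m L b : lowset m L -> L b -> finsupp b.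
Proof. by move=> Lm /Lm/low_finsupp. Qed.

(** [tensor_factor] writes a general transvection through far ones and an element of [Kg m].
    Truncating at m splits each far one again into a transvection of the given types and an element
    of [Kg m]. *)
Lemma tfixed_types L M m v : lowset m L -> lowset m M -> Kfixed act m v ->
  (forall phi, low m phi -> ann L phi -> utype act m phi v) ->
  (forall a, low m a -> ann M a -> ltype act m a v) -> tfixed L M v.
Proof.
move=> Lm Mm vK vu vl phi a phiL aM aphi.
have ok : trv_ok phi a by split=> //; [exact: phiL.1|exact: aM.1].
have [|||||e [k [e' [eP e'P km ->]]]] := @tensor_factor A L M m (trv phi a) [set g | act g v = v] Lm Mm.
- split=> [w Lw|w Mw].
    by rewrite rowmul_trv //; apply/funext => i; rewrite phiL.2 // mul0r addr0.
  rewrite colmul_trv //; last exact: lowset_finsupp Mm Mw.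
  by apply/funext => i; rewrite dotpC aM.2 // mulr0 addr0.
- exists [:: (phi, trunc m a)]; split.
    move=> p [<-|//]; split=> //; split; [exact: ann_trunc|exact: low_trunc].
  by move=> i j jm; rewrite trv_val // big_seq1 /= /trunc jm.
- exact: ua1.
- by move=> x y /= xv yv; rewrite (uaM ua) yv.
- move=> _ [[psi [j [mj psiL psij ->]]]|[b [j [mj bM bj ->]]]] /=.
    have ok1 : trv_ok (trunc m psi) (delta A j).
      apply: (trv_ok_lowhigh (low_trunc _)); [exact: high_delta|exact: delta_finsupp].
    have ok2 : trv_ok (psi - trunc m psi) (delta A j).
      apply: trv_ok_delta; last by rewrite fun1D fun1N psij /trunc ltnNge mj subrr.
      by apply: finsuppB; [exact: psiL.1|exact: low_finsupp (low_trunc _)].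
    rewrite -[psi](subrK (trunc m psi)) addrC trvDl // (uaM ua).
    rewrite [act (trv (psi - _) _) v]vK; last first.
      by apply: trv_Kg => //; [exact: high_trunc|exact: high_delta].
    by apply: vu => //; [exact: low_trunc|exact: ann_trunc].
  have ok1 : trv_ok (delta A j) (trunc m b).
    apply: (trv_ok_highlow _ (low_trunc _)); [exact: high_delta|exact: delta_finsupp].
  have ok2 : trv_ok (delta A j) (b - trunc m b).
    apply: trv_delta_ok; last by rewrite fun1D fun1N bj /trunc ltnNge mj subrr.
    by apply: finsuppB; [exact: bM.1|exact: low_finsupp (low_trunc _)].
  rewrite -[b](subrK (trunc m b)) addrC trvDr // (uaM ua).
  rewrite [act (trv _ (b - _)) v]vK; last first.
    by apply: trv_Kg => //; [exact: high_delta|exact: high_trunc].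
  by apply: vl => //; [exact: low_trunc|exact: ann_trunc].
by rewrite !(uaM ua) e'P vK.
Qed.

Lemma tfixed_utype L M m phi v : tfixed L M v -> lowset m M -> low m phi -> ann L phi ->
  utype act m phi v.
Proof.
move=> vt Mm pm phiL j mj; apply: vt => //.
  by apply: (ann_high Mm); [exact: delta_finsupp|exact: high_delta].
by rewrite dotpC dotp_delta pm.
Qed.

Lemma tfixed_ltype L M m a v : tfixed L M v -> lowset m L -> low m a -> ann M a ->
  ltype act m a v.
Proof.
move=> vt Lm am aM j mj; apply: vt => //; last by rewrite dotp_delta am.
by apply: (ann_high Lm); [exact: delta_finsupp|exact: high_delta].
Qed.

End FixedVectors.

Section TensorCols.
Variable A : comNzRingType.
Implicit Types (L M : set (nat -> A)) (g : GL A).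

(** Passing from n to n + 1 adds the term with column g e_n - e_n and row e_n; the column
    annihilates [L] because g fixes [L] pointwise. *)
Lemma tensor_colsS L M m n g : fixes_pt L M g -> lowset m M -> (m <= n)%N ->
  tensor_cols L M m g -> tensor_cols L M n g.
Proof.
move=> [gL gM] Mm; elim: n => [|n IH]; first by rewrite leqn0 => /eqP ->.
rewrite leq_eqVlt => /orP[/eqP <- //|mn] /(IH mn)[s [sP gs]].
exists ((g^~ n - delta A n, delta A n) :: s); split=> [p [<-|/sP[? [? pn]]]|i j].
- split; last split.
  + split=> [|v Lv]; first exact: finsuppB ((gl_fin g).2 n) (delta_finsupp _ _).
    rewrite dotpDr ?dotp_delta; [|exact: (gl_fin g).2|exact: finsuppN (delta_finsupp _ _)].
    rewrite -[X in X + _]/(rowmul v g n) gL //.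
    have -> : - delta A n = fun i => -1 * delta A n i by apply/funext => i; rewrite mulN1r.
    by rewrite dotpZr ?dotp_delta ?mulN1r ?subrr //; exact: delta_finsupp.
  + by apply: (ann_high Mm); [exact: delta_finsupp|exact: high_delta].
  + exact: low_delta.
- by split=> //; split=> // i ni; apply: pn; exact: ltnW.
rewrite ltnS leq_eqVlt big_cons /= => /orP[/eqP ->|jn]; last first.
  by rewrite gs // [delta A n j]deltaE (gtn_eqF jn) mulr0 add0r.
rewrite [delta A n n]deltaE eqxx mulr1 fun1D fun1N deltaE [n == i]eq_sym addrA addrCA subrr addr0.
rewrite (_ : \sum_(p <- s) p.1 i * p.2 n = 0) ?addr0 //.
elim: s sP {gs} => [|p s IHs] sP; first by rewrite big_nil.
rewrite big_cons IHs ?addr0 => [|q qs]; last by apply: sP; right.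
by have [_ [_ pn]] := sP p (or_introl erefl); rewrite pn // mulr0.
Qed.

Lemma Kg_tensor L M m g : lowset m L -> lowset m M -> Kg m g ->
  fixes_pt L M g /\ tensor_cols L M m g.
Proof.
move=> Lm Mm gm; split.
  by split=> v vin; [apply: (rowmul_Kg gm); exact: Lm|apply: (colmul_Kg gm); exact: Mm].
exists [::]; split=> // i j jm; rewrite big_nil addr0.
by have [_ gc] := (KgP m g).1 gm; rewrite -[LHS]/((g^~ j) i) gc // deltaE eq_sym.
Qed.

(** The first m columns of g - 1 are the block column of -b u and w, times c. The columns of b
    annihilate [L] and the rows of c annihilate [M]. *)
Lemma bullet_tensor L M g : g \in Gbullet L M ->
  exists m, [/\ lowset m L, lowset m M, fixes_pt L M g & tensor_cols L M m g].
Proof.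
move/asboolP => [m [N [b [c [<- <- [u [v [w [z [g1 g2 g3 g4]]]]]]]]]].
exists m.
have Lm : lowset m (rowker b) by move=> x [xm _].
have Mm : lowset m (rowker c^T) by move=> x [xm _].
have split_idx j : (m <= j)%N -> exists j', j = (m + j')%N.
  by move=> mj; exists (j - m)%N; rewrite subnKC.
have KX X : rowker b X -> (\row_i X i) *m b = 0 by case.
have KY Y : rowker c^T Y -> c *m (\row_i Y i)^T = 0.
  by move=> [_ Yc]; rewrite -[c]trmxK -trmx_mul Yc trmx0.
have [n0 n0P] := finsupp_unif m (gl_fin g).2.
split=> //.
  split=> [x xL|y yM].
    have xm := Lm _ xL; apply/funext => j; rewrite /rowmul -/(dotp _ _) dotpC (dotp_ord _ xm).
    have [jm|/split_idx[j' ->]] := ltnP j m.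
      transitivity (((\row_i x i) *m (1%:M - b *m u *m c)) 0 (Ordinal jm)).
        rewrite [RHS]mxE; apply: eq_bigr => i _.
        by rewrite -[j]/(val (Ordinal jm)) g1 [X in _ = X * _]mxE mulrC.
      by rewrite mulmxBr mulmx1 !mulmxA KX // !mul0mx subr0 mxE.
    transitivity (((\row_i x i) *m (b *m v j')) 0 0).
      by rewrite [RHS]mxE; apply: eq_bigr => i _; rewrite g2 [X in _ = X * _]mxE mulrC.
    by rewrite mulmxA KX // mul0mx mxE xm // leq_addr.
  have ym := Mm _ yM; apply/funext => i; rewrite /colmul (dotp_ord _ ym).
  have [im|/split_idx[i' ->]] := ltnP i m.
    transitivity (((1%:M - b *m u *m c) *m (\row_i y i)^T) (Ordinal im) 0).
      rewrite [RHS]mxE; apply: eq_bigr => j _.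
      by rewrite -[X in g X _]/(val (Ordinal im)) g1 [X in _ = _ * X]mxE [X in _ = _ * X]mxE.
    by rewrite mulmxBl mul1mx -!mulmxA KY // !mulmx0 subr0 !mxE.
  transitivity ((w i' *m c *m (\row_i y i)^T) 0 0).
    by rewrite [RHS]mxE; apply: eq_bigr => j _; rewrite g3 [X in _ = _ * X]mxE [X in _ = _ * X]mxE.
  by rewrite -mulmxA KY // mulmx0 mxE ym // leq_addr.
(* The rows of w are cut at [n0], below which the first m columns of g vanish; nothing else ensures
   finite support for w. *)
pose phi k i := if insub i is Some i' then (- (b *m u)) i' k else
  if (i < n0)%N then w (i - m)%N 0 k else 0.
pose a (k : 'I_N) j := if insub j is Some j' then c k j' else 0.
have phi_lt k (i : 'I_m) : phi k i = (- (b *m u)) i k.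
  rewrite /phi; case: insubP => [i' _ ii|]; last by rewrite ltn_ord.
  by congr (_ _ _); apply: val_inj.
have a_lt k (j : 'I_m) : a k j = c k j.
  rewrite /a; case: insubP => [j' _ jj|]; last by rewrite ltn_ord.
  by congr (_ _ _); apply: val_inj.
have am k : low m (a k) by move=> j mj; rewrite /a; case: insubP => // j'; rewrite ltnNge mj.
exists [seq (phi k, a k) | k <- enum 'I_N]; split.
  move=> _ /List.in_map_iff[k [<- _]] /=; split; last split => //.
    split=> [|x xL].
      exists (maxn m n0) => i; rewrite geq_max => /andP[mi ni]; rewrite /phi.
      by case: insubP => [i'|_]; rewrite ?(ltnNge i) ?mi ?ni.
    have xm := Lm _ xL; rewrite dotpC (dotp_ord _ xm).
    transitivity (((\row_i x i) *m (- (b *m u))) 0 k).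
      by rewrite [RHS]mxE; apply: eq_bigr => i _; rewrite phi_lt [X in _ = X * _]mxE mulrC.
    by rewrite mulmxN mulmxA KX // mul0mx oppr0 mxE.
  split=> [|y yM]; first exact: low_finsupp (am k).
  rewrite (dotp_ord _ (am k)).
  transitivity ((c *m (\row_i y i)^T) k 0); last by rewrite KY // mxE.
  by rewrite [RHS]mxE; apply: eq_bigr => j _; rewrite a_lt [X in _ = _ * X]mxE [X in _ = _ * X]mxE mulrC.
move=> i j jm; rewrite big_map big_enum /=.
rewrite -[j]/(val (Ordinal jm)); have [im|mi] := ltnP i m.
  have -> : i = val (Ordinal im) by [].
  rewrite g1 mxE mxE; congr (_ + _).
  by rewrite -mulNmx mxE; apply: eq_bigr => k _; rewrite phi_lt a_lt.
rewrite gtn_eqF ?add0r //=; last exact: leq_trans jm mi.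
have [ni|ni] := ltnP i n0; last first.
  rewrite n0P // big1 // => k _; rewrite /phi; case: insubP => [i'|_]; first by rewrite ltnNge mi.
  by rewrite ltnNge ni mul0r.
have [i' iE] := split_idx _ mi.
rewrite {1}iE -[j]/(val (Ordinal jm)) g3 mxE; apply: eq_bigr => k _.
rewrite -[j]/(val (Ordinal jm)) a_lt; congr (_ * _); rewrite /phi.
case: insubP => [i''|_]; first by rewrite ltnNge mi.
by rewrite ni iE addKn.
Qed.

End TensorCols.

Section FixedByBullet.
Variables (K : realType) (A : comNzRingType) (pi : urep K (predT : {pred GL A})).
Implicit Types (L M : set (nat -> A)) (v : pi) (g : GL A).

(** The factorization is available for arbitrarily large n. Its far transvections fix v, and its
    factor in [Kg n] moves v as little as desired by strong continuity. *)
Lemma tfixed_tensor L M m g v : tfixed (ur_act pi) L M v -> lowset m L -> lowset m M ->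
  fixes_pt L M g -> tensor_cols L M m g -> ur_act pi g v = v.
Proof.
move=> vt Lm Mm gLM gm; have ua := urep_unitary pi.
apply/eqP; rewrite -subr_eq0; apply/eqP/rnorm_eps => e e0.
have [n nP] := urep_smooth v e0; pose n' := maxn m n.
have mn' : (m <= n')%N by rewrite leq_maxl.
have Ln' : lowset n' L by move=> x Lx i ni; apply: (Lm x Lx); exact: leq_trans ni.
have Mn' : lowset n' M by move=> x Mx i ni; apply: (Mm x Mx); exact: leq_trans ni.
have gn' := tensor_colsS gLM Mm mn' gm.
have [|||f [k [f' [fP f'P kn ->]]]] :=
    @tensor_factor A L M n' g [set g | ur_act pi g v = v] Ln' Mn' gLM gn'.
- exact: ur_act1.
- by move=> x y /= xv yv; rewrite (uaM ua) yv.
- have hd j : (n' <= j)%N -> forall S, lowset n' S -> ann S (delta A j).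
    by move=> nj S Sn; apply: (ann_high Sn); [exact: delta_finsupp|exact: high_delta].
  move=> _ [[phi [j [nj pL pj ->]]]|[a [j [nj aM aj ->]]]] /=; apply: vt => //.
  + exact: hd.
  + by rewrite dotpC dotp_delta.
  + exact: hd.
  + by rewrite dotp_delta.
rewrite !(uaM ua) f'P -{2}fP -(uaB ua) (ua_rnorm ua); apply: nP.
by apply: Kg_le kn; rewrite leq_maxr.
Qed.

Lemma tfixed_bullet L M g v : tfixed (ur_act pi) L M v -> g \in Gbullet L M ->
  ur_act pi g v = v.
Proof. by move=> vt /bullet_tensor[m [Lm Mm gp gt]]; exact: tfixed_tensor gp gt. Qed.

Lemma tfixed_Kfixed L M m v : tfixed (ur_act pi) L M v -> lowset m L -> lowset m M ->
  Kfixed (ur_act pi) m v.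
Proof. by move=> vt Lm Mm g /(Kg_tensor Lm Mm)[gp gt]; exact: tfixed_tensor gp gt. Qed.

End FixedByBullet.

(** * Compatibility of the projections for different pairs *)

Section Orthogonality.
Variables (K : realType) (n : nat) (n_gt1 : (1 < n)%N).
Local Notation R := 'Z_n.
Variables (H : hilbert K) (act : GL R -> H -> H) (ua : unitary_action act).
Implicit Types (L M : set (nat -> R)).

Lemma low_ann_seq m L : exists s : seq (nat -> R), forall phi, phi \in s <-> low m phi /\ ann L phi.
Proof.
have /finite_seqP[s sE] : finite_set [set phi | low m phi /\ ann L phi].
  apply: sub_finite_set (fg_finite (@fg_full n m)).
  by move=> x [].
by exists s => phi; have := congr1 (fun S : set _ => S phi) sE; rewrite /= => ->.
Qed.

(** v is the average of v1 over the types of (L2, M2). It retains the types of v1, so [ann_setI]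
    gives it those of the intersections; v2 has all the averaged types, hence pairs equally with v1
    and v. *)
Lemma tfixed_setI m L1 M1 L2 M2 v1 v2 :
  fg_submodule L1 -> fg_submodule M1 -> fg_submodule L2 -> fg_submodule M2 ->
  lowset m L1 -> lowset m M1 -> lowset m L2 -> lowset m M2 ->
  Kfixed act m v1 -> Kfixed act m v2 ->
  tfixed act L1 M1 v1 -> tfixed act L2 M2 v2 ->
  exists2 v, tfixed act (L1 `&` L2) (M1 `&` M2) v & hdot H v1 v2 = hdot H v v2.
Proof.
move=> fL1 fM1 fL2 fM2 L1m M1m L2m M2m v1K v2K v1t v2t.
have [s sP] := low_ann_seq m L2; have [t tP] := low_ann_seq m M2.
have [||v [vK [vs vt] vu vl vd]] := @average_types K R H act m s t v1 ua _ _ v1K.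
- by move=> phi /sP[].
- by move=> a /tP[].
exists v; last first.
  rewrite vd // => [phi /sP[pm pL]|a /tP[am aM]].
    exact: tfixed_utype v2t M2m pm pL.
  exact: tfixed_ltype v2t L2m am aM.
apply: (tfixed_types ua (m := m)) => //.
- by move=> x [/L1m].
- by move=> x [/M1m].
- move=> phi pm /(ann_setI n_gt1 fL1 fL2 L1m L2m pm)[p1 [p2 [-> p1m p2m p1L p2L]]] j mj.
  have okj q : low m q -> trv_ok q (delta R j).
    by move=> qm; apply: (trv_ok_lowhigh qm); [exact: high_delta|exact: delta_finsupp].
  rewrite trvDl ?(uaM ua); [|exact: okj|exact: okj].
  rewrite [act (trv p2 _) v]vs //; last by apply/sP.
  by apply: (vu _ p1m _ j mj); exact: tfixed_utype v1t M1m p1m p1L.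
- move=> a am /(ann_setI n_gt1 fM1 fM2 M1m M2m am)[p1 [p2 [-> p1m p2m p1L p2L]]] j mj.
  have okj q : low m q -> trv_ok (delta R j) q.
    by move=> qm; apply: (trv_ok_highlow _ qm); [exact: high_delta|exact: delta_finsupp].
  rewrite trvDr ?(uaM ua); [|exact: okj|exact: okj].
  rewrite [act (trv _ p2) v]vt //; last by apply/tP.
  by apply: (vl _ p1m _ j mj); exact: tfixed_ltype v1t L1m p1m p1L.
Qed.

End Orthogonality.

(** * Subspaces and induced representations *)

Section ClosedSubspace.
Variables (K : realType) (H : hilbert K).

Record closed_subspace := ClosedSubspace {
  cs_pred : {pred H};
  cs_submod : submod_closed cs_pred;
  cs_closed : forall u, adherent (fun v => v \in cs_pred) u -> u \in cs_pred }.

HB.instance Definition _ (S : closed_subspace) :=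
  GRing.isSubmodClosed.Build _ _ (cs_pred S) (cs_submod S).

Variable S : closed_subspace.

Record subspace_of := MkSubspace { ss_val : H; ss_valP : ss_val \in cs_pred S }.

HB.instance Definition _ := [isSub for ss_val].
HB.instance Definition _ := [Choice of subspace_of by <:].
HB.instance Definition _ := [SubChoice_isSubLmodule of subspace_of by <:].

Implicit Types u v : subspace_of.

Definition ss_dot u v : K[i] := hdot H (val u) (val v).

Lemma ss_dot_bilinear :
  bilinear_for *%R (Num.conj \; *%R) (ss_dot : subspace_of -> subspace_of -> K[i]).
Proof.
have E (k : K[i]) u v : val (k *: u + v) = k *: val u + val v by rewrite linearP.
split=> [v|u] k x y; rewrite /ss_dot E; first by rewrite linearDl linearZl_LR.
by rewrite linearDr linearZr_LR.
Qed.

HB.instance Definition _ := bilinear_isBilinear.Build _ subspace_of subspace_of _ _ _ ss_dot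
  ss_dot_bilinear.

Lemma ss_dot_herm u v : ss_dot u v = (-1) ^+ false * Num.conj (ss_dot v u).
Proof. exact: hermC. Qed.

HB.instance Definition _ :=
  isHermitianSesquilinear.Build _ subspace_of false Num.conj ss_dot ss_dot_herm.

Lemma ss_dot_gt0 u : u != 0 -> 0 < ss_dot u u.
Proof. by move=> u0; rewrite dnorm_gt0. Qed.

HB.instance Definition _ := isDotProduct.Build _ subspace_of ss_dot ss_dot_gt0.

Definition ss_norm u : K[i] := `|val u|.

Lemma ss_normD u v : ss_norm (u + v) <= ss_norm u + ss_norm v.
Proof. exact: ler_normD. Qed.

Lemma ss_normZ (k : K[i]) u : ss_norm (k *: u) = `|k| * ss_norm u.
Proof. exact: normrZ. Qed.

Lemma ss_norm0 u : ss_norm u = 0 -> u = 0.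
Proof. by move/eqP; rewrite normr_eq0 => /eqP u0; apply: val_inj. Qed.

HB.instance Definition _ :=
  Lmodule_isNormed.Build K[i] subspace_of ss_normD ss_normZ ss_norm0.

Lemma ss_normE u : `|u| = `|val u|. Proof. by []. Qed.

Lemma ss_complete (F : set_system subspace_of) : ProperFilter F -> cauchy F -> cvg F.
Proof.
move=> FF /cauchy_ballP cF.
have cl : cvg ((val : subspace_of -> H) @ F).
  apply/cauchy_cvgP/cauchy_ballP => e e0; near_simpl.
  by have := cF e e0; apply: filterS => -[f g]; rewrite -!ball_normE.
pose l := lim ((val : subspace_of -> H) @ F).
have lS : l \in cs_pred S.
  apply: cs_closed => e e0; have e0' : 0 < e%:C%C by have := e0; rewrite -ltcR.
  have /cvgrPdist_lt /(_ _ e0') /filter_ex[f fl] := cl.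
  by exists (val f); [exact: ss_valP|rewrite rnorm_lt].
apply/cvg_ex; exists (MkSubspace lS); apply/cvgrPdist_lt => e e0.
by have /cvgrPdist_lt /(_ _ e0) := cl; apply: filterS => f.
Qed.

HB.instance Definition _ := Uniform_isComplete.Build subspace_of ss_complete.

Lemma ss_hdotE u : ss_dot u u = `|u| ^+ 2.
Proof. exact: hdotE. Qed.

Definition subspace_hilbert : hilbert K := @Hilbert K subspace_of ss_dot ss_hdotE.

End ClosedSubspace.

(** * Restriction to an invariant closed subspace *)

Section Restriction.
Variables (K : realType) (A : comNzRingType) (pi : urep K (predT : {pred GL A})).
Variables (Q : {pred GL A}) (S : closed_subspace pi).
Hypothesis QS : {in Q, forall g, {in cs_pred S, forall v, ur_act pi g v \in cs_pred S}}.
Local Notation W := (subspace_hilbert S).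

(** The default 0 is taken when the image leaves [S], which can happen only for g outside [Q]. *)
Definition restrict_act (g : GL A) (v : W) : W := insubd (0 : subspace_of S) (ur_act pi g (val v)).

Lemma restrict_actE g v : g \in Q -> val (restrict_act g v) = ur_act pi g (val v).
Proof. by move=> gQ; rewrite val_insubd QS //; exact: ss_valP. Qed.

Lemma restrict_linear : {in Q, forall g, linear (restrict_act g)}.
Proof.
move=> g gQ k u v; apply: val_inj; rewrite /= restrict_actE // !linearP /=.
by rewrite !restrict_actE // (ua_lin (urep_unitary pi)).
Qed.

Lemma restrict_act1 v : restrict_act 1%g v = v.
Proof. by apply: val_inj; rewrite val_insubd ur_act1 ss_valP. Qed.

Lemma restrict_cont v : {within [set` Q], continuous (restrict_act^~ v)}.
Proof.
apply/subspace_continuousP => x xQ; apply/cvgrPdist_lt => e e0.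
have /subspace_continuousP /(_ x isT) c := @ur_cont _ _ _ pi (val v).
have /cvgrPdist_lt /(_ _ e0) [n Hn] := c; exists n => y xy yQ.
rewrite ss_normE linearB /= !restrict_actE //; exact: (Hn y xy).
Qed.

Lemma restrict_hdot : {in Q, forall g u v,
  hdot W (restrict_act g u) (restrict_act g v) = hdot W u v}.
Proof.
move=> g gQ u v; rewrite -[LHS]/(hdot pi (val (restrict_act g u)) (val (restrict_act g v))).
by rewrite !restrict_actE // (ua_hdot (urep_unitary pi)).
Qed.

Hypothesis QM : mulg_closed Q.

Lemma restrict_actM : {in Q &, forall g h v,
  restrict_act (g * h)%g v = restrict_act g (restrict_act h v)}.
Proof.
move=> g h gQ hQ v; apply: val_inj.
by rewrite /= !restrict_actE ?QM // (uaM (urep_unitary pi)).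
Qed.

Definition restrict_rep : urep K Q :=
  @URep K A Q W restrict_act restrict_linear restrict_act1 restrict_actM
    restrict_hdot restrict_cont.

End Restriction.

Section IntertwinedSpace.
Variables (K : realType) (A : comNzRingType) (pi : urep K (predT : {pred GL A})).
Variables (L M : set (nat -> A)).
Implicit Types v : pi.

Definition tfixed_pred : {pred pi} := [pred v | `[< tfixed (ur_act pi) L M v >]].

Lemma tfixed_predP v : reflect (tfixed (ur_act pi) L M v) (v \in tfixed_pred).
Proof. exact: asboolP. Qed.

Let ua := urep_unitary pi.

Lemma tfixed_submod : submod_closed tfixed_pred.
Proof.
split=> [|k u v /tfixed_predP ut /tfixed_predP vt]; apply/tfixed_predP => phi a pL aM aphi.
  exact: ua0.
by rewrite (ua_lin ua) ut // vt.
Qed.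

Lemma tfixed_closed u : adherent (fun v => v \in tfixed_pred) u -> u \in tfixed_pred.
Proof.
move=> au; apply/tfixed_predP => phi a pL aM aphi.
apply/eqP; rewrite -subr_eq0; apply/eqP/rnorm_eps => e e0.
have [v /tfixed_predP vt uv] := au (e / 2) (divr_gt0 e0 (ltr0Sn _ _)).
have := rnormD (ur_act pi (trv phi a) (u - v)) (v - u).
rewrite (ua_rnorm ua) -(rnormN (v - u)) opprB (uaB ua) vt // addrA subrK.
by move: uv; lra.
Qed.

Definition tfixed_space : closed_subspace pi := ClosedSubspace tfixed_submod tfixed_closed.

End IntertwinedSpace.

Lemma csum_reindex (K : realType) (X : choiceType) (s t : X -> X) (z : X -> K[i]) :
  cancel s t -> cancel t s -> csum (fun x => z (s x)) = csum z.
Proof.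
move=> st ts; have bij : set_bij [set: X] [set: X] s.
  by split=> // [x y _ _ /(can_inj st)//|x _]; exists (t x); rewrite ?ts.
by rewrite /csum /rsum; congr (Complex _ _); congr (fine _ - fine _);
  rewrite [RHS](reindex_esum _ _ _ _ bij).
Qed.

Lemma cocycle_mulg (G : groupType) (a b c d e : G) :
  (a * b * c^-1 * (c * d * e^-1))%g = (a * (b * d) * e^-1)%g.
Proof. by rewrite !mulgA mulgVK. Qed.

Section InducedTheory.
Variables (K : realType) (A : comNzRingType) (Q : groupClosed (GL A)) (nu : urep K (Q : {pred GL A})).
Implicit Types (x : rcosets Q) (g h : GL A) (f : l2 (rcosets Q) nu) (w : nu).

Lemma l2_eqP f f' : (forall x, f x = f' x) -> f = f'.
Proof. by move=> ff; apply: val_inj; apply/funext. Qed.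

Lemma IndE g f x : Ind nu g f x = ur_act nu (ind_cocycle g x) (f (rcoset_act x g)).
Proof. by []. Qed.

Lemma rcoset_actK x g : rcoset_act (rcoset_act x g) g^-1%g = x.
Proof. by rewrite rcoset_actM mulgV rcoset_act1. Qed.

Lemma rcoset_actVK x g : rcoset_act (rcoset_act x g^-1%g) g = x.
Proof. by rewrite rcoset_actM mulVg rcoset_act1. Qed.

Lemma Ind_unitary : unitary_action (Ind nu).
Proof.
split.
- move=> g k f f'; apply: l2_eqP => x.
  by rewrite IndE /= (ur_linear (ind_cocycleP g x)).
- move=> f; apply: l2_eqP => x; rewrite IndE rcoset_act1.
  by rewrite /ind_cocycle rcoset_act1 mulg1 mulgV ur_act1.
- move=> g h f; apply: l2_eqP => x; rewrite !IndE -ur_actM ?ind_cocycleP //.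
  rewrite rcoset_actM; congr (ur_act nu _ _).
  by rewrite /ind_cocycle rcoset_actM cocycle_mulg.
- move=> g f f'; rewrite -[LHS]/(l2_dot _ _) -[RHS]/(l2_dot _ _) /l2_dot.
  transitivity (csum (fun x => hdot nu (f (rcoset_act x g)) (f' (rcoset_act x g)))).
    by congr csum; apply/funext => x; rewrite !IndE ur_hdot // ind_cocycleP.
  apply: (csum_reindex (t := fun x => rcoset_act x g^-1%g)
    (fun x => hdot nu (f x) (f' x))) => x.
    exact: rcoset_actK.
  exact: rcoset_actVK.
Qed.

End InducedTheory.

Section PointMass.
Variables (K : realType) (X : choiceType) (H : hilbert K).
Implicit Types (x y : X) (w : H) (f : l2 X H).

Lemma rsummable_single x (c : K) : rsummable (fun y => if y == x then c else 0).
Proof.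
rewrite /rsummable /summable; apply: (@le_lt_trans _ _ `|c|%:E); last exact: ltry.
rewrite (eq_esum (b := fun y => if y \in [set x] then `|c|%:E else 0%E)).
  by rewrite -esum_mkcond esum_set1 // lee_fin.
move=> y _ /=; have -> : (y \in [set x]) = (y == x) by apply/idP/eqP; rewrite inE.
by case: ifP; rewrite ?normr0.
Qed.

Lemma rsum_single x (c : K) : rsum (fun y => if y == x then c else 0) = c.
Proof.
have pos (d : K) : 0 <= d -> (\esum_(y in [set: X]) (if y == x then d else 0)%:E)%E = d%:E.
  move=> d0; rewrite (eq_esum (b := fun y => if y \in [set x] then d%:E else 0%E)).
    by rewrite -esum_mkcond esum_set1 // lee_fin.
  move=> y _ /=; have -> : (y \in [set x]) = (y == x) by apply/idP/eqP; rewrite inE.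
  by case: ifP.
rewrite /rsum -[RHS]maxr_posneg; congr (_ - _).
  rewrite -[RHS]/(fine (Num.max c 0)%:E) -pos ?le_max ?lexx ?orbT //.
  by congr fine; apply: eq_esum => y _; case: ifP => // _; rewrite maxxx.
rewrite -[RHS]/(fine (Num.max (- c) 0)%:E) -pos ?le_max ?lexx ?orbT //.
by congr fine; apply: eq_esum => y _; case: ifP => // _; rewrite oppr0 maxxx.
Qed.

Lemma csum_single x (c : K[i]) : csum (fun y => if y == x then c else 0) = c.
Proof.
rewrite /csum; case: c => a b; congr (Complex _ _).
  rewrite -[RHS](rsum_single x); congr rsum; apply/funext => y; by case: ifP.
rewrite -[RHS](rsum_single x); congr rsum; apply/funext => y; by case: ifP.
Qed.

Definition point_fun x w : X -> H := fun y => if y == x then w else 0.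

Lemma point_fun_l2 x w : point_fun x w \in @l2_pred K X H.
Proof.
apply/l2P; have := rsummable_single x (nsq w); congr rsummable; apply/funext => y.
by rewrite /point_fun; case: ifP; rewrite ?nsq0.
Qed.

Definition point_mass x w : l2_hilbert X H := MkL2 (point_fun_l2 x w).

Lemma hdot_point_mass f x w : hdot (l2_hilbert X H) f (point_mass x w) = hdot H (f x) w.
Proof.
rewrite -[RHS](csum_single x); congr csum; apply/funext => y /=.
by rewrite /point_fun; case: eqP => [->//|_]; rewrite linear0r.
Qed.

(* Bessel's inequality *)
Lemma l2_finite_level f (x : nat -> X) (d : K) : injective x -> 0 < d ->
  ~ (forall j, nsq (f (x j)) = d).
Proof.
move=> xI d0 fd; pose F : l2_hilbert X H := f.
pose e j := point_mass (x j) (f (x j)).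
have dot_e j : rdot F (e j) = d by rewrite /rdot hdot_point_mass hdot_nsq fd.
have e_e i j : rdot (e i) (e j) = if i == j then d else 0.
  rewrite /rdot hdot_point_mass /= /point_fun (inj_eq xI) eq_sym.
  by case: eqP => [->|_]; rewrite ?hdot_nsq ?fd ?linear0l.
have key N : N%:R * d <= nsq F.
  have rS v : (forall j, rdot v (e j) = d) -> rdot v (\sum_(j < N) e j) = N%:R * d.
    move=> vd; rewrite rdotC rdot_suml (eq_bigr (fun=> d)) => [|j _]; last by rewrite rdotC vd.
    by rewrite sumr_const card_ord mulr_natl.
  have nS : nsq (\sum_(j < N) e j) = N%:R * d.
    rewrite -rdot_nsq rdot_suml (eq_bigr (fun=> d)) => [|i _].
      by rewrite sumr_const card_ord mulr_natl.
    rewrite rdotC rdot_suml (bigD1 i) //= e_e eqxx big1 ?addr0 // => j ji.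
    by rewrite e_e (inj_eq val_inj) (negPf ji).
  by have := nsq_ge0 (F - \sum_(j < N) e j); rewrite nsqB (rS _ dot_e) nS; lra.
have := key (Num.trunc (nsq F / d)).+1.
by rewrite -ler_pdivlMr // leNgt truncnS_gt.
Qed.

End PointMass.

Lemma linear_zero (R : pzRingType) (U V : lmodType R) (f : U -> V) : linear f -> f 0 = 0.
Proof. by move=> fl; have := fl (-1) 0 0; rewrite scaler0 addr0 scaleN1r addNr. Qed.

(** * The induced representation on equivariant functions *)

Section MackeyModel.
Variables (K : realType) (A : comNzRingType) (Q : groupClosed (GL A)) (nu : urep K (Q : {pred GL A})).
Implicit Types (g h q : GL A) (f : l2_hilbert (rcosets Q) nu) (w : nu).
Local Notation I := (l2_hilbert (rcosets Q) nu).

Lemma coset_pt_subproof h : `[< exists g, rcoset Q h = rcoset Q g >].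
Proof. by apply/asboolP; exists h. Qed.

Definition coset_pt h : rcosets Q :=
  exist (fun y => `[< exists g, y = rcoset Q g >]) (rcoset Q h) (coset_pt_subproof h).

Lemma coset_pt_act g h : rcoset_act (coset_pt g) h = coset_pt (g * h)%g.
Proof.
apply: val_inj; rewrite /= /rcoset image_comp; apply: eq_imagel => q _ /=.
by rewrite mulgA.
Qed.

Lemma coset_pt_rep (x : rcosets Q) : coset_pt (rcoset_rep x) = x.
Proof. by apply: val_inj; rewrite /= -rcoset_repP. Qed.

Lemma coset_ptP g h : coset_pt g = coset_pt h <-> (g * h^-1)%g \in (Q : {pred GL A}).
Proof.
split=> [/(congr1 val) /= gh|ghQ].
  have : rcoset Q g g by exists 1%g; [exact: gpred1|rewrite mul1g].
  by rewrite gh => -[q qQ <-]; rewrite mulgK.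
apply: val_inj; apply/seteqP; split=> _ [q /= qQ <-].
  by exists (q * (g * h^-1))%g; [exact: gpredM|rewrite -!mulgA mulVg mulg1].
exists (q * (g * h^-1)^-1)%g; first by apply: gpredM => //; rewrite gpredV.
by rewrite invgM invgK -!mulgA mulVg mulg1.
Qed.

Lemma coset_rep_mem h : (h * (rcoset_rep (coset_pt h))^-1)%g \in (Q : {pred GL A}).
Proof. by apply/coset_ptP; rewrite coset_pt_rep. Qed.

(* The induced representation realized by functions F on the group with
   F (q h) = nu q (F h): this is the value at h of the function given by f. *)
Definition val_at f h : nu := ur_act nu (h * (rcoset_rep (coset_pt h))^-1)%g (f (coset_pt h)).

Lemma val_at_Ind f g h : val_at (Ind nu g f) h = val_at f (h * g)%g.
Proof.
rewrite /val_at IndE -(ur_actM (coset_rep_mem h) (ind_cocycleP g _)) coset_pt_act.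
rewrite /ind_cocycle coset_pt_act.
by have := cocycle_mulg h 1 (rcoset_rep (coset_pt h)) g (rcoset_rep (coset_pt (h * g)%g)); rewrite mulg1 mul1g => ->.
Qed.

Lemma val_at_mul f q h : q \in (Q : {pred GL A}) -> val_at f (q * h)%g = ur_act nu q (val_at f h).
Proof.
move=> qQ; have -> : val_at f (q * h)%g = ur_act nu (q * h * (rcoset_rep (coset_pt h))^-1)%g (f (coset_pt h)).
  rewrite /val_at; have -> // : coset_pt (q * h)%g = coset_pt h.
  by apply/coset_ptP; rewrite mulgK.
by rewrite -mulgA ur_actM // coset_rep_mem.
Qed.

Lemma nsq_val_at f h : nsq (val_at f h) = nsq (f (coset_pt h)).
Proof. by apply: complexI; rewrite -!hdot_nsq ur_hdot // coset_rep_mem. Qed.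

Lemma val_at_linear h k f f' : val_at (k *: f + f') h = k *: val_at f h + val_at f' h.
Proof. by rewrite /val_at -(ur_linear (coset_rep_mem h)). Qed.

Lemma val_at0 h : val_at 0 h = 0.
Proof. exact: linear_zero (val_at_linear h). Qed.

Lemma val_at_inj f f' : (forall h, val_at f h = val_at f' h) -> f = f'.
Proof.
move=> ff; apply: l2_eqP => x; rewrite -(coset_pt_rep x).
set h := rcoset_rep x; pose s := (h * (rcoset_rep (coset_pt h))^-1)%g.
have sQ : s \in (Q : {pred GL A}) by exact: coset_rep_mem.
have sV : s^-1%g \in (Q : {pred GL A}) by rewrite gpredV.
have := congr1 (ur_act nu s^-1%g) (ff h).
by rewrite /val_at -/s -!ur_actM // mulVg !ur_act1.
Qed.

(** The chosen representative of the coset [Q] need not be 1; acting by it on w makes the value at 1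
    equal to w. *)
Definition emb w : I := point_mass (coset_pt 1%g) (ur_act nu (rcoset_rep (coset_pt 1%g)) w).

Lemma rep1_mem : rcoset_rep (coset_pt 1%g) \in (Q : {pred GL A}).
Proof. by have := coset_rep_mem 1%g; rewrite mul1g gpredV. Qed.

Lemma val_at_emb w g :
  val_at (emb w) g = if g \in (Q : {pred GL A}) then ur_act nu g w else 0.
Proof.
rewrite /val_at /= /point_fun.
have -> : (coset_pt g == coset_pt 1%g) = (g \in (Q : {pred GL A})).
  by apply/eqP/idP => [/coset_ptP|gQ]; [|apply/coset_ptP]; rewrite invg1 mulg1.
case: ifPn => gQ; last first.
  exact: linear_zero (ur_linear (coset_rep_mem g)).
have E : coset_pt g = coset_pt 1%g by apply/coset_ptP; rewrite invg1 mulg1.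
by rewrite E -ur_actM ?mulgVK // ?rep1_mem //; apply: gpredM => //; rewrite gpredV rep1_mem.
Qed.

Lemma hdot_emb f w : hdot I f (emb w) = hdot nu (val_at f 1%g) w.
Proof.
rewrite hdot_point_mass /val_at mul1g.
have rV : (rcoset_rep (coset_pt 1%g))^-1%g \in (Q : {pred GL A}) by rewrite gpredV rep1_mem.
rewrite -(ur_hdot rV) -ur_actM ?rep1_mem // mulVg.
by rewrite ur_act1.
Qed.

Lemma emb_linear : linear emb.
Proof.
move=> k w w'; apply: val_at_inj => h; rewrite val_at_linear !val_at_emb.
case: ifPn => hQ; first by rewrite (ur_linear hQ).
by rewrite scaler0 addr0.
Qed.

Lemma hdot_emb_emb w w' : hdot I (emb w) (emb w') = hdot nu w w'.
Proof. by rewrite hdot_emb val_at_emb gpred1 ur_act1. Qed.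

Lemma emb_cyclic : cyclic (Ind nu) emb.
Proof.
move=> f f0; apply: val_at_inj => h; apply: hdot_inj => w.
have := f0 h^-1%g w; rewrite hdotC (ua_hdotV (Ind_unitary nu)) invgK -hdotC hdot_emb val_at_Ind mul1g => ->.
rewrite val_at0.
by rewrite linear0l.
Qed.

Lemma Ind_emb q w : q \in (Q : {pred GL A}) -> Ind nu q (emb w) = emb (ur_act nu q w).
Proof.
move=> qQ; apply: val_at_inj => h; rewrite val_at_Ind !val_at_emb gpredMr //.
by case: ifPn => // hQ; rewrite ur_actM.
Qed.

Lemma supported_emb f h : (forall g, val_at f g != 0 -> (g * h^-1)%g \in (Q : {pred GL A})) ->
  f = Ind nu h^-1%g (emb (val_at f h)).
Proof.
move=> fh; apply: val_at_inj => g; rewrite val_at_Ind val_at_emb; case: ifPn => gQ.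
  by rewrite -val_at_mul // mulgVK.
by apply/eqP; apply: contraNT gQ; exact: fh.
Qed.

(** The coefficients of the vectors [emb w] are those of nu on [Q] and 0 elsewhere, and together
    with cyclicity they determine the representation. *)
Lemma Ind_equivalent (H : hilbert K) (act : GL A -> H -> H) (iota : nu -> H) :
  unitary_action act -> cyclic act iota ->
  (forall g w w', g \in (Q : {pred GL A}) ->
     hdot H (act g (iota w)) (iota w') = hdot nu (ur_act nu g w) w') ->
  (forall g w w', g \notin (Q : {pred GL A}) -> hdot H (act g (iota w)) (iota w') = 0) ->
  unitarily_equivalent predT act (Ind nu).
Proof.
move=> ua cy inQ outQ.
have [|T [Tl Tb Td Ta]] := cyclic_equivalent ua (Ind_unitary nu) (i1 := iota) (i2 := emb) _ cy emb_cyclic.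
  move=> g w w'; rewrite hdot_emb val_at_Ind mul1g val_at_emb.
  by case: ifPn => gQ; [exact: inQ|rewrite outQ // linear0l].
by exists T; split => // g _ v; exact: Ta.
Qed.

End MackeyModel.

(** * Classification *)

Section Cardinals.
Variable T : choiceType.
Implicit Types B C : set T.

Definition scard B : nat := #|` fset_set B|%fset.

Lemma scard_le B C : finite_set C -> B `<=` C -> (scard B <= scard C)%N.
Proof.
move=> Cf BC; have Bf := sub_finite_set BC Cf.
by apply: fsubset_leq_card; rewrite -fset_set_sub.
Qed.

Lemma scard_eq B C : finite_set C -> B `<=` C -> (scard C <= scard B)%N -> B = C.
Proof.
move=> Cf BC CB; have Bf := sub_finite_set BC Cf; apply: fset_set_inj => //.
have sub : (fset_set B `<=` fset_set C)%fset by rewrite -fset_set_sub.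
apply/eqP; rewrite -(geq_leqif (fsubset_leqif_cards sub)); exact: CB.
Qed.

Lemma scard_image (f : T -> T) B : finite_set B -> injective f -> scard [set f x | x in B] = scard B.
Proof. by move=> Bf fI; rewrite /scard fset_set_image // card_imfset. Qed.

End Cardinals.

Section Actions.
Variable A : comNzRingType.
Implicit Types (L M : set (nat -> A)) (g h : GL A) (v w a phi : nat -> A).

Lemma corowactE M g : corowact M g = [set colmul g^-1%g w | w in M].
Proof. by apply: eq_imagel => w _; rewrite [RHS]colmul_rowmul. Qed.

Lemma rowmul_inj g : injective (fun v => rowmul v g).
Proof. by move=> v w vw; rewrite -[v](rowmulK _ g) vw rowmulK. Qed.

Lemma rowmulD k v w g : rowmul (fun i => k * v i + w i) g = fun j => k * rowmul v g j + rowmul w g j.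
Proof.
apply/funext => j; have gj : finsupp (g^~ j) by exact: (gl_fin g).2.
rewrite /rowmul -!/(dotp _ _) -dotpZl // -dotpDl //.
Qed.

Lemma tfixed_conj (K : realType) (H : hilbert K) (act : GL A -> H -> H) L M g (x : H) :
  unitary_action act -> (forall w, M w -> finsupp w) ->
  tfixed act L M x -> tfixed act (rowact L g^-1%g) (corowact M g^-1%g) (act g x).
Proof.
move=> ua Mf vt phi a pL aM aphi.
have ok : trv_ok phi a by split=> //; [exact: pL.1|exact: aM.1].
have ok' := trv_ok_conj g^-1%g ok; rewrite invgK in ok'.
have -> : trv phi a = (g * trv (colmul g^-1%g phi) (rowmul a g) * g^-1)%g.
  by rewrite trvJ // colmulM ?mulgV ?colmul1g ?rowmulK //; case: ok.
rewrite !(uaM ua) (uaK ua); congr (act g _); case: ok' => o1 o2 o3.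
apply: vt => //; split=> // w win.
  rewrite -dotp_rowmul; [|exact: pL.1|exact: (gl_fin _).2].
  by apply: pL.2; exists w.
rewrite dotpC dotp_rowmul; [|exact: Mf|exact: (gl_fin _).2].
rewrite dotpC; apply: aM.2; rewrite corowactE invgK; by exists w.
Qed.

End Actions.

Section FiniteRingActions.
Variables (n : nat) (n_gt1 : (1 < n)%N).
Local Notation R := 'Z_n.
Implicit Types (L M : set (nat -> R)) (v w a phi : nat -> R) (g h : GL R).

Lemma fg_rowact L g : fg_submodule L -> fg_submodule (rowact L g).
Proof.
move=> /fg_submoduleP[[L0 L1] [m Lm]]; apply/fg_submoduleP; split.
  split.
    exists 0 => //; apply/funext => j; rewrite /rowmul -/(dotp _ _) dotpC.
    by rewrite (dotp_ord _ (n := 0)) ?big_ord0.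
  move=> k _ _ [v Lv <-] [w Lw <-]; exists (fun i => k * v i + w i); first exact: L1.
  exact: rowmulD.
have [N NP] := finsupp_unif m (gl_fin g).1.
exists N => _ [v Lv <-] j Nj; rewrite /rowmul -/(dotp _ _) dotpC (dotp_ord _ (Lm v Lv)).
by rewrite big1 // => i _; rewrite NP // mul0r.
Qed.

Lemma fg_corowact M g : fg_submodule M -> fg_submodule (corowact M g).
Proof. exact: fg_rowact. Qed.

Lemma scard_rowact L g : fg_submodule L -> scard (rowact L g) = scard L.
Proof. by move=> fL; apply: scard_image; [exact: fg_finite|exact: rowmul_inj]. Qed.

Lemma scard_corowact M g : fg_submodule M -> scard (corowact M g) = scard M.
Proof. exact: scard_rowact. Qed.

Lemma fg_lowset L : fg_submodule L -> exists m, lowset m L.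
Proof. by move=> /fg_submoduleP[]. Qed.

Lemma lowset_le m k L : (m <= k)%N -> lowset m L -> lowset k L.
Proof. by move=> mk Lm v Lv i ki; apply: (Lm v Lv); exact: leq_trans ki. Qed.

Lemma fg_lowset4 L1 L2 L3 L4 : fg_submodule L1 -> fg_submodule L2 -> fg_submodule L3 ->
  fg_submodule L4 -> exists m, [/\ lowset m L1, lowset m L2, lowset m L3 & lowset m L4].
Proof.
move=> /fg_lowset[m1 h1] /fg_lowset[m2 h2] /fg_lowset[m3 h3] /fg_lowset[m4 h4].
exists (maxn (maxn m1 m2) (maxn m3 m4)); split.
- by apply: lowset_le h1; rewrite !leq_max leqnn.
- by apply: lowset_le h2; rewrite !leq_max leqnn orbT.
- by apply: lowset_le h3; rewrite !leq_max leqnn !orbT.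
- by apply: lowset_le h4; rewrite !leq_max leqnn !orbT.
Qed.

(* The columns of b are all the columns of height m annihilated by L. *)
Lemma exists_rowker m L : submod L -> lowset m L ->
  exists b : 'M[R]_(m, #|{: 'rV[R]_m}|), rowker b = L /\
    forall phi, low m phi -> ann L phi -> exists k, forall i : 'I_m, b i k = phi i.
Proof.
move=> sL Lm; pose T : finType := 'rV[R]_m.
pose b : 'M[R]_(m, #|T|) := \matrix_(i, k)
  (if pselect (ann L (ofrow (enum_val k : 'rV_m))) then (enum_val k : 'rV_m) 0 i else 0).
have bE phi : low m phi -> ann L phi -> forall i : 'I_m,
    b i (enum_rank (\row_(i < m) phi i : T)) = phi i.
  move=> pm pL i; rewrite mxE enum_rankK ofrowK //.
  by case: pselect => //= _; rewrite mxE.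
exists b; split; last by move=> phi pm pL; exists (enum_rank (\row_(i < m) phi i : T)); exact: bE.
apply/seteqP; split=> [v [vm vb]|v Lv].
  apply: contrapT => vL; have [y [ym yL vy]] := double_annihilator n_gt1 sL Lm vm vL.
  apply: vy; rewrite (dotp_ord _ ym).
  have := congr1 (fun B : 'rV_#|T| => B 0 (enum_rank (\row_(i < m) y i : T))) vb.
  rewrite /= [X in X = _ -> _]mxE [X in _ = X -> _]mxE => E; rewrite -[RHS]E.
  by apply: eq_bigr => i _; rewrite bE // mxE.
have vm := Lm v Lv; split=> //; apply/rowP => k; rewrite mxE [RHS]mxE.
case: (pselect (ann L (ofrow (enum_val k : 'rV_m)))) => h.
  rewrite -[RHS](h.2 v Lv) dotpC (dotp_ord _ vm); apply: eq_bigr => i _.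
  rewrite mxE [X in _ * X]mxE; case: pselect => //= _.
  by rewrite ofrow_val mulrC.
rewrite big1 // => i _; rewrite [X in _ * X]mxE; case: pselect => //= _.
by rewrite mulr0.
Qed.

(** For m beyond all supports, phi is a column of the matrix b of [exists_rowker] and a is a row of
    c, so u can be minus a matrix unit, with v = w = 0. *)
Lemma trv_bullet L M phi a : fg_submodule L -> fg_submodule M -> ann L phi -> ann M a ->
  dotp a phi = 0 -> trv phi a \in Gbullet L M.
Proof.
move=> fL fM pL aM aphi.
have ok : trv_ok phi a by split=> //; [exact: pL.1|exact: aM.1].
have [mL Lm] := fg_lowset fL; have [mM Mm] := fg_lowset fM.
have [mp pm] := pL.1; have [ma am] := aM.1.
pose m := maxn (maxn mL mM) (maxn mp ma).
have {Lm} Lm : lowset m L by apply: lowset_le Lm; rewrite !leq_max leqnn.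
have {Mm} Mm : lowset m M by apply: lowset_le Mm; rewrite !leq_max leqnn orbT.
have {pm} pm : low m phi by move=> i mi; apply: pm; apply: leq_trans mi; rewrite !leq_max leqnn !orbT.
have {am} am : low m a by move=> i mi; apply: am; apply: leq_trans mi; rewrite !leq_max leqnn !orbT.
have [b [bL /(_ _ pm pL)[k bk]]] := exists_rowker ((fg_submoduleP L).1 fL).1 Lm.
have [c [cM /(_ _ am aM)[l cl]]] := exists_rowker ((fg_submoduleP M).1 fM).1 Mm.
apply/asboolP; exists m, #|{: 'rV[R]_m}|, b, c^T; split=> //; first by rewrite trmxK.
exists (- delta_mx k l), (fun=> 0), (fun=> 0), (fun i j => trv phi a (m + i)%N (m + j)%N).
split=> [i j|i j|i j|//]; rewrite trv_val //.
- rewrite mulmxN mulNmx opprK !mxE; congr (_ + _).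
  rewrite (bigD1 l) //= big1 ?addr0 => [|l' ll].
    rewrite mxE (bigD1 k) //= big1 ?addr0 => [|k' kk].
      by rewrite !mxE !eqxx mulr1 bk cl.
    by rewrite mxE (negPf kk) mulr0.
  rewrite mxE big1 ?mul0r // => k' _; by rewrite mxE (negPf ll) andbF mulr0.
- rewrite mulmx0 mxE am ?leq_addr // mulr0 addr0 ltn_eqF //.
  by rewrite (leq_trans (ltn_ord i)) // leq_addr.
- rewrite mul0mx mxE pm ?leq_addr // mul0r addr0 gtn_eqF //.
  by rewrite (leq_trans (ltn_ord j)) // leq_addr.
Qed.

End FiniteRingActions.

(** * Supports of invariant functions *)

Section Support.
Variables (K : realType) (n : nat) (n_gt1 : (1 < n)%N).
Local Notation R := 'Z_n.
Variables (L1 M1 L2 M2 : set (nat -> R)) (tau : urep K (Ghat L1 M1)).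
Hypotheses (fL1 : fg_submodule L1) (fM1 : fg_submodule M1).
Hypotheses (fL2 : fg_submodule L2) (fM2 : fg_submodule M2).

(* A square-summable invariant function vanishes at the points with an infinite
   orbit, and a vector outside L2 has infinitely many images under the
   transvections attached to L2 and M2. *)
Lemma tfixed_support (f : l2_hilbert (rcosets (Ghat L1 M1)) tau) h :
  tfixed (Ind tau) L2 M2 f -> val_at f h != 0 ->
  rowact L1 h `<=` L2 /\ corowact M1 h `<=` M2.
Proof.
move=> ft fh; have sL2 := ((fg_submoduleP L2).1 fL2).1; have sM2 := ((fg_submoduleP M2).1 fM2).1.
have [m [L1m M1m L2m M2m]] := fg_lowset4 (fg_rowact h fL1) (fg_corowact h fM1) fL2 fM2.
have d0 : 0 < nsq (val_at f h).
  rewrite lt_neqAle nsq_ge0 andbT eq_sym; apply: contra fh => /eqP/nsq_eq0 ->.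
  by [].
have hd j : high m (delta R (m + j)) by apply: high_delta; exact: leq_addr.
have level (t : nat -> GL R) : (forall j, Ind tau (t j) f = f) ->
    injective (fun j => coset_pt (Ghat L1 M1) (h * t j)%g) -> False.
  move=> tf tI; apply: (l2_finite_level tI d0 (f := f)) => j.
  by rewrite -nsq_val_at -val_at_Ind tf.
have stab t t' : coset_pt (Ghat L1 M1) (h * t)%g = coset_pt (Ghat L1 M1) (h * t')%g ->
    rowact (rowact L1 h) (t * t'^-1)%g = rowact L1 h /\
    corowact (corowact M1 h) (t * t'^-1)%g = corowact M1 h.
  move=> /coset_ptP/GhatP[e1 e2].
  have E : (h * t * (h * t')^-1 * h = h * (t * t'^-1))%g by rewrite invgM !mulgA mulgVK.
  by split; [rewrite -{2}e1|rewrite -{2}e2]; rewrite ?rowactM ?corowactM E.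
split=> v vin; apply: contrapT => vout.
  have vm := L1m v vin.
  (* phi annihilates [L2] but not v. If the cosets for i <> j coincided, L1 h would contain v + (v
     phi)(e_(m+i) - e_(m+j)), which does not vanish beyond m. *)
  have [phi [pm pL vp]] := double_annihilator n_gt1 sL2 L2m vm vout.
  have ok j : trv_ok phi (delta R (m + j)).
    by apply: (trv_ok_lowhigh pm); [exact: hd|exact: delta_finsupp].
  apply: (level (fun j => trv phi (delta R (m + j)))).
    move=> j; apply: ft => //; last by case: (ok j).
    by apply: (ann_high M2m); [exact: delta_finsupp|exact: hd].
  move=> i j /stab[E _]; apply/eqP; apply: contra_notT vp => ij.
  have : rowact L1 h (rowmul v (trv phi (delta R (m + i)) * (trv phi (delta R (m + j)))^-1)%g).
    by rewrite -E; exists v.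
  rewrite -trvN // -trvDr //; last exact: trv_okN.
  have okij : trv_ok phi (delta R (m + i) - delta R (m + j)).
    split; [exact: low_finsupp pm|apply: finsuppB; exact: delta_finsupp|].
    by apply: dotp_highlow pm; exact: highB.
  rewrite rowmul_trv // => /L1m/(_ (m + i)%N (leq_addr _ _)).
  rewrite vm ?leq_addr // add0r fun1D fun1N !deltaE eqxx eqn_add2l.
  by rewrite [j == i]eq_sym (negPf ij) subr0 mulr1.
have vm := M1m v vin.
(* The same argument with columns; [corowact] involves the inverse, which interchanges i and j. *)
have [phi [pm pM vp]] := double_annihilator n_gt1 sM2 M2m vm vout.
have ok j : trv_ok (delta R (m + j)) phi.
  by apply: (trv_ok_highlow _ pm); [exact: hd|exact: delta_finsupp].
apply: (level (fun j => trv (delta R (m + j)) phi)).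
  move=> j; apply: ft => //; last by case: (ok j).
  by apply: (ann_high L2m); [exact: delta_finsupp|exact: hd].
move=> i j /stab[_ E]; apply/eqP; apply: contra_notT vp => ij.
have : corowact M1 h (colmul (trv (delta R (m + j)) phi * (trv (delta R (m + i)) phi)^-1)%g v).
  by rewrite -E corowactE; exists v => //; rewrite invgM invgK.
rewrite -trvN //.
have okN : trv_ok (- delta R (m + i)) phi.
  split; [exact: finsuppN (delta_finsupp _ _)|exact: low_finsupp pm|].
  by apply: (dotp_lowhigh pm) => l lm; rewrite fun1N hd // oppr0.
have -> : trv (delta R (m + i)) (- phi) = trv (- delta R (m + i)) phi.
  apply: gl_eqP => k l; rewrite !trv_val //; last exact: trv_okN.
  by rewrite !fun1N mulrN mulNr.
rewrite -trvDl //.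
have okij : trv_ok (delta R (m + j) - delta R (m + i)) phi.
  split; [apply: finsuppB; exact: delta_finsupp|exact: low_finsupp pm|].
  by apply: (dotp_lowhigh pm); exact: highB.
rewrite colmul_trv //; last exact: low_finsupp vm.
move=> /M1m/(_ (m + j)%N (leq_addr _ _)).
rewrite vm ?leq_addr // add0r fun1D fun1N !deltaE eqxx eqn_add2l.
by rewrite (negPf ij) subr0 mul1r dotpC.
Qed.

End Support.

(** * Uniqueness of the inducing data *)

Section Uniqueness.
Variables (K : realType) (n : nat) (n_gt1 : (1 < n)%N).
Local Notation R := 'Z_n.
Implicit Types (L M : set (nat -> R)) (g h : GL R).

Lemma fixes_pt_Ghat L M g : fg_submodule M -> fixes_pt L M g -> g \in Ghat L M.
Proof.
move=> /fg_lowset[m Mm] gLM; have Mf w : M w -> finsupp w by exact: lowset_finsupp Mm.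
have [gL _] := gLM; have [_ gVM] := fixes_ptV Mf gLM.
apply/GhatP; rewrite corowactE; split; apply/seteqP; split=> [_ [v vin <-]|v vin].
- by rewrite gL.
- by exists v => //; exact: gL.
- by rewrite gVM.
- by exists v => //; exact: gVM.
Qed.

Lemma trv_fixes_pt L M phi a : fg_submodule M -> ann L phi -> ann M a -> dotp a phi = 0 ->
  fixes_pt L M (trv phi a).
Proof.
move=> /fg_lowset[m Mm] pL aM aphi.
have ok : trv_ok phi a by split=> //; [exact: pL.1|exact: aM.1].
split=> [v Lv|w Mw].
  by rewrite rowmul_trv //; apply/funext => i; rewrite pL.2 // mul0r addr0.
rewrite colmul_trv //; last exact: lowset_finsupp Mm Mw.
by apply/funext => i; rewrite dotpC aM.2 // mulr0 addr0.
Qed.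

(** These transvections lie in [Ghat L M], so they act on the embedded copy through tau, which is
    trivial on them by [trv_bullet]. *)
Lemma emb_tfixed L M (tau : urep K (Ghat L M)) w : fg_submodule L -> fg_submodule M ->
  {in Gbullet L M, forall g v, ur_act tau g v = v} -> tfixed (Ind tau) L M (emb w).
Proof.
move=> fL fM triv phi a pL aM aphi; rewrite Ind_emb ?triv //; first exact: trv_bullet.
by apply: fixes_pt_Ghat => //; exact: trv_fixes_pt.
Qed.

Lemma Ghat_conj L1 M1 L2 M2 h g : rowact L1 h = L2 -> corowact M1 h = M2 ->
  (h * g * h^-1)%g \in Ghat L1 M1 = (g \in Ghat L2 M2).
Proof.
move=> hL hM; apply/GhatP/GhatP => -[gL gM].
  rewrite -hL -hM !rowactM !corowactM; split; first by rewrite -{2}gL rowactM mulgVK.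
  by rewrite -{2}gM corowactM mulgVK.
rewrite -!rowactM -!corowactM hL hM gL gM -hL -hM.
by rewrite rowactM corowactM mulgV rowact1 corowact1.
Qed.

Lemma Ghat_transporter L1 M1 L2 M2 g h : rowact L1 h = L2 -> corowact M1 h = M2 ->
  rowact L1 g = L2 -> corowact M1 g = M2 -> (g * h^-1)%g \in Ghat L1 M1.
Proof.
move=> hL hM gL gM; apply/GhatP; rewrite -rowactM -corowactM gL gM -hL -hM.
by rewrite rowactM corowactM mulgV rowact1 corowact1.
Qed.

Lemma emb_neq0 L M (tau : urep K (Ghat L M)) (w : tau) : w != 0 -> emb w != 0.
Proof.
move=> w0; apply: contra w0 => /eqP e0.
by have := val_at_emb w 1%g; rewrite gpred1 ur_act1 e0 val_at0 => ->.
Qed.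

Lemma neq0_val_at L M (tau : urep K (Ghat L M)) (f : l2_hilbert (rcosets (Ghat L M)) tau) :
  f != 0 -> exists h, val_at f h != 0.
Proof.
move=> f0; apply: contrapT => /forallNP nh; case/eqP: f0.
apply: val_at_inj => h; rewrite val_at0.
by apply: contrapT => /eqP; exact: nh.
Qed.

Lemma irreducible_val_at L M (tau : urep K (Ghat L M)) : irreducible predT (Ind tau) ->
  exists w : tau, w != 0.
Proof. by move=> [[f /neq0_val_at[h fh]] _]; exists (val_at f h). Qed.

Section TwoRepresentations.
Variables (L1 M1 L2 M2 : set (nat -> R)).
Variables (tau1 : urep K (Ghat L1 M1)) (tau2 : urep K (Ghat L2 M2)).
Hypotheses (fL1 : fg_submodule L1) (fM1 : fg_submodule M1).
Hypotheses (fL2 : fg_submodule L2) (fM2 : fg_submodule M2).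

(** The copy of tau1 in its induced representation, translated by h^-1, has coefficient at g equal
    to that of tau1 at h g h^-1, hence that of tau2 on [Ghat L2 M2] and 0 outside. *)
Lemma Ind_conj_equivalent h : rowact L1 h = L2 -> corowact M1 h = M2 ->
  unitarily_equivalent (Ghat L2 M2) (ur_act tau2) (fun q => ur_act tau1 (h * q * h^-1)%g) ->
  unitarily_equivalent predT (Ind tau1) (Ind tau2).
Proof.
move=> hL hM [U [Ul [V UK VK] Ud Ua]]; have ua := Ind_unitary tau1.
have hdotE g w w' : hdot _ (Ind tau1 g (Ind tau1 h^-1%g (emb (U w)))) (Ind tau1 h^-1%g (emb (U w')))
    = hdot _ (val_at (emb (U w)) (h * g * h^-1)%g) (U w').
  rewrite hdotC (ua_hdotV ua) invgK -hdotC -!(uaM ua) hdot_emb val_at_Ind mul1g.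
  by [].
apply: (Ind_equivalent (iota := fun w => Ind tau1 h^-1%g (emb (U w)))) => //.
- move=> z zU; apply: (emb_cyclic (nu := tau1)) => g w; rewrite -(VK w).
  by have := zU (g * h)%g (V w); rewrite -(uaM ua) mulgK.
- move=> g w w' gQ; rewrite hdotE val_at_emb (Ghat_conj _ hL hM) gQ.
  by rewrite -Ua // Ud.
- move=> g w w' gQ; rewrite hdotE val_at_emb (Ghat_conj _ hL hM) (negPf gQ).
  by rewrite linear0l.
Qed.

(** Group elements act injectively, so the two inclusions force the finite modules to have equal
    cardinality. *)
Lemma sub_rowact_eq h h' : rowact L1 h `<=` L2 -> rowact L2 h' `<=` L1 -> rowact L1 h = L2.
Proof.
move=> s1 s2; apply: (scard_eq (fg_finite fL2)) => //.
rewrite scard_rowact // -(scard_rowact h' fL2).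
by apply: scard_le => //; exact: fg_finite.
Qed.

Lemma sub_corowact_eq h h' : corowact M1 h `<=` M2 -> corowact M2 h' `<=` M1 -> corowact M1 h = M2.
Proof.
move=> s1 s2; apply: (scard_eq (fg_finite fM2)) => //.
rewrite scard_corowact // -(scard_corowact h' fM2).
by apply: scard_le => //; exact: fg_finite.
Qed.

End TwoRepresentations.

(** The inverse [S] of the intertwiner carries the embedded tau2 to functions supported on a single
    coset Ghat L1 M1 h; evaluation at h is the equivalence of tau2 with the conjugate of tau1. *)
Lemma Ind_equivalent_conj L1 M1 L2 M2 (tau1 : urep K (Ghat L1 M1)) (tau2 : urep K (Ghat L2 M2)) :
  fg_submodule L1 -> fg_submodule M1 -> fg_submodule L2 -> fg_submodule M2 ->
  {in Gbullet L1 M1, forall g v, ur_act tau1 g v = v} ->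
  {in Gbullet L2 M2, forall g v, ur_act tau2 g v = v} ->
  (exists w : tau1, w != 0) -> (exists w : tau2, w != 0) ->
  unitarily_equivalent predT (Ind tau1) (Ind tau2) ->
  exists h : GL R, [/\ rowact L1 h = L2, corowact M1 h = M2 &
    unitarily_equivalent (Ghat L2 M2) (ur_act tau2) (fun q => ur_act tau1 (h * q * h^-1)%g)].
Proof.
move=> fL1 fM1 fL2 fM2 triv1 triv2 [w1 w1n] [w2 w2n] [T [Tl [S TK SK] Td Ta]].
have uI1 := Ind_unitary tau1; have uI2 := Ind_unitary tau2.
have Tinj := can_inj TK; have Sinj := can_inj SK.
have Sl : linear S by move=> k u v; apply: Tinj; rewrite Tl !SK.
have Sa g f : S (Ind tau2 g f) = Ind tau1 g (S f) by apply: Tinj; rewrite Ta // !SK.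
have T0 f : f != 0 -> T f != 0.
  by move=> f0; apply: contra f0 => /eqP Tf; rewrite -(TK f) Tf (linear_zero Sl).
have S0 f : f != 0 -> S f != 0.
  by move=> f0; apply: contra f0 => /eqP Sf; rewrite -(SK f) Sf (linear_zero Tl).
have Sfix w : tfixed (Ind tau1) L2 M2 (S (emb w)).
  by move=> phi a pL aM aphi; rewrite -Sa (emb_tfixed w fL2 fM2 triv2 pL aM aphi).
have Tfix w : tfixed (Ind tau2) L1 M1 (T (emb w)).
  by move=> phi a pL aM aphi; rewrite -Ta // (emb_tfixed w fL1 fM1 triv1 pL aM aphi).
(* A nonzero vector of the second representation fixed for (L1, M1) supplies the inclusions in the
   opposite direction. *)
have [h' h'w] := neq0_val_at (T0 _ (emb_neq0 w1n)).
have [sL' sM'] := tfixed_support n_gt1 fL2 fM2 fL1 fM1 (Tfix w1) h'w.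
have trans g w : val_at (S (emb w)) g != 0 -> rowact L1 g = L2 /\ corowact M1 g = M2.
  move=> gw; have [sL sM] := tfixed_support n_gt1 fL1 fM1 fL2 fM2 (Sfix w) gw.
  by split; [exact: sub_rowact_eq sL sL'|exact: sub_corowact_eq sM sM'].
have [h hw] := neq0_val_at (S0 _ (emb_neq0 w2n)).
have [hL hM] := trans h w2 hw.
have SE w : S (emb w) = Ind tau1 h^-1%g (emb (val_at (S (emb w)) h)).
  apply: supported_emb => g /trans[gL gM]; exact: Ghat_transporter hL hM gL gM.
(* The translate by h^-1 is fixed for (L1 h, M1 (h^t)^-1) = (L2, M2), so its image is supported on
   [Ghat L2 M2]. This gives surjectivity of the evaluation map. *)
have TE w : T (Ind tau1 h^-1%g (emb w)) =
    emb (val_at (T (Ind tau1 h^-1%g (emb w))) 1%g).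
  rewrite {1}(@supported_emb _ _ _ tau2 (T (Ind tau1 h^-1%g (emb w))) 1%g) ?invg1 ?(@ua1 _ _ _ _ uI2) //.
  have fix2 : tfixed (Ind tau2) L2 M2 (T (Ind tau1 h^-1%g (emb w))).
    move=> phi a pL aM aphi; rewrite -Ta //; congr (T _).
    have := tfixed_conj (g := h^-1%g) uI1 _ (emb_tfixed w fL1 fM1 triv1).
    rewrite invgK hL hM; apply=> // v Mv.
    by have [m Mm] := fg_lowset fM1; exact: lowset_finsupp Mm Mv.
  move=> g /(tfixed_support n_gt1 fL2 fM2 fL2 fM2 fix2)[sL sM].
  rewrite ?invg1 mulg1; apply/GhatP; split.
    by apply: (sub_rowact_eq fL2 fL2 sL (h' := 1%g)); rewrite rowact1.
  by apply: (sub_corowact_eq fM2 fM2 sM (h' := 1%g)); rewrite corowact1.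
exists h; split=> //.
exists (fun w => val_at (S (emb w)) h); split.
- by move=> k u v; rewrite emb_linear Sl val_at_linear.
- exists (fun w => val_at (T (Ind tau1 h^-1%g (emb w))) 1%g) => w.
    by rewrite -SE SK val_at_emb gpred1 ur_act1.
  by rewrite -TE TK val_at_Ind mulgV val_at_emb gpred1 ur_act1.
- move=> u v; rewrite -hdot_emb_emb -[RHS]hdot_emb_emb -[in RHS](SK (emb u)) -[in RHS](SK (emb v)).
  by rewrite Td (SE u) (SE v) (ua_hdot uI1) !val_at_Ind !mulgV !val_at_emb gpred1 !ur_act1.
- move=> q qQ w; rewrite -Ind_emb // Sa val_at_Ind.
  have hq : (h * q * h^-1)%g \in Ghat L1 M1 by rewrite (Ghat_conj _ hL hM).
  by rewrite -(val_at_mul _ _ hq) mulgVK.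
Qed.

End Uniqueness.

(** * Existence of the inducing data *)

Section Classification.
Variables (K : realType) (n : nat) (n_gt1 : (1 < n)%N).
Local Notation R := 'Z_n.

Lemma adherent_closed (H : hilbert K) (C : {pred H}) :
  (forall u, adherent (fun v => v \in C) u -> u \in C) -> closed [set` C].
Proof.
move=> Cad u uC; apply: Cad => e e0; have e0' : 0 < e%:C%C by have := e0; rewrite -ltcR.
have [v [/= vC uv]] := uC _ (nbhsx_ballx u e%:C%C e0').
by exists v => //; rewrite rnorm_lt; move: uv; rewrite -ball_normE.
Qed.

Lemma adherent_perp (H : hilbert K) (C : H -> Prop) u z : adherent C u ->
  (forall v, C v -> hdot H v z = 0) -> hdot H u z = 0.
Proof.
move=> uC Cz; suff key y : (forall v, C v -> rdot v y = 0) -> rdot u y = 0.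
  apply: hdot0_rdot => k; apply: key => v Cv.
  by rewrite /rdot linearZr_LR /= Cz // mulr0.
move=> Cy; apply/eqP; rewrite -normr_le0; apply/ler_addgt0Pl => e e0; rewrite addr0.
have p0 : 0 < rnorm y + 1 by rewrite ltr_wpDl ?rnorm_ge0.
have [v Cv uv] := uC _ (divr_gt0 e0 p0).
have -> : rdot u y = rdot (u - v) y by rewrite rdotBl (Cy v Cv) subr0.
apply: le_trans (rdot_le _ _) _; move: uv; rewrite ltr_pdivlMr // => uv.
by have := rnorm_ge0 (u - v); move: uv; lra.
Qed.

Lemma irreducible_cyclic (A : comNzRingType) (H : hilbert K) (act : GL A -> H -> H)
    (V : Type) (i : V -> H) w :
  unitary_action act -> irreducible predT act -> i w != 0 -> cyclic act i.
Proof.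
move=> ua [_ irr] iw0.
(* E is the double orthogonal of the orbit of i. *)
pose Z z := forall g w, hdot H z (act g (i w)) = 0.
pose E : {pred H} := [pred v | `[< forall z, Z z -> hdot H v z = 0 >]].
have Estable g z : Z z -> Z (act g z) by move=> Zz h w'; rewrite (ua_hdotV ua) -(uaM ua) Zz.
have [|||E0|ET] := irr E.
- split=> [|k u v /asboolP uE /asboolP vE]; apply/asboolP => z Zz; first by rewrite linear0l.
  by rewrite linearDl linearZl_LR /= uE // vE // mulr0 addr0.
- apply: adherent_closed => u uE; apply/asboolP => z Zz.
  by apply: adherent_perp uE _ => v /asboolP; exact.
- move=> g _ v /asboolP vE; apply/asboolP => z Zz.
  by rewrite (ua_hdotV ua) vE //; exact: Estable.
- have : i w \in E.
    by apply/asboolP => z Zz; rewrite hdotC -[i w](ua1 ua) Zz conjC0.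
  by rewrite E0 inE (negPf iw0).
move=> z Zz; have /asboolP zz : z \in E by rewrite ET.
by apply: nsq_eq0; apply: complexI; rewrite -hdot_nsq zz.
Qed.

Variable pi : urep K (predT : {pred GL R}).
Implicit Types (L M : set (nat -> R)) (g : GL R).
Let act := ur_act pi.
Let ua : unitary_action act := urep_unitary pi.

(** The pair is hidden behind the number |L| + |M| so that a minimal one can be selected. *)
Definition has_tfixed (N : nat) : Prop := exists L M,
  [/\ fg_submodule L, fg_submodule M, exists2 v, v != 0 & tfixed act L M v
    & N = (scard L + scard M)%N].

(** For L = M = R^m the attached transvections lie in [Kg m], and for a suitable m this subgroup
    fixes a nonzero vector. *)
Lemma has_tfixed_ex : (exists v : pi, v != 0) -> exists N, `[< has_tfixed N >].
Proof.
move=> [v /urep_fixed_vector[m [u [u0 uK]]]].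
pose F : set (nat -> R) := [set x | low m x].
have highF phi : ann F phi -> high m phi.
  by move=> [_ pF] i im; rewrite -[LHS]dotp_delta dotpC pF //; exact: low_delta.
exists (scard F + scard F)%N; apply/asboolP; exists F, F; split=> //; try exact: fg_full.
exists u => // phi a pF aF aphi; apply: uK; apply: trv_Kg; try exact: highF.
by split=> //; [exact: pF.1|exact: aF.1].
Qed.

Lemma leq_add_squeeze (a b c d : nat) : (a + b <= c + d)%N -> (c <= a)%N -> (d <= b)%N ->
  (a <= c)%N /\ (b <= d)%N.
Proof. lia. Qed.

(** A nonzero product would give a nonzero vector in the space of the intersections of (L, M) with
    its translate by g^-1. By minimality the intersections are [L] and [M], and equal cardinalities
    make the translate equal to (L, M), so g would stabilize the pair. *)
Lemma minimal_orthogonal L M g v w : fg_submodule L -> fg_submodule M ->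
  (forall N, has_tfixed N -> (scard L + scard M <= N)%N) ->
  tfixed act L M v -> tfixed act L M w -> g \notin Ghat L M -> hdot pi (act g v) w = 0.
Proof.
move=> fL fM minN vt wt gQ.
have Mf x : M x -> finsupp x.
  by have [m Mm] := fg_lowset fM; exact: lowset_finsupp Mm.
pose L' := rowact L g^-1%g; pose M' := corowact M g^-1%g.
have fL' : fg_submodule L' by exact: fg_rowact.
have fM' : fg_submodule M' by exact: fg_corowact.
have gvt : tfixed act L' M' (act g v) by exact: tfixed_conj.
have [m [L'm M'm Lm Mm]] := fg_lowset4 fL' fM' fL fM.
have [u ut ->] := @tfixed_setI K n n_gt1 pi act ua m L' M' L M (act g v) w fL' fM' fL fM
  L'm M'm Lm Mm (tfixed_Kfixed gvt L'm M'm) (tfixed_Kfixed wt Lm Mm) gvt wt.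
have [->|u0] := eqVneq u 0; first by rewrite linear0l.
case/negP: gQ.
have {}minN : (scard L + scard M <= scard (L' `&` L) + scard (M' `&` M))%N.
  apply: minN; exists (L' `&` L), (M' `&` M); split=> //; try exact: fg_setI.
  by exists u.
have sL := scard_le (fg_finite fL) (@subIsetr _ L' L).
have sM := scard_le (fg_finite fM) (@subIsetr _ M' M).
have [hL hM] := leq_add_squeeze minN sL sM.
have eL : L' `&` L = L := scard_eq (fg_finite fL) (@subIsetr _ _ _) hL.
have eM : M' `&` M = M := scard_eq (fg_finite fM) (@subIsetr _ _ _) hM.
have LL' : L = L'.
  apply: scard_eq (fg_finite fL') _ _; last by rewrite scard_rowact.
  by rewrite -{1}eL; exact: subIsetl.
have MM' : M = M'.
  apply: scard_eq (fg_finite fM') _ _; last by rewrite scard_corowact.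
  by rewrite -{1}eM; exact: subIsetl.
by rewrite -(gpredV (Ghat L M)); apply/GhatP; split.
Qed.

Lemma tfixed_space_stable L M : fg_submodule M ->
  {in Ghat L M, forall g, {in cs_pred (tfixed_space pi L M), forall v,
    ur_act pi g v \in cs_pred (tfixed_space pi L M)}}.
Proof.
move=> fM g gQ v /tfixed_predP vt; apply/tfixed_predP.
have gVQ : g^-1%g \in Ghat L M by rewrite gpredV.
have [m Mm] := fg_lowset fM; have /GhatP[gL gM] := gVQ.
have := tfixed_conj (g := g) ua (fun w => @lowset_finsupp _ _ _ w Mm) vt.
by rewrite gL gM.
Qed.

Theorem irreducible_induced : irreducible predT act ->
  exists L M (tau : urep K (Ghat L M)),
    [/\ fg_submodule L, fg_submodule M,
        {in Gbullet L M, forall g v, ur_act tau g v = v} &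
        unitarily_equivalent predT act (Ind tau)].
Proof.
move=> irr; have [N /asboolP[L [M [fL fM [v0 v0n v0t] NE]]] Nmin] :=
  ex_minnP (has_tfixed_ex irr.1).
have minN k : has_tfixed k -> (scard L + scard M <= k)%N.
  by move=> hk; rewrite -NE; apply: Nmin; exact/asboolP.
pose tau := restrict_rep (tfixed_space_stable fM) (@GhatM R L M).
have tauE g (v : tau) : g \in Ghat L M -> val (ur_act tau g v) = act g (val v).
  exact: (restrict_actE (tfixed_space_stable fM)).
have tauP (v : tau) : tfixed act L M (val v) by apply/tfixed_predP; exact: ss_valP.
exists L, M, tau; split=> //.
  move=> g gB v; apply: val_inj; rewrite tauE; first exact: tfixed_bullet gB.
  by have [m [_ _ gp _]] := bullet_tensor gB; exact: fixes_pt_Ghat.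
apply: (Ind_equivalent (iota := fun v : tau => val v : pi)) => //.
- have v0S : v0 \in cs_pred (tfixed_space pi L M) by exact/tfixed_predP.
  exact: (irreducible_cyclic (w := MkSubspace v0S)).
- by move=> g w w' gQ; rewrite -tauE.
- by move=> g w w' gQ; apply: minimal_orthogonal gQ.
Qed.

End Classification.

Theorem theorem1p5 (K : realType) (p mu : nat)
    (p_prime : prime p) (p_gt2 : (2 < p)%N) (mu_gt0 : (0 < mu)%N) :
  (forall pi : urep K (predT : {pred GL 'Z_(p ^ mu)}),
    irreducible predT (ur_act pi) ->
    exists (L M : set (nat -> 'Z_(p ^ mu))) (tau : urep K (Ghat L M)),
      [/\ fg_submodule L, fg_submodule M,
          {in Gbullet L M, forall g v, ur_act tau g v = v} &
          unitarily_equivalent predT (ur_act pi) (Ind tau)])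
  /\
  (forall (L1 M1 L2 M2 : set (nat -> 'Z_(p ^ mu)))
      (tau1 : urep K (Ghat L1 M1)) (tau2 : urep K (Ghat L2 M2)),
    fg_submodule L1 -> fg_submodule M1 ->
    fg_submodule L2 -> fg_submodule M2 ->
    {in Gbullet L1 M1, forall g v, ur_act tau1 g v = v} ->
    {in Gbullet L2 M2, forall g v, ur_act tau2 g v = v} ->
    irreducible predT (Ind tau1) ->
    irreducible predT (Ind tau2) ->
    (unitarily_equivalent predT (Ind tau1) (Ind tau2) <->
     exists h : GL 'Z_(p ^ mu),
       [/\ rowact L1 h = L2, corowact M1 h = M2 &
           unitarily_equivalent (Ghat L2 M2) (ur_act tau2)
             (fun q => ur_act tau1 (h * q * h^-1)%g)])).
Proof.
have n_gt1 : (1 < p ^ mu)%N by rewrite -(exp1n mu) ltn_exp2r // prime_gt1.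
split; first exact: irreducible_induced.
move=> L1 M1 L2 M2 tau1 tau2 fL1 fM1 fL2 fM2 triv1 triv2 irr1 irr2; split.
  by apply: Ind_equivalent_conj => //; exact: irreducible_val_at.
by move=> [h [hL hM]]; exact: Ind_conj_equivalent.
Qed.
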